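(* Let $B$ be a finite dimensional graded co-commutative Hopf algebra over a field $k$ of positive characteristic satisfying the tensor product property. Then every thick ideal of $\mathrm{stmod}(B)$ admits a unique Krull-Schmidt decomposition. Conversely, given thick ideals $(\mathcal{T}_i)_{i\in I}$ in $\mathrm{stmod}(B)$ satisfying $\mathcal{T}_i\cap\mathcal{T}_j=0$ for $i\neq j$, there exists a thick ideal $\mathcal{T}$ of $\mathrm{stmod}(B)$ such that $\mathcal{T}=\coprod_{i\in I}\mathcal{T}_i$. Moreover, $$K_0(\mathcal{T})\cong\bigoplus_{i\in I}K_0(\mathcal{T}_i).$$
   Context: **Thick ideals.** All subcategories are full. A thick subcategory of a triangulated category is a full triangulated subcategory closed under retracts. In a tensor triangulated category $\mathcal{K}$ with product $\wedge$, a thick subcategory $\mathcal{A}$ is a thick ideal if $X\wedge Y\in\mathcal{A}$ for all $X\in\mathcal{A}$, $Y\in\mathcal{K}$. A family of thick ideals $(\mathcal{A}_i)_{i\in I}$ is a decomposition of a thick ideal $\mathcal{A}$, written $\mathcal{A}=\coprod_i\mathcal{A}_i$, if the objects of $\mathcal{A}$ are exactly the finite coproducts of objects from the $\mathcal{A}_i$, and $\mathcal{A}_i\cap\mathcal{A}_j=0$ for $i\neq j$. $\mathcal{A}$ is indecomposable if $\mathcal{A}\ne0$ and any decomposition $\mathcal{A}=\mathcal{C}\amalg\mathcal{D}$ has $\mathcal{C}=0$ or $\mathcal{D}=0$. A Krull-Schmidt decomposition is a decomposition into indecomposable thick ideals which is unique (any other such decomposition agrees with it up to a permutation of the indices). $K_0$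 of an essentially small triangulated category is the free abelian group on isomorphism classes of objects modulo $[B]=[A]+[C]$ for each exact triangle $A\to B\to C\to\Sigma A$. **The category $\mathrm{stmod}(B)$.** The stable module category: objects are finitely generated graded $B$-modules, morphisms are $B$-module homomorphisms modulo those factoring through a projective module, with tensor product $\otimes_k$ with diagonal action. **The category $K(\mathrm{Proj}\,B)$.** Objects: unbounded chain complexes of graded projective $B$-modules; morphisms: chain homotopy classes of chain maps. It is tensor triangulated with $X\wedge Y=X\otimes_k Y$ with diagonal action; the unit $S$ is the resolution $0\to k\to P^0\to P^1\to\cdots$ of $k$ by projective (equivalently, injective) modules. An object $X$ is small (= finite) if $[X,-]$ commutes with arbitrary coproducts. $[X,Y]_*$ denotes the bigraded group of morphisms, and $\pi_*(S)=[S,S]_*\cong\operatorname{Ext}_B^{*,*}(k,k)$, a bigraded Noetherian ring. For a bihomogeneous prime $\mathbf{q}$ of $\pi_*(S)$, $X\to X_{\mathbf{q}}$ is the localisation inducing $[A,X]_*\to([A,X]_* )_{\mathbf{q}}$ for all small $A$. **Tensor product property.** For a thick ideal $\mathcal{A}$ of small objects (a thick ideal of the category of small objects of $K(\mathrm{Proj}\,B)$), the finite localisation functor $L_{\mathcal{A}}$ is the localisation $X\to L_{\mathcal{A}}X$ whose fibre lies in the localising subcategory generated by $\mathcal{A}$ and such that $[A,L_{\mathcal{A}}X]_*=0$ for all $A\in\mathcal{A}$; its small acyclics are exactly the objects of $\mathcal{A}$. For a bihomogeneous prime $\mathbf{p}$ of $\pi_*(S)$, let $L_{\mathbf{p}}$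 and $L_{<\mathbf{p}}$ be the finite localisation functors whose finite acyclics are $\{X \text{ finite}: X_{\mathbf{q}}=0\ \forall\,\mathbf{q}\subseteq\mathbf{p}\}$ and $\{X\text{ finite}: X_{\mathbf{q}}=0\ \forall\,\mathbf{q}\subsetneq\mathbf{p}\}$ respectively, and let $M_{\mathbf{p}}$ be the fibre of the natural map $L_{\mathbf{p}}S\to L_{<\mathbf{p}}S$. $B$ satisfies the tensor product property if for all bihomogeneous primes $\mathbf{p}$ and all objects $X,Y$ of $K(\mathrm{Proj}\,B)$: $M_{\mathbf{p}}\wedge X\wedge Y=0$ if and only if $M_{\mathbf{p}}\wedge X=0$ or $M_{\mathbf{p}}\wedge Y=0$. *)

(* Defs.v *)
From HB Require Import structures.
From mathcomp Require Import all_boot all_order all_algebra all_field.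

Set Implicit Arguments.
Unset Strict Implicit.
Unset Printing Implicit Defensive.

Import GRing.Theory.
Local Open Scope ring_scope.

(** * Gradings *)

(* An internal direct sum decomposition V = (+)_(g : G) V_g, given by the
   projections x |-> x_g. *)
Record grading (G V : zmodType) := Grading {
  component :> G -> V -> V;
  componentD : forall g x y, component g (x + y) = component g x + component g y;
  component_proj : forall g h x,
    component g (component h x) = if g == h then component h x else 0;
  component_sum : forall x, exists s : seq G,
    uniq s /\ x = \sum_(g <- s) component g x
}.

Definition homog (G V : zmodType) (gr : grading G V) (g : G) (x : V) : Prop :=
  gr g x = x.

(* The Koszul sign (-1)^(ij), as an integer. *)
Definition ksign (i j : int) : int := (-1) ^ (i * j).

Lemma ksign0l i : ksign 0 i = 1.
Proof. by rewrite /ksign mul0r expr0z. Qed.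

Lemma ksignDl i j l : ksign (i + j) l = ksign i l * ksign j l.
Proof. by rewrite /ksign mulrDl exprzDr // unitrN1. Qed.

(** * Graded cocommutative Hopf algebras *)

(* An element of B (x) B is represented by a formal sum of pure tensors of
   homogeneous elements, each factor tagged with its degree (Sweedler notation).
   Two such sums are equal in B (x) B iff every bilinear map to a vector space
   takes the same value on them; identities in B (x) B and B (x) B (x) B are
   stated through this universal property.  [comult] chooses a representative
   of each coproduct. *)
Section Hopf.
Variables (k : fieldType) (B : falgType k).

Definition bilinear2 (W : lmodType k) (b : B -> B -> W) : Prop :=
  (forall c x x' y, b (c *: x + x') y = c *: b x y + b x' y) /\
  (forall c x y y', b x (c *: y + y') = c *: b x y + b x y').

Definition trilinear3 (W : lmodType k) (t : B -> B -> B -> W) : Prop :=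
  [/\ forall c x x' y z, t (c *: x + x') y z = c *: t x y z + t x' y z,
      forall c x y y' z, t x (c *: y + y') z = c *: t x y z + t x y' z
    & forall c x y z z', t x y (c *: z + z') = c *: t x y z + t x y z'].

Record hopf_algebra := HopfAlgebra {
  hgr : grading int B;
  hgrZ : forall i (c : k) x, hgr i (c *: x) = c *: hgr i x;
  hgr1 : homog hgr 0 1;
  hgrM : forall i j x y,
    homog hgr i x -> homog hgr j y -> homog hgr (i + j) (x * y);

  comult : B -> seq ((int * B) * (int * B));
  comult_homog : forall b t, t \in comult b ->
    homog hgr t.1.1 t.1.2 /\ homog hgr t.2.1 t.2.2;
  comult_deg : forall n b t,
    homog hgr n b -> t \in comult b -> t.1.1 + t.2.1 = n;
  comult_linear : forall (W : lmodType k) (f : B -> B -> W), bilinear2 f ->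
    forall c a b,
    \sum_(t <- comult (c *: a + b)) f t.1.2 t.2.2 =
    c *: (\sum_(t <- comult a) f t.1.2 t.2.2)
      + \sum_(t <- comult b) f t.1.2 t.2.2;
  comultA : forall (W : lmodType k) (f : B -> B -> B -> W), trilinear3 f ->
    forall b,
    \sum_(t <- comult b) \sum_(u <- comult t.1.2) f u.1.2 u.2.2 t.2.2 =
    \sum_(t <- comult b) \sum_(u <- comult t.2.2) f t.1.2 u.1.2 u.2.2;
  comult1 : forall (W : lmodType k) (f : B -> B -> W), bilinear2 f ->
    \sum_(t <- comult 1) f t.1.2 t.2.2 = f 1 1;
  comultM : forall (W : lmodType k) (f : B -> B -> W), bilinear2 f ->
    forall a b,
    \sum_(t <- comult (a * b)) f t.1.2 t.2.2 =
    \sum_(s <- comult a) \sum_(t <- comult b)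
      f (s.1.2 * t.1.2) (s.2.2 * t.2.2) *~ ksign s.2.1 t.1.1;

  counit : B -> k;
  counit_linear : forall c a b, counit (c *: a + b) = c * counit a + counit b;
  counit1 : counit 1 = 1;
  counitM : forall a b, counit (a * b) = counit a * counit b;
  counit_deg : forall i b, homog hgr i b -> i != 0 -> counit b = 0;
  counitl : forall b, \sum_(t <- comult b) counit t.1.2 *: t.2.2 = b;
  counitr : forall b, \sum_(t <- comult b) counit t.2.2 *: t.1.2 = b;

  antipode : B -> B;
  antipode_linear : forall (c : k) a b,
    antipode (c *: a + b) = c *: antipode a + antipode b;
  antipode_deg : forall i b, homog hgr i b -> homog hgr i (antipode b);
  antipodel : forall b,
    \sum_(t <- comult b) antipode t.1.2 * t.2.2 = (counit b)%:A;
  antipoder : forall b,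
    \sum_(t <- comult b) t.1.2 * antipode t.2.2 = (counit b)%:A
}.

Definition graded_cocommutative (H : hopf_algebra) : Prop :=
  forall (W : lmodType k) (f : B -> B -> W), bilinear2 f -> forall b,
    \sum_(t <- comult H b) f t.1.2 t.2.2 =
    \sum_(t <- comult H b) f t.2.2 t.1.2 *~ ksign t.1.1 t.2.1.

End Hopf.

(** * Tensor triangulated categories *)

(* The data of a tensor triangulated category which is presented as the stable
   category of an exact category: [heq] is the congruence on morphisms (maps
   modulo those factoring through projectives, resp. chain homotopy), [ses] says
   that two composable maps of the exact category form a short exact sequence,
   and [ten X Y Z] says that Z is a tensor product of X and Y.  No laws are
   required, since only definitions are based on these data. *)
Record ttdata := TTData {
  ob : Type;
  hom : ob -> ob -> Type;
  heq : forall X Y : ob, hom X Y -> hom X Y -> Prop;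
  hzero : forall X Y : ob, hom X Y;
  hadd : forall X Y : ob, hom X Y -> hom X Y -> hom X Y;
  idm : forall X : ob, hom X X;
  comp : forall X Y Z : ob, hom Y Z -> hom X Y -> hom X Z;
  ses : forall X Y Z : ob, hom X Y -> hom Y Z -> Prop;
  ten : ob -> ob -> ob -> Prop
}.

Arguments heq {t X Y} f g.
Arguments hzero {t} X Y.
Arguments hadd {t X Y} f g.
Arguments idm {t} X.
Arguments comp {t X Y Z} g f.
Arguments ses {t X Y Z} f g.
Arguments ten {t} X Y Z.

Section TensorTriangulated.
Variable C : ttdata.

Definition is_iso (X Y : ob C) (f : hom X Y) : Prop :=
  exists g : hom Y X, heq (comp g f) (idm X) /\ heq (comp f g) (idm Y).

Definition isomorphic (X Y : ob C) : Prop := exists f : hom X Y, is_iso f.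

Definition is_zero (X : ob C) : Prop := heq (idm X) (hzero X X).

(* X -f-> Y -g-> Z is part of an exact triangle X -> Y -> Z -> Sigma X: the
   exact triangles are those isomorphic to the ones induced by short exact
   sequences. *)
Definition triangle (X Y Z : ob C) (f : hom X Y) (g : hom Y Z) : Prop :=
  exists (X' Y' Z' : ob C) (i : hom X' Y') (p : hom Y' Z')
         (a : hom X X') (b : hom Y Y') (c : hom Z Z'),
    [/\ ses i p, [/\ is_iso a, is_iso b & is_iso c],
        heq (comp b f) (comp i a) & heq (comp c g) (comp p b)].

Definition has_triangle (X Y Z : ob C) : Prop :=
  exists (f : hom X Y) (g : hom Y Z), triangle f g.

Definition is_coproduct (J : Type) (F : J -> ob C) (X : ob C)
    (inj : forall j, hom (F j) X) : Prop :=
  forall (Y : ob C) (f : forall j, hom (F j) Y),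
    exists u : hom X Y, (forall j, heq (comp u (inj j)) (f j)) /\
      forall v : hom X Y, (forall j, heq (comp v (inj j)) (f j)) -> heq v u.

(** Full subcategories are given by their objects. *)
Definition subcat := ob C -> Prop.

(* Closure under suspension and desuspension is the case Y = 0 of the last
   clause. *)
Definition triangulated_subcat (A : subcat) : Prop :=
  [/\ forall X Y, isomorphic X Y -> A X -> A Y,
      forall X, is_zero X -> A X
    & forall X Y Z, has_triangle X Y Z ->
        [/\ A X -> A Y -> A Z, A Y -> A Z -> A X & A X -> A Z -> A Y]].

Definition thick (A : subcat) : Prop :=
  triangulated_subcat A /\
  forall (X Y : ob C) (i : hom X Y) (r : hom Y X),
    heq (comp r i) (idm X) -> A Y -> A X.

Definition thick_ideal (A : subcat) : Prop :=
  thick A /\ forall X Y Z : ob C, ten X Y Z -> A X -> A Z.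

Definition trivial_intersection (A A' : subcat) : Prop :=
  forall X, A X -> A' X -> is_zero X.

Definition decomposition (I : Type) (Ai : I -> subcat) (A : subcat) : Prop :=
  [/\ forall i, thick_ideal (Ai i),
      forall X, A X <->
        exists (n : nat) (c : 'I_n -> I) (F : 'I_n -> ob C)
               (inj : forall j, hom (F j) X),
          (forall j, Ai (c j) (F j)) /\ is_coproduct inj
    & forall i j, i <> j -> trivial_intersection (Ai i) (Ai j)].

Definition zero_subcat (A : subcat) : Prop := forall X, A X -> is_zero X.

Definition indecomposable (A : subcat) : Prop :=
  ~ zero_subcat A /\
  forall C1 C2 : subcat,
    decomposition (fun b : bool => if b then C1 else C2) A ->
    zero_subcat C1 \/ zero_subcat C2.

Definition indecomposable_decomposition (I : Type) (Ai : I -> subcat)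
    (A : subcat) : Prop :=
  decomposition Ai A /\ forall i, indecomposable (Ai i).

Definition has_unique_Krull_Schmidt (A : subcat) : Prop :=
  exists (I : Type) (Ai : I -> subcat),
    indecomposable_decomposition Ai A /\
    forall (J : Type) (Aj : J -> subcat), indecomposable_decomposition Aj A ->
      exists s : I -> J, bijective s /\ forall i X, Ai i X <-> Aj (s i) X.

(* Every type carries an eqType structure classically, so these are arbitrary
   coproducts. *)
Definition localising (A : subcat) : Prop :=
  thick A /\
  forall (J : eqType) (F : J -> ob C) (X : ob C) (inj : forall j, hom (F j) X),
    (forall j, A (F j)) -> is_coproduct inj -> A X.

Definition localising_gen (A : subcat) : subcat := fun X =>
  forall L : subcat, localising L -> (forall Y, A Y -> L Y) -> L X.

(* [X, -] commutes with coproducts: the canonical map from the direct sum of the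
   [X, F j] to [X, coprod_j F j] is bijective. *)
Definition finite_sum_map (J : eqType) (F : J -> ob C) (X Y : ob C)
    (inj : forall j, hom (F j) Y) (s : seq J) (f : forall j, hom X (F j)) :
    hom X Y :=
  foldr (fun j a => hadd (comp (inj j) (f j)) a) (hzero X Y) s.

Definition small (X : ob C) : Prop :=
  forall (J : eqType) (F : J -> ob C) (Y : ob C) (inj : forall j, hom (F j) Y),
    is_coproduct inj ->
    (forall g : hom X Y, exists (s : seq J) (f : forall j, hom X (F j)),
       uniq s /\ heq g (finite_sum_map inj s f)) /\
    (forall (s : seq J) (f : forall j, hom X (F j)), uniq s ->
       heq (finite_sum_map inj s f) (hzero X Y) ->
       forall j, j \in s -> heq (f j) (hzero X (F j))).

(* K_0 by generators and relations: an element is represented by a formal sum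
   of signed objects ([true] is +, [false] is -), and [K0eq] is the congruence
   generated by the axioms of abelian groups and the defining relations. *)
Definition K0word (A : subcat) := seq (bool * {X : ob C | A X}).

Inductive K0eq (A : subcat) : K0word A -> K0word A -> Prop :=
| K0refl u : K0eq u u
| K0sym u v : K0eq u v -> K0eq v u
| K0trans u v w : K0eq u v -> K0eq v w -> K0eq u w
| K0cat u u' v v' : K0eq u u' -> K0eq v v' -> K0eq (u ++ v) (u' ++ v')
| K0comm u v : K0eq (u ++ v) (v ++ u)
| K0opp b X : K0eq [:: (b, X); (~~ b, X)] [::]
| K0iso X Y : isomorphic (sval X) (sval Y) ->
    K0eq [:: (true, X)] [:: (true, Y)]
| K0triangle X Y Z : has_triangle (sval X) (sval Y) (sval Z) ->
    K0eq [:: (true, Y)] [:: (true, X); (true, Z)].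

(* An isomorphism from K_0(A) onto the direct sum of the K_0(Ai i), viewed as
   the subgroup of finitely supported families in the product. *)
Definition K0_direct_sum (I : Type) (Ai : I -> subcat) (A : subcat) : Prop :=
  exists phi : K0word A -> forall i, K0word (Ai i),
    let fin_supp (w : forall i, K0word (Ai i)) :=
      exists (n : nat) (s : 'I_n -> I),
        forall i, (exists j, s j = i) \/ K0eq (w i) [::] in
    [/\ forall u v, K0eq u v <-> forall i, K0eq (phi u i) (phi v i),
        forall u v i, K0eq (phi (u ++ v) i) (phi u i ++ phi v i),
        forall u, fin_supp (phi u)
      & forall w, fin_supp w -> exists u, forall i, K0eq (phi u i) (w i)].

End TensorTriangulated.

(** * Graded and bigraded modules *)

(* Degree groups of modules over the Z-graded algebra B: [dinc i] is the degree
   of an element of B of degree i, and [dint g] is the internal degree which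
   enters the Koszul signs. *)
Record degrees := Degrees {
  dgrp :> zmodType;
  dinc : int -> dgrp;
  dint : dgrp -> int
}.

Definition deg1 : degrees := @Degrees int id id.

(* (homological degree, internal degree) *)
Definition deg2 : degrees :=
  @Degrees (int * int)%type (fun i => (0, i)) (fun g => g.2).

Section Modules.
Variables (k : fieldType) (B : falgType k) (H : hopf_algebra B).

Section OverDegrees.
Variable D : degrees.

Record gmod := GMod {
  gcar :> lmodType B;
  ggr : grading D gcar;
  gact : forall i g (b : B) (x : gcar),
    homog (hgr H) i b -> homog ggr g x -> homog ggr (dinc D i + g) (b *: x)
}.

Record ghom (M N : gmod) := GHom {
  gfun :> {linear M -> N};
  gfun_deg : forall g x, homog (ggr M) g x -> homog (ggr N) g (gfun x)
}.

Definition projective (P : gmod) : Prop :=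
  forall (M N : gmod) (p : ghom M N) (f : ghom P N),
    (forall y, exists x, p x = y) -> exists h : ghom P M, forall x, p (h x) = f x.

Definition finitely_generated (M : gmod) : Prop :=
  exists s : seq M, forall x : M, exists c : nat -> B,
    x = \sum_(i < size s) c i *: s`_i.

Definition short_exact (M N P : gmod) (f : M -> N) (g : N -> P) : Prop :=
  [/\ injective f, forall z, exists y, g y = z
    & forall y, g y = 0 <-> exists x, f x = y].

(* k-bilinear maps, for a given scaling by k on the target. *)
Definition kbilinear (M N : gmod) (W : zmodType) (sc : k -> W -> W)
    (f : M -> N -> W) : Prop :=
  (forall c x x' y, f (c%:A *: x + x') y = sc c (f x y) + f x' y) /\
  (forall c x y y', f x (c%:A *: y + y') = sc c (f x y) + f x y').

Definition klinear (M : gmod) (W : lmodType k) (u : M -> W) : Prop :=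
  forall c x y, u (c%:A *: x + y) = c *: u x + u y.

(* (T, t) is the tensor product of M and N over k, with diagonal action of B. *)
Definition is_tensor (M N T : gmod) (t : M -> N -> T) : Prop :=
  [/\ kbilinear (fun c z => c%:A *: z) t,
      forall (W : lmodType k) (f : M -> N -> W), kbilinear *:%R f ->
        exists u : T -> W, [/\ klinear u, forall x y, u (t x y) = f x y
          & forall u' : T -> W, klinear u' ->
              (forall x y, u' (t x y) = f x y) -> u' =1 u],
      forall g h x y, homog (ggr M) g x -> homog (ggr N) h y ->
        homog (ggr T) (g + h) (t x y)
    & forall b g x y, homog (ggr M) g x ->
        b *: t x y = \sum_(s <- comult H b)
          t (s.1.2 *: x) (s.2.2 *: y) *~ ksign s.2.1 (dint g)].

Definition gid (M : gmod) : ghom M M :=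
  @GHom M M (idfun : {linear M -> M}) (fun _ _ hx => hx).

Definition gcomp (M N P : gmod) (g : ghom N P) (f : ghom M N) : ghom M P :=
  @GHom M P (g \o f : {linear M -> P})
    (fun _ _ hx => gfun_deg g (gfun_deg f hx)).

Lemma homogD (M : gmod) g (x y : M) :
  homog (ggr M) g x -> homog (ggr M) g y -> homog (ggr M) g (x + y).
Proof. by rewrite /homog componentD => -> ->. Qed.

Lemma homog0 (M : gmod) g : homog (ggr M) g 0.
Proof.
by apply: (@addrI _ (ggr M g 0)); rewrite -componentD !addr0.
Qed.

Definition gzero (M N : gmod) : ghom M N :=
  @GHom M N (\0 : {linear M -> N}) (fun g _ _ => homog0 N g).

Definition gadd (M N : gmod) (f g : ghom M N) : ghom M N :=
  @GHom M N (f \+ g : {linear M -> N})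
    (fun _ _ hx => homogD (gfun_deg f hx) (gfun_deg g hx)).

End OverDegrees.

(** * The stable module category *)

Record fgmod := FGMod {
  fgcar :> gmod deg1;
  fgcarP : finitely_generated fgcar
}.

Definition stably_equal (M N : gmod deg1) (f g : ghom M N) : Prop :=
  exists (P : gmod deg1) (a : ghom M P) (b : ghom P N),
    projective P /\ forall x, f x - g x = b (a x).

Definition stmod : ttdata := {|
  ob := fgmod;
  hom := fun M N => ghom M N;
  heq := fun M N => @stably_equal M N;
  hzero := fun M N => gzero M N;
  hadd := fun M N => @gadd deg1 M N;
  idm := fun M => gid M;
  comp := fun M N P => @gcomp deg1 M N P;
  ses := fun M N P f g => short_exact f g;
  ten := fun M N T => exists t : M -> N -> T, is_tensor t
|}.

(** * The homotopy category of complexes of projectives *)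

(* A complex ... -> X_n -> X_(n+1) -> ... of graded modules is encoded by the
   bigraded module (+)_n X_n with its differential.  Bigraded modules are the
   same as Z-indexed families of graded modules, and such a family is projective
   iff all its members are. *)
Record cplx := Cplx {
  cmod :> gmod deg2;
  cproj : projective cmod;
  cdif : {linear cmod -> cmod};
  cdif_deg : forall (n i : int) x,
    homog (ggr cmod) (n, i) x -> homog (ggr cmod) (n + 1, i) (cdif x);
  cdif2 : forall x, cdif (cdif x) = 0
}.

(* Maps of arbitrary bidegree d follow the Koszul sign rule for both degrees. *)
Definition is_gmap (d : int * int) (X Y : cplx) (f : X -> Y) : Prop :=
  [/\ forall x y, f (x + y) = f x + f y,
      forall i b x, homog (hgr H) i b -> f (b *: x) = b *: f x *~ ksign d.2 i
    & forall (g : int * int) x,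
        homog (ggr X) g x -> homog (ggr Y) (g + d) (f x)].

Definition is_cmap (d : int * int) (X Y : cplx) (f : X -> Y) : Prop :=
  is_gmap d f /\ forall x, cdif Y (f x) = f (cdif X x) *~ ksign d.1 1.

Record cmap (d : int * int) (X Y : cplx) := CMap {
  cfun :> X -> Y;
  cfunP : is_cmap d cfun
}.

Definition homotopic (d : int * int) (X Y : cplx) (f g : X -> Y) : Prop :=
  exists h : X -> Y, is_gmap (d.1 - 1, d.2) h /\
    forall x, f x - g x = cdif Y (h x) + h (cdif X x) *~ ksign d.1 1.

Definition is_ctensor (X Y T : cplx) (t : X -> Y -> T) : Prop :=
  is_tensor t /\
  forall (g : int * int) x y, homog (ggr X) g x ->
    cdif T (t x y) = t (cdif X x) y + t x (cdif Y y) *~ ksign g.1 1.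

Lemma additiveMz (X Y : zmodType) (f : X -> Y) :
  (forall x y, f (x + y) = f x + f y) -> forall x n, f (x *~ n) = f x *~ n.
Proof.
move=> fD x n.
have f0 : f 0 = 0 by apply: (@addrI _ (f 0)); rewrite -fD !addr0.
have fN y : f (- y) = - f y by apply/eqP; rewrite -addr_eq0 -fD addNr f0.
have fn m : f (x *+ m) = f x *+ m.
  by elim: m => [|m IH]; rewrite ?mulr0n // !mulrS fD IH.
by case: n => m; rewrite ?NegzE ?mulrNz -?pmulrn ?fN fn.
Qed.

Lemma is_cmap_comp d e (X Y Z : cplx) (g : Y -> Z) (f : X -> Y) :
  is_cmap e g -> is_cmap d f -> is_cmap (d + e) (g \o f).
Proof.
move=> [[gD gB gd] gc] [[fD fB fd] fc]; split; first split=> /=.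
- by move=> x y; rewrite fD gD.
- move=> i b x hb; rewrite (fB i b) // (additiveMz gD) (gB i b) //.
  by rewrite -mulrzA mulrC -ksignDl.
- by move=> a x hx; rewrite addrA; apply/gd/fd.
- by move=> x /=; rewrite gc fc (additiveMz gD) -mulrzA -ksignDl.
Qed.

Definition ccomp d e (X Y Z : cplx) (g : cmap e Y Z) (f : cmap d X Y) :
  cmap (d + e) X Z := CMap (is_cmap_comp (cfunP g) (cfunP f)).

Definition ccomp0 (X Y Z : cplx) (g : cmap 0 Y Z) (f : cmap 0 X Y) :
  cmap 0 X Z := @CMap 0 X Z (g \o f) (ccomp g f).(cfunP).

Lemma is_cmap_id (X : cplx) : is_cmap 0 (@id X).
Proof.
split; last by move=> x; rewrite ksign0l mulr1z.
by split=> [//|i b x _|g x]; rewrite ?ksign0l ?mulr1z ?addr0.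
Qed.

Definition cid (X : cplx) : cmap 0 X X := CMap (is_cmap_id X).

Lemma is_cmap_zero (X Y : cplx) : is_cmap 0 (fun _ : X => 0 : Y).
Proof.
split; last by move=> x; rewrite linear0 mul0rz.
split=> [x y|i b x _|g x _]; first by rewrite addr0.
- by rewrite scaler0 mul0rz.
- exact: homog0.
Qed.

Definition czero (X Y : cplx) : cmap 0 X Y := CMap (is_cmap_zero X Y).

Lemma is_cmap_add (X Y : cplx) (f g : cmap 0 X Y) :
  is_cmap 0 (fun x => f x + g x).
Proof.
case: f g => f [[fD fB fd] fc] [g [[gD gB gd] gc]] /=.
split; first split=> /=.
- by move=> x y; rewrite fD gD addrACA.
- by move=> i b x hb; rewrite (fB i b) // (gB i b) // scalerDr mulrzDl.
- by move=> a x hx; apply: homogD; [apply: fd | apply: gd].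
- by move=> x; rewrite linearD /= fc gc mulrzDl.
Qed.

Definition cadd (X Y : cplx) (f g : cmap 0 X Y) : cmap 0 X Y :=
  CMap (is_cmap_add f g).

(* A short exact sequence of complexes of projectives splits degreewise, so it
   induces, up to isomorphism, the exact triangle of a mapping cone. *)
Definition KProj : ttdata := {|
  ob := cplx;
  hom := fun X Y => cmap 0 X Y;
  heq := fun X Y f g => homotopic 0 f g;
  hzero := czero;
  hadd := cadd;
  idm := cid;
  comp := ccomp0;
  ses := fun X Y Z f g => short_exact f g;
  ten := fun X Y T => exists t : X -> Y -> T, is_ctensor t
|}.

(* S is a resolution 0 -> k -> S^0 -> S^1 -> ... of the trivial module, and u is
   the image of 1 under the augmentation k -> S^0.  In degree 0, the exactness
   clause says that the cocycles are the multiples of u. *)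
Definition is_unit (S : cplx) (u : S) : Prop :=
  [/\ forall (n i : int) x, (n < 0)%O -> homog (ggr S) (n, i) x -> x = 0,
      [/\ homog (ggr S) (0, 0) u, u <> 0 & cdif S u = 0],
      forall b, b *: u = (counit H b)%:A *: u
    & forall x, cdif S x = 0 ->
        exists (c : k) (y : S), x = c%:A *: u + cdif S y].

(** * Localisation at primes of pi_*(S) = [S, S]_* *)

Section Localisation.
Variables (S : cplx) (u : S).

(* A bihomogeneous prime ideal of [S, S]_*, given by its bihomogeneous elements
   as a homotopy invariant predicate. *)
Record bihomog_prime := BihomogPrime {
  inprime :> forall d, cmap d S S -> Prop;
  inprime0 : forall d (f : cmap d S S),
    homotopic d f (fun=> 0) -> inprime f;
  inprimeD : forall d (f g h : cmap d S S), inprime f -> inprime g ->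
    homotopic d h (fun x => f x + g x) -> inprime h;
  inprimeM : forall d e (f : cmap d S S) (g : cmap e S S),
    inprime f -> inprime (ccomp g f) /\ inprime (ccomp f g);
  inprime1 : ~ inprime (cid S);
  inprimeP : forall d e (f : cmap d S S) (g : cmap e S S),
    inprime (ccomp g f) -> inprime f \/ inprime g
}.

Definition prime_le (q p : bihomog_prime) : Prop :=
  forall d (f : cmap d S S), q d f -> p d f.

Definition prime_lt (q p : bihomog_prime) : Prop :=
  prime_le q p /\ ~ prime_le p q.

(* f represents the action of r in [S, S]_* on X, i.e. it corresponds to r /\ X
   under the unit isomorphism X -> S /\ X, x |-> u (x) x. *)
Definition acts_as d (r : cmap d S S) (X : cplx) (f : cmap d X X) : Prop :=
  exists (T : cplx) (t : S -> X -> T), is_ctensor t /\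
    homotopic d (fun x => t (r u) x) (fun x => t u (f x)).

(* l : X -> Xq induces the localisation [A, X]_* -> ([A, X]_* )_q for all small
   A: elements outside q act bijectively on [A, Xq]_*, and the kernel and the
   cokernel of [A, l]_* are q-torsion. *)
Definition is_localisation (q : bihomog_prime) (X Xq : cplx) (l : cmap 0 X Xq) :
    Prop :=
  forall A : cplx, @small KProj A ->
  [/\ forall d (r : cmap d S S) (f : cmap d Xq Xq), ~ q d r -> acts_as r f ->
        (forall e (a : cmap e A Xq), homotopic (e + d) (ccomp f a) (fun=> 0) ->
           homotopic e a (fun=> 0)) /\
        (forall e (b : cmap (e + d) A Xq), exists a : cmap e A Xq,
           homotopic (e + d) (ccomp f a) b),
      forall e (a : cmap e A X), homotopic e (l \o a) (fun=> 0) ->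
        exists d (r : cmap d S S) (f : cmap d X X),
          [/\ ~ q d r, acts_as r f & homotopic (e + d) (ccomp f a) (fun=> 0)]
    & forall e (b : cmap e A Xq),
        exists d (r : cmap d S S) (f : cmap d Xq Xq) (a : cmap (e + d) A X),
          [/\ ~ q d r, acts_as r f & homotopic (e + d) (ccomp f b) (l \o a)]].

Definition localises_to_zero (q : bihomog_prime) (X : cplx) : Prop :=
  exists (Xq : cplx) (l : cmap 0 X Xq),
    is_localisation q l /\ @is_zero KProj Xq.

(** * Finite localisations and the tensor product property *)

Definition is_finite_localisation (A : subcat KProj) (X LX : cplx)
    (eta : cmap 0 X LX) : Prop :=
  (exists (F : ob KProj) (f : hom F (X : ob KProj)),
     triangle f (eta : @hom KProj X LX) /\ localising_gen A F) /\
  (forall Y : cplx, A Y -> forall d (g : cmap d Y LX), homotopic d g (fun=> 0)).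

Definition acyclics_le (p : bihomog_prime) : subcat KProj := fun X =>
  small X /\ forall q, prime_le q p -> localises_to_zero q X.

Definition acyclics_lt (p : bihomog_prime) : subcat KProj := fun X =>
  small X /\ forall q, prime_lt q p -> localises_to_zero q X.

(* M is the fibre of the natural map L_p S -> L_(<p) S. *)
Definition is_Mp (p : bihomog_prime) (M : ob KProj) : Prop :=
  exists (L L' : ob KProj) (eta : @hom KProj S L) (eta' : @hom KProj S L')
         (nu : hom L L') (f : hom M L),
    [/\ is_finite_localisation (acyclics_le p) eta,
        is_finite_localisation (acyclics_lt p) eta',
        heq (comp nu eta) eta' & triangle f nu].

End Localisation.

(* The unit S, the objects M_p and the tensor products are determined up to
   isomorphism, so the property is required for all choices of these. *)
Definition tensor_product_property : Prop :=
  forall (S : cplx) (u : S), is_unit u ->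
  forall (p : bihomog_prime S) (M : ob KProj), is_Mp u p M ->
  forall X Y MX MY MXY : ob KProj,
    ten M X MX -> ten M Y MY -> ten MX Y MXY ->
    (is_zero MXY <-> is_zero MX \/ is_zero MY).

End Modules.

(* Main.v *)
From HB Require Import structures.
Require Import Defs.
From mathcomp Require Import all_boot all_order all_algebra all_field.
From mathcomp Require Import boolp ring.

(** The stable category of B is a Krull-Schmidt category, and it is rigid: the
    internal hom [N, W] = W (x) N^* exists inside the category.  Rigidity forces
    ideals with trivial intersection to be orthogonal; together with the
    Krull-Schmidt property of objects, this makes the decompositions of ideals
    exist and be unique.

    Rigidity.  The antipode turns the linear dual of a module into a module, and
    evaluation W (x) N^* (x) N -> W identifies the maps P (x) N -> W with the
    maps P -> [N, W] (app_pairing, curry).  Hence P (x) N is projective when P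
    is (proj_tens); and projective modules are injective (proj_inj), because for
    an embedding X -> Y the restriction [Y, P] -> [X, P] is a surjection onto a
    projective module, so it splits.  The cosyzygy of U is an internal hom into
    U (cosyz), so the suspension is a tensor product, and a class of modules is
    an ideal as soon as it is closed under retracts, fibres and tensor products
    (tideal_crit).

    Orthogonality.  A map X -> Y factors through [X, Y] (x) X.  This object lies
    in every ideal that contains X and in every ideal that contains Y, so it is
    projective if X and Y belong to ideals with trivial intersection: there are
    no nonzero stable maps between such ideals (hom_orth).  The objects
    without nonzero maps to a given ideal form an ideal again (perp_tideal);
    therefore trivial intersection of two generated ideals can be tested on
    generators (gen_disj).

    Sums.  Let the T_i be ideals with trivial pairwise intersections.  A map
    between finite sums of objects of the T_i is diagonal by orthogonality, so
    its fibre is the sum of the fibres of the diagonal entries (fib_bip) and is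
    of the same form.  Retracts of such sums are again such sums by the
    Krull-Schmidt property: by Fitting's lemma every module is a finite sum
    of modules with local endomorphism ring (KS_ind), and a local retract of
    a sum is a retract of one of the summands (loc_bip).  So the sums form an
    ideal T (sums_tideal).

    Krull-Schmidt decompositions.  Call two nonzero local objects of T linked if
    the ideals that they generate meet nontrivially, and consider the
    equivalence relation which this generates.  The ideals generated by the
    equivalence classes are disjoint by gen_disj, every object of T is a sum of
    local ones, and a decomposition of any ideal puts linked objects into the
    same summand; this gives existence, indecomposability and uniqueness
    (krull_schmidt).

    K_0.  The T_i-component of an object of T is unique up to isomorphism
    (comp_uniq), and taking components preserves exact triangles (pr_tri), again
    because maps are diagonal.  The components and the inclusions of the T_i are
    mutually inverse on Grothendieck groups (K0_sum). *)

Set Implicit Arguments.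
Unset Strict Implicit.
Unset Printing Implicit Defensive.
Import GRing.Theory.
Local Open Scope ring_scope.

(** * Gradings and Koszul signs *)

Section Grading.
Variables (G V : zmodType) (gr : grading G V).

Lemma gr0 g : gr g 0 = 0.
Proof. by apply: (@addrI _ (gr g 0)); rewrite -componentD !addr0. Qed.

Lemma grN g x : gr g (- x) = - gr g x.
Proof. by apply/eqP; rewrite -addr_eq0 -componentD addNr gr0. Qed.

Lemma gr_sum g (I : Type) (s : seq I) (P : pred I) F :
  gr g (\sum_(i <- s | P i) F i) = \sum_(i <- s | P i) gr g (F i).
Proof. by apply: (big_morph (gr g)); [exact: componentD | exact: gr0]. Qed.

Lemma grMz g x m : gr g (x *~ m) = gr g x *~ m.
Proof. by apply: additiveMz => ? ?; rewrite componentD. Qed.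

Lemma homog_gr g x : homog gr g (gr g x).
Proof. by rewrite /homog component_proj eqxx. Qed.

Lemma gr_homog g h x : homog gr h x -> gr g x = if g == h then x else 0.
Proof. by move=> <-; rewrite component_proj. Qed.

(** The finitely many degrees of a support are chosen once and for all, so
    that operators can be defined by a sum over degrees. *)
Definition supp x : seq G := projT1 (cid (component_sum gr x)).

Lemma supp_uniq x : uniq (supp x).
Proof. by rewrite /supp; case: cid => s []. Qed.

Lemma supp_sum x : x = \sum_(g <- supp x) gr g x.
Proof. by rewrite /supp; case: cid => s []. Qed.

Lemma gr_out x g : g \notin supp x -> gr g x = 0.
Proof.
move=> gs; rewrite [x]supp_sum gr_sum big_seq big1 // => h hs.
rewrite component_proj; case: eqP => // e; by rewrite e hs in gs.
Qed.

Lemma gr_sumE x s : uniq s -> {subset supp x <= s} -> x = \sum_(g <- s) gr g x.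
Proof.
move=> us sub; rewrite [LHS]supp_sum.
transitivity (\sum_(g <- [seq g <- s | g \in supp x]) gr g x).
  apply: perm_big; apply: uniq_perm; rewrite ?supp_uniq ?filter_uniq // => g.
  by rewrite mem_filter /=; case: (boolP (g \in supp x)) => [/sub ->|].
rewrite big_filter [RHS](bigID (mem (supp x))) /=.
by rewrite [X in _ = _ + X]big1 ?addr0 // => g /gr_out.
Qed.

Lemma gr_ext x y : (forall g, gr g x = gr g y) -> x = y.
Proof.
move=> e; have us := undup_uniq (supp x ++ supp y).
rewrite [LHS](gr_sumE us) => [|g]; last by rewrite mem_undup mem_cat => ->.
rewrite [RHS](gr_sumE us) => [|g]; last by rewrite mem_undup mem_cat orbC => ->.
by apply: eq_bigr => g _; rewrite e.
Qed.

Lemma homog_ind (P : V -> Prop) : P 0 -> (forall x y, P x -> P y -> P (x + y)) ->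
  (forall g x, homog gr g x -> P x) -> forall x, P x.
Proof.
move=> P0 PD Ph x; rewrite [x]supp_sum.
by elim/big_rec: _ => // g y _; apply: PD; apply: Ph (homog_gr _ _).
Qed.

Lemma homog_sum g (I : Type) (s : seq I) (P : pred I) F :
  (forall i, P i -> homog gr g (F i)) -> homog gr g (\sum_(i <- s | P i) F i).
Proof. by move=> h; rewrite /homog gr_sum; apply: eq_bigr. Qed.

Lemma homogMz g x m : homog gr g x -> homog gr g (x *~ m).
Proof. by rewrite /homog grMz => ->. Qed.

Lemma homog_0 g : homog gr g 0.
Proof. exact: gr0. Qed.

Lemma gr_bound x s : uniq s -> (forall g, g \notin s -> gr g x = 0) ->
  x = \sum_(g <- s) gr g x.
Proof.
move=> us out; apply: gr_ext => g; rewrite gr_sum.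
have [gs|gs] := boolP (g \in s).
  rewrite (big_rem g) //= component_proj eqxx big_seq big1 ?addr0 // => h.
  rewrite (rem_filter _ us) mem_filter component_proj /= eq_sym.
  by case/andP=> /negPf ->.
rewrite out // big_seq big1 // => h hs; rewrite component_proj.
by case: eqP => // e; rewrite e hs in gs.
Qed.

End Grading.

Lemma ksignC i j : ksign i j = ksign j i.
Proof. by rewrite /ksign mulrC. Qed.
Lemma ksign0r i : ksign i 0 = 1.
Proof. by rewrite ksignC ksign0l. Qed.
Lemma ksignDr i j l : ksign i (j + l) = ksign i j * ksign i l.
Proof. by rewrite ![ksign i _]ksignC ksignDl. Qed.
Lemma ksign_sq i j : ksign i j * ksign i j = 1.
Proof.
rewrite /ksign -exprzDr ?unitrN1 //.
have -> : i * j + i * j = 2%:Z * (i * j) by rewrite -mulr2n -mulr_natl.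
by rewrite -exprz_exp -exprnP sqrrN expr1n exp1rz.
Qed.
Lemma ksignNl i j : ksign (- i) j = ksign i j.
Proof.
by rewrite -[LHS]mulr1 -(ksign_sq i j) mulrA -ksignDl addNr ksign0l mul1r.
Qed.
Lemma ksignNr i j : ksign i (- j) = ksign i j.
Proof. by rewrite ![ksign i _]ksignC ksignNl. Qed.

Section Twist.
Variables (V : zmodType) (gr : grading int V).

(** The Koszul sign (-1)^(i deg x) as an additive operator. It allows sign
    rules, which only make sense for homogeneous elements, to be written for
    all elements. *)
Definition tw (i : int) (x : V) : V :=
  \sum_(g <- supp gr x) gr g x *~ ksign i g.

Lemma gr_tw g i x : gr g (tw i x) = gr g x *~ ksign i g.
Proof.
rewrite /tw gr_sum; have [gs|gs] := boolP (g \in supp gr x).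
  rewrite (big_rem g) //= grMz component_proj eqxx big_seq big1 ?addr0 // => h.
  rewrite (rem_filter _ (supp_uniq gr x)) mem_filter grMz component_proj /=.
  by rewrite eq_sym => /andP[/negPf ->]; rewrite mul0rz.
rewrite (gr_out gs) mul0rz big_seq big1 // => h hs; rewrite grMz component_proj.
by case: eqP => [e|]; rewrite ?mul0rz //; rewrite e hs in gs.
Qed.

Lemma twD i x y : tw i (x + y) = tw i x + tw i y.
Proof. by apply: (@gr_ext _ _ gr) => g; rewrite componentD !gr_tw componentD mulrzDl. Qed.
Lemma tw0 i : tw i 0 = 0.
Proof. by apply: (@addrI _ (tw i 0)); rewrite -twD !addr0. Qed.
Lemma tw_homog i g x : homog gr g x -> tw i x = x *~ ksign i g.
Proof.
move=> hx; apply: (@gr_ext _ _ gr) => h; rewrite gr_tw grMz (gr_homog _ hx).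
by case: eqP => [->|]; rewrite ?mul0rz.
Qed.
Lemma tw_tw i j x : tw i (tw j x) = tw (i + j) x.
Proof.
apply: (@gr_ext _ _ gr) => h; rewrite !gr_tw ksignDl -mulrzA; congr (_ *~ _).
by rewrite mulrC.
Qed.
Lemma homog_tw i g x : homog gr g x -> homog gr g (tw i x).
Proof. by move=> hx; rewrite (tw_homog _ hx); apply: homogMz. Qed.
Lemma twKK i x : tw i (tw i x) = x.
Proof. by apply: (@gr_ext _ _ gr) => h; rewrite !gr_tw -mulrzA ksign_sq. Qed.
Lemma tw_sum i (I : Type) (s : seq I) (P : pred I) F :
  tw i (\sum_(j <- s | P j) F j) = \sum_(j <- s | P j) tw i (F j).
Proof. by apply: (big_morph (tw i)); [exact: twD | exact: tw0]. Qed.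
End Twist.

(** * Graded modules over B *)

Section Scalars.
Variables (k : fieldType) (B : falgType k).

Section KMod.
Variable M : lmodType B.

Lemma kcomm (b : B) (c : k) (x : M) : b *: (c%:A *: x) = c%:A *: (b *: x).
Proof. by rewrite !scalerA mulr_algl mulr_algr. Qed.

Lemma kscaleA (b : B) (c : k) (x : M) : (c *: b) *: x = c%:A *: (b *: x).
Proof. by rewrite scalerA mulr_algl. Qed.

Lemma kA (c d : k) (x : M) : c%:A *: (d%:A *: x) = (c * d)%:A *: x.
Proof. by rewrite scalerA mulr_algl scalerA. Qed.

Lemma k1 (x : M) : (1 : k)%:A *: x = x.
Proof. by rewrite !scale1r. Qed.

Lemma kD (c d : k) (x : M) : (c + d)%:A *: x = c%:A *: x + d%:A *: x.
Proof. by rewrite !scalerDl. Qed.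

Lemma k0 (x : M) : (0 : k)%:A *: x = 0.
Proof. by rewrite !scale0r. Qed.

(** The underlying vector space of a B-module: tensor products and coproducts
    are determined by their maps to vector spaces. *)
Definition kmod : Type := M.
HB.instance Definition _ := GRing.Zmodule.copy kmod M.

Definition kmod_scale (c : k) (x : kmod) : kmod := c%:A *: (x : M).
Fact kmod_scaleA c d x : kmod_scale c (kmod_scale d x) = kmod_scale (c * d) x.
Proof. exact: kA. Qed.
Fact kmod_scale1 x : kmod_scale 1 x = x.
Proof. exact: k1. Qed.
Fact kmod_scaleDr : right_distributive kmod_scale +%R.
Proof. by move=> c x y; rewrite /kmod_scale scalerDr. Qed.
Fact kmod_scaleDl x : {morph kmod_scale^~ x : c d / c + d}.
Proof. by move=> c d; rewrite /kmod_scale scalerDl scalerDl. Qed.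
HB.instance Definition _ := GRing.Zmodule_isLmodule.Build k kmod
  kmod_scaleA kmod_scale1 kmod_scaleDr kmod_scaleDl.
End KMod.
End Scalars.

Section Mod.
Variables (k : fieldType) (B : falgType k) (H : hopf_algebra B).
Local Notation gm := (gmod H deg1).
Local Notation fg := (fgmod H).

Lemma hgr_alg (c : k) : homog (hgr H) 0 c%:A.
Proof. by rewrite /homog hgrZ (hgr1 H). Qed.

Lemma tw_hgrZ i c x : tw (hgr H) i (c *: x) = c *: tw (hgr H) i x.
Proof. by apply: (@gr_ext _ _ (hgr H)) => g; rewrite hgrZ !gr_tw hgrZ scalerMzr. Qed.

Lemma tw1 i : tw (hgr H) i 1 = 1.
Proof. by rewrite (tw_homog _ (hgr1 H)) ksign0r. Qed.

Section OneMod.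
Variable M : gm.

Lemma gr_k g (c : k) x : ggr M g (c%:A *: x) = c%:A *: ggr M g x.
Proof.
elim/(@homog_ind _ _ (ggr M)): x => [|x y hx hy|h x hx].
- by rewrite !(gr0, scaler0).
- by rewrite scalerDr !componentD hx hy scalerDr.
have := gact (hgr_alg c) hx; rewrite /= add0r => hc.
by rewrite (gr_homog _ hx) (gr_homog _ hc); case: eqP; rewrite ?scaler0.
Qed.

Lemma homog_k g (c : k) x : homog (ggr M) g x -> homog (ggr M) g (c%:A *: x).
Proof. by rewrite /homog gr_k => ->. Qed.

Lemma tw_k i (c : k) x : tw (ggr M) i (c%:A *: x) = c%:A *: tw (ggr M) i x.
Proof. by apply: (@gr_ext _ _ (ggr M)) => g; rewrite gr_k !gr_tw gr_k scalerMzr. Qed.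

Lemma gr_act p g (b : B) x : homog (hgr H) p b ->
  ggr M g (b *: x) = b *: ggr M (g - p) x.
Proof.
move=> hb; elim/(@homog_ind _ _ (ggr M)): x => [|x y hx hy|h x hx].
- by rewrite !(gr0, scaler0).
- by rewrite scalerDr !componentD hx hy scalerDr.
have := gact hb hx => /= hc.
rewrite (gr_homog _ hx) (gr_homog _ hc) subr_eq addrC.
by case: eqP; rewrite ?scaler0.
Qed.

Lemma tw_act i (b : B) x :
  tw (ggr M) i (b *: x) = tw (hgr H) i b *: tw (ggr M) i x.
Proof.
elim/(@homog_ind _ _ (hgr H)): b => [|a b ha hb|p b hb].
- by rewrite !(scale0r, tw0).
- by rewrite !(scalerDl, twD) ha hb.
elim/(@homog_ind _ _ (ggr M)): x => [|x y hx hy|g x hx].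
- by rewrite !(scaler0, tw0).
- by rewrite !(scalerDr, twD) hx hy.
have hc := gact hb hx; rewrite (tw_homog _ hb) (tw_homog _ hx) (tw_homog _ hc).
by rewrite ksignDr -scalerMzr -scalerMzl -mulrzA mulrC.
Qed.

End OneMod.

Definition klin (M N : lmodType B) (u : M -> N) : Prop :=
  forall (c : k) x y, u (c%:A *: x + y) = c%:A *: u x + u y.

Section KLin.
Variables (M N : lmodType B) (u : M -> N) (ul : klin u).
Lemma klinD x y : u (x + y) = u x + u y.
Proof. by rewrite -[x]k1 ul !k1. Qed.
Lemma klin0 : u 0 = 0.
Proof. by apply: (@addrI _ (u 0)); rewrite -klinD !addr0. Qed.
Lemma klinZ c x : u (c%:A *: x) = c%:A *: u x.
Proof. by rewrite -[c%:A *: x]addr0 ul klin0 addr0. Qed.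
Lemma klin_sum (I : Type) (s : seq I) (P : pred I) F :
  u (\sum_(i <- s | P i) F i) = \sum_(i <- s | P i) u (F i).
Proof. by apply: (big_morph u klinD klin0). Qed.
Lemma klinMz x m : u (x *~ m) = u x *~ m.
Proof. exact: additiveMz klinD _ _. Qed.
End KLin.

Lemma klin_lin (M N : lmodType B) (u : {linear M -> N}) : klin u.
Proof. by move=> c x y; rewrite linearP. Qed.
Lemma klin_act (M : lmodType B) (b : B) : klin (fun x : M => b *: x).
Proof. by move=> c x y; rewrite scalerDr kcomm. Qed.
Lemma klin_gr (M : gm) g : klin (ggr M g).
Proof. by move=> c x y; rewrite componentD gr_k. Qed.
Lemma klin_tw (M : gm) i : klin (tw (ggr M) i).
Proof. by move=> c x y; rewrite twD tw_k. Qed.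

Lemma ghom_gr (M N : gm) (f : ghom M N) g x : f (ggr M g x) = ggr N g (f x).
Proof.
elim/(@homog_ind _ _ (ggr M)): x => [|x y hx hy|h x hx].
- by rewrite !(gr0, linear0).
- by rewrite linearD !componentD linearD hx hy.
rewrite (gr_homog _ hx) (gr_homog _ (gfun_deg f hx)).
by case: eqP; rewrite ?linear0.
Qed.

Lemma ghom_tw (M N : gm) (f : ghom M N) i x : f (tw (ggr M) i x) = tw (ggr N) i (f x).
Proof.
by apply: (@gr_ext _ _ (ggr N)) => g; rewrite gr_tw -!ghom_gr gr_tw (klinMz (klin_lin f)).
Qed.

(** Maps are found by choice rather than by explicit terms below, so they are
    first known as functions. *)
Lemma mk_ghom (M N : gm) (u : M -> N) :
  (forall x y, u (x + y) = u x + u y) -> (forall b x, u (b *: x) = b *: u x) ->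
  (forall g x, homog (ggr M) g x -> homog (ggr N) g (u x)) ->
  exists f : ghom M N, forall x, f x = u x.
Proof.
move=> uD uZ ud.
have ul : linear u by move=> a x y; rewrite uD uZ.
pose U := GRing.isLinear.Build B M N *:%R u ul.
pose F : {linear M -> N} := HB.pack u U.
by exists (@GHom _ _ H deg1 M N F ud).
Qed.

(** A twisted action of B on tuples x of elements of a module X, by (b x)_i =
    sum_j R(b)_(i j) x_j, where the j-th entry is shifted by mdeg j. Tensor
    products (X arbitrary, tuples indexed by a basis of the second factor) and
    duals (X the trivial module) both have this form. *)
Record mx_rep n := MxRep {
  mdeg : 'I_n -> int;
  mact :> B -> 'I_n -> 'I_n -> B;
  mactP : forall (c : k) a b i j, mact (c *: a + b) i j = c *: mact a i j + mact b i j;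
  mact1 : forall i j, mact 1 i j = (i == j)%:R;
  mactM : forall a b i j, mact (a * b) i j = \sum_l mact a i l * mact b l j;
  mact_deg : forall p b i j, homog (hgr H) p b ->
    homog (hgr H) (p + mdeg j - mdeg i) (mact b i j)
}.

Section Coord.
Variables (X : gm) (n : nat) (R : mx_rep n).

Definition coord_car : Type := {ffun 'I_n -> X}.
HB.instance Definition _ := GRing.Zmodule.copy coord_car {ffun 'I_n -> X}.

Definition coord_scale (b : B) (f : coord_car) : coord_car :=
  [ffun i => \sum_j R b i j *: (f : {ffun 'I_n -> X}) j].

Fact coord_scaleA a b f :
  coord_scale a (coord_scale b f) = coord_scale (a * b) f.
Proof.
apply/ffunP=> i; rewrite !ffunE.
under eq_bigr => j _ do rewrite ffunE scaler_sumr.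
rewrite exchange_big; apply: eq_bigr => j _ /=.
by rewrite mactM scaler_suml; apply: eq_bigr => l _; rewrite scalerA.
Qed.
Fact coord_scale1 : left_id 1 coord_scale.
Proof.
move=> f; apply/ffunP=> i; rewrite !ffunE (bigD1 i) //= mact1 eqxx scale1r.
by rewrite big1 ?addr0 // => j ji; rewrite mact1 eq_sym (negPf ji) scale0r.
Qed.
Fact coord_scaleDr : right_distributive coord_scale +%R.
Proof.
move=> b f g; apply/ffunP=> i; rewrite !ffunE -big_split /=.
by apply: eq_bigr => j _; rewrite ffunE scalerDr.
Qed.
Fact coord_scaleDl f : {morph coord_scale^~ f : a b / a + b}.
Proof.
move=> a b; apply/ffunP=> i; rewrite !ffunE -big_split /=.
by apply: eq_bigr => j _; rewrite -{1}[a]scale1r mactP scale1r scalerDl.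
Qed.
HB.instance Definition _ := GRing.Zmodule_isLmodule.Build B coord_car
  coord_scaleA coord_scale1 coord_scaleDr coord_scaleDl.

Definition coord_comp (g : int) (f : coord_car) : coord_car :=
  [ffun j => ggr X (g - mdeg R j) ((f : {ffun 'I_n -> X}) j)].

Fact coord_compD g x y : coord_comp g (x + y) = coord_comp g x + coord_comp g y.
Proof. by apply/ffunP=> i; rewrite !ffunE componentD. Qed.
Fact coord_comp_proj g h x :
  coord_comp g (coord_comp h x) = if g == h then coord_comp h x else 0.
Proof.
apply/ffunP=> i; rewrite !ffunE component_proj (inj_eq (addIr _)).
by case: (eqVneq g h) => [_|_]; rewrite !ffunE.
Qed.
Fact coord_comp_sum x : exists s : seq int,
  uniq s /\ x = \sum_(g <- s) coord_comp g x.
Proof.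
pose s := undup (flatten
  [seq [seq h + mdeg R j | h <- supp (ggr X) ((x : {ffun 'I_n -> X}) j)] | j : 'I_n]).
exists s; split; first exact: undup_uniq.
apply/ffunP=> j; rewrite sum_ffunE.
under eq_bigr => g _ do rewrite ffunE.
rewrite -(big_map (fun g => g - mdeg R j) xpredT (fun g => ggr X g (x j))).
apply: gr_bound => [|g gs].
  by rewrite map_inj_uniq ?undup_uniq //; apply: addIr.
apply: gr_out; apply: contra gs => gs; apply/mapP; exists (g + mdeg R j).
  rewrite mem_undup; apply/flatten_mapP; exists j; first by rewrite mem_enum.
  by apply/mapP; exists g.
by rewrite addrK.
Qed.

Definition coord_gr : grading int coord_car :=
  Grading coord_compD coord_comp_proj coord_comp_sum.

Fact coord_act i g (b : B) (x : coord_car) :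
  homog (hgr H) i b -> homog coord_gr g x -> homog coord_gr (i + g) (b *: x).
Proof.
move=> hb /ffunP hx; apply/ffunP => j; rewrite !ffunE gr_sum.
apply: eq_bigr => l _; rewrite (gr_act _ _ (mact_deg R j l hb)).
congr (_ *: _); rewrite -{2}hx ffunE; congr (ggr X _ _).
by rewrite /=; ring.
Qed.

Definition coord_mod : gm := @GMod _ _ H deg1 coord_car coord_gr coord_act.

Lemma coord_modZ (b : B) (f : coord_mod) i :
  ((b *: f : coord_mod) : {ffun 'I_n -> X}) i =
  \sum_j R b i j *: (f : {ffun 'I_n -> X}) j.
Proof. by rewrite ffunE. Qed.

Lemma coord_k (c : k) (f : coord_mod) i :
  ((c%:A *: f : coord_mod) : {ffun 'I_n -> X}) i = c%:A *: (f : {ffun 'I_n -> X}) i.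
Proof.
have R0 a b : R 0 a b = 0.
  apply: (@addrI _ (R 0 a b)); have := mactP R 1 0 0 a b.
  by rewrite !scale1r !addr0 => <-.
have Rc a b : R c%:A a b = c *: (a == b)%:R.
  by rewrite -[c%:A]addr0 mactP mact1 R0 addr0.
rewrite coord_modZ (bigD1 i) //= Rc eqxx big1 ?addr0 // => j ji.
by rewrite Rc eq_sym (negPf ji) scaler0 scale0r.
Qed.

Lemma coord_homog g (f : coord_mod) : homog (ggr coord_mod) g f <->
  forall i, homog (ggr X) (g - mdeg R i) ((f : {ffun 'I_n -> X}) i).
Proof.
split=> [/ffunP hf i|hf]; first by have := hf i; rewrite ffunE.
by apply/ffunP=> i; rewrite ffunE hf.
Qed.
End Coord.

Definition triv_car : Type := k.
HB.instance Definition _ := GRing.Zmodule.copy triv_car k.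
Definition triv_scale (b : B) (c : triv_car) : triv_car := counit H b * (c : k).
Lemma counitD a b : counit H (a + b) = counit H a + counit H b.
Proof. by rewrite -[a]scale1r counit_linear mul1r scale1r. Qed.
Lemma counit0 : counit H 0 = 0.
Proof. by apply: (@addrI _ (counit H 0)); rewrite -counitD !addr0. Qed.
Lemma counitZ c a : counit H (c *: a) = c * counit H a.
Proof. by rewrite -[c *: a]addr0 counit_linear counit0 addr0. Qed.
Fact triv_scaleA a b c : triv_scale a (triv_scale b c) = triv_scale (a * b) c.
Proof. by rewrite /triv_scale counitM mulrA. Qed.
Fact triv_scale1 : left_id 1 triv_scale.
Proof. by move=> c; rewrite /triv_scale counit1 mul1r. Qed.
Fact triv_scaleDr : right_distributive triv_scale +%R.
Proof. by move=> b x y; rewrite /triv_scale mulrDr. Qed.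
Fact triv_scaleDl x : {morph triv_scale^~ x : a b / a + b}.
Proof. by move=> a b; rewrite /triv_scale counitD mulrDl. Qed.
HB.instance Definition _ := GRing.Zmodule_isLmodule.Build B triv_car
  triv_scaleA triv_scale1 triv_scaleDr triv_scaleDl.
Definition triv_comp (g : int) (x : triv_car) : triv_car := if g == 0 then x else 0.
Fact triv_compD g x y : triv_comp g (x + y) = triv_comp g x + triv_comp g y.
Proof. by rewrite /triv_comp; case: eqP; rewrite ?addr0. Qed.
Fact triv_comp_proj g h x :
  triv_comp g (triv_comp h x) = if g == h then triv_comp h x else 0.
Proof.
rewrite /triv_comp; have [->|gh] := eqVneq g h; first by case: eqP.
by case: eqP => // g0; case: eqP => // h0; rewrite g0 h0 eqxx in gh.
Qed.
Fact triv_comp_sum x : exists s : seq int,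
  uniq s /\ x = \sum_(g <- s) triv_comp g x.
Proof. by exists [:: 0]; rewrite big_seq1 /triv_comp eqxx. Qed.
Definition triv_gr : grading int triv_car :=
  Grading triv_compD triv_comp_proj triv_comp_sum.
Fact triv_act i g (b : B) (x : triv_car) :
  homog (hgr H) i b -> homog triv_gr g x -> homog triv_gr (i + g) (b *: x).
Proof.
move=> hb hx; rewrite /homog /= /triv_comp; have [//|ig] := eqVneq (i + g) 0.
have [i0|i0] := eqVneq i 0.
  move: hx ig; rewrite /homog /= /triv_comp i0 add0r.
  by case: eqP => // _ <-; rewrite scaler0.
by rewrite /GRing.scale /= /triv_scale (counit_deg hb i0) mul0r.
Qed.
Definition triv : gm := @GMod _ _ H deg1 triv_car triv_gr triv_act.
Lemma trivZ (b : B) (c : triv) : b *: c = counit H b * (c : k) :> k.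
Proof. by []. Qed.

Definition reg : gm := @GMod _ _ H deg1 (B^o : lmodType B) (hgr H) (@hgrM _ _ H).

Section DSum.
Variables M N : gm.
Definition dsum_comp (g : int) (x : M * N) : M * N := (ggr M g x.1, ggr N g x.2).
Fact dsum_compD g x y : dsum_comp g (x + y) = dsum_comp g x + dsum_comp g y.
Proof. by rewrite /dsum_comp !componentD. Qed.
Fact dsum_comp_proj g h x :
  dsum_comp g (dsum_comp h x) = if g == h then dsum_comp h x else 0.
Proof. by rewrite /dsum_comp !component_proj; case: eqP. Qed.
Fact dsum_comp_sum x : exists s : seq int,
  uniq s /\ x = \sum_(g <- s) dsum_comp g x.
Proof.
exists (undup (supp (ggr M) x.1 ++ supp (ggr N) x.2)); rewrite undup_uniq; split=> //.
rewrite [LHS]surjective_pairing [RHS]surjective_pairing.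
rewrite (big_morph fst (id1 := 0) (op1 := +%R)) // (big_morph snd (id1 := 0) (op1 := +%R)) //=.
congr (_, _); apply: gr_sumE => [|g]; rewrite ?undup_uniq // mem_undup mem_cat => -> //.
by rewrite orbT.
Qed.
Definition dsum_gr : grading int (M * N)%type :=
  Grading dsum_compD dsum_comp_proj dsum_comp_sum.
Fact dsum_act i g (b : B) (x : M * N) :
  homog (hgr H) i b -> homog dsum_gr g x -> homog dsum_gr (i + g) (b *: x).
Proof.
move=> hb; rewrite /homog /= /dsum_comp => -[hx].
by case: x hx => x y /= [<- <-]; congr (_, _); apply: gact => //; apply: homog_gr.
Qed.
Definition dsum : gm := @GMod _ _ H deg1 (M * N)%type dsum_gr dsum_act.
End DSum.

Section Ker.
Variables (M N : gm) (f : ghom M N).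
Definition kerp : {pred M} := fun x => f x == 0.
Fact kerp_submod : submod_closed kerp.
Proof.
split=> [|a x y]; first by rewrite unfold_in linear0.
rewrite !unfold_in => /eqP hx /eqP hy.
by rewrite linearP hx hy scaler0 addr0.
Qed.
HB.instance Definition _ := GRing.isSubmodClosed.Build B M kerp kerp_submod.
Record ker_car : Type := KerEl { ker_val :> M; _ : ker_val \in kerp }.
HB.instance Definition _ := [isSub for ker_val].
HB.instance Definition _ := [Choice of ker_car by <:].
HB.instance Definition _ := [SubChoice_isSubLmodule of ker_car by <:].

Lemma ker_valP (x : ker_car) : f (ker_val x) = 0.
Proof. by case: x => x /= /eqP. Qed.
Fact ker_gr_in g (x : ker_car) : ggr M g (ker_val x) \in kerp.
Proof. by rewrite unfold_in ghom_gr ker_valP gr0. Qed.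
Definition ker_comp (g : int) (x : ker_car) : ker_car := KerEl (ker_gr_in g x).
Fact ker_compD g x y : ker_comp g (x + y) = ker_comp g x + ker_comp g y.
Proof. by apply: val_inj; rewrite /= componentD. Qed.
Fact ker_comp_proj g h x :
  ker_comp g (ker_comp h x) = if g == h then ker_comp h x else 0.
Proof. by apply: val_inj; rewrite /= component_proj; case: eqP. Qed.
Fact ker_comp_sum x : exists s : seq int,
  uniq s /\ x = \sum_(g <- s) ker_comp g x.
Proof.
exists (supp (ggr M) (ker_val x)); rewrite supp_uniq; split=> //.
by apply: val_inj; rewrite (raddf_sum (\val : ker_car -> M)); apply: supp_sum.
Qed.
Definition ker_gr : grading int ker_car :=
  Grading ker_compD ker_comp_proj ker_comp_sum.
Fact ker_act i g (b : B) (x : ker_car) :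
  homog (hgr H) i b -> homog ker_gr g x -> homog ker_gr (i + g) (b *: x).
Proof.
move=> hb hx; apply: val_inj.
by have := gact hb (congr1 val hx : homog (ggr M) g (ker_val x)).
Qed.
Definition ker : gm := @GMod _ _ H deg1 ker_car ker_gr ker_act.
Lemma ker_inc_ex : exists i : ghom ker M, forall x, i x = ker_val x.
Proof.
apply: mk_ghom => // g x hx; by move/(congr1 val): hx.
Qed.
Definition ker_inc : ghom ker M := projT1 (cid ker_inc_ex).
Lemma ker_incE x : ker_inc x = ker_val x.
Proof. by rewrite /ker_inc; case: cid. Qed.
Lemma ker_inc_inj : injective ker_inc.
Proof. by move=> x y; rewrite !ker_incE => /val_inj. Qed.
Lemma ker_lift x : f x = 0 -> exists y : ker, ker_inc y = x.
Proof.
move=> fx; have fx' : x \in kerp by rewrite unfold_in fx.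
by exists (KerEl fx'); rewrite ker_incE.
Qed.
Lemma ker_inc0 y : f (ker_inc y) = 0.
Proof. by rewrite ker_incE ker_valP. Qed.
End Ker.

End Mod.

(** * The antipode *)

Section Hopf.
Variables (k : fieldType) (B : falgType k) (H : hopf_algebra B).
Local Notation gm := (gmod H deg1).
Local Notation S := (antipode H).
Local Notation twB := (tw (hgr H)).
Local Notation cop := (comult H).

Lemma tw_hgrP i c x y : twB i (c *: x + y) = c *: twB i x + twB i y.
Proof. by rewrite twD tw_hgrZ. Qed.

Lemma twM i a b : twB i (a * b) = twB i a * twB i b.
Proof. exact: (@tw_act k B H (reg H) i a b). Qed.

Lemma antipodeD a b : S (a + b) = S a + S b.
Proof. by rewrite -[a]scale1r antipode_linear !scale1r. Qed.
Lemma antipode0 : S 0 = 0.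
Proof. by apply: (@addrI _ (S 0)); rewrite -antipodeD !addr0. Qed.
Lemma antipodeZ c a : S (c *: a) = c *: S a.
Proof. by rewrite -[c *: a]addr0 antipode_linear antipode0 addr0. Qed.
Lemma antipodeMz a m : S (a *~ m) = S a *~ m.
Proof. exact: additiveMz antipodeD _ _. Qed.
Lemma antipode_sum (I : Type) (s : seq I) (P : pred I) F :
  S (\sum_(j <- s | P j) F j) = \sum_(j <- s | P j) S (F j).
Proof. by apply: (big_morph S antipodeD antipode0). Qed.

Lemma antipode_tw i b : S (twB i b) = twB i (S b).
Proof.
elim/(@homog_ind _ _ (hgr H)): b => [|a b ha hb|p b hb].
- by rewrite !(antipode0, tw0).
- by rewrite !(antipodeD, twD) ha hb.
by rewrite (tw_homog _ hb) (tw_homog _ (antipode_deg hb)) antipodeMz.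
Qed.

Lemma antipode1 : S 1 = 1.
Proof.
have f2 : @bilinear2 k B B (fun x y => S x * y).
  by split=> *; rewrite ?antipode_linear ?mulrDl ?mulrDr -?scalerAl -?scalerAr.
have := comult1 H f2; rewrite mulr1 => <-.
by rewrite antipodel counit1 scale1r.
Qed.

Lemma cop1_homog b t : t \in cop b -> homog (hgr H) t.1.1 t.1.2.
Proof. by case/comult_homog. Qed.
Lemma cop2_homog b t : t \in cop b -> homog (hgr H) t.2.1 t.2.2.
Proof. by case/comult_homog. Qed.
Lemma counit_cop2 n b t : homog (hgr H) n b -> t \in cop b ->
  counit H t.2.2 != 0 -> t.2.1 = 0 /\ t.1.1 = n.
Proof.
move=> hb tb; have [t0|t0] := eqVneq t.2.1 0.
  by move=> _; split=> //; apply: (etrans _ (comult_deg hb tb)); rewrite t0 addr0.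
by rewrite (counit_deg (cop2_homog tb) t0) eqxx.
Qed.

(** The sum of S(a1 b1) a2 b2 S(b3) S(a3) over the iterated coproducts, with
    Koszul signs, is computed in two ways: contracting a2 with a3 and b2 with
    b3 leaves S(a b), while contracting the product a1 b1 with a2 b2 leaves
    S(b) S(a). *)
Lemma antipodeM i j a b : homog (hgr H) i a -> homog (hgr H) j b ->
  S (a * b) = (S b * S a) *~ ksign i j.
Proof.
move=> ha hb.
pose K (t : (int * B) * (int * B)) := \sum_(v <- cop t.2.2) v.1.2 * S v.2.2.
(* In F, x, y, z stand for a1, a2, a3 and t for the coproduct b1 (x) (b2 b3);
   K t is the contraction of b2 with S(b3). *)
pose F (t : (int * B) * (int * B)) x y z :=
  S (x * t.1.2) * twB t.1.1 y * K t * S (twB j z).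
transitivity (\sum_(t <- cop b) \sum_(s <- cop a) \sum_(u <- cop s.2.2)
   F t s.1.2 u.1.2 u.2.2).
  have FE2 t s : t \in cop b -> s \in cop a ->
      \sum_(u <- cop s.2.2) F t s.1.2 u.1.2 u.2.2 =
      S (s.1.2 * (counit H t.2.2 *: t.1.2)) * (counit H s.2.2)%:A.
    move=> tb sa; rewrite -(tw1 H j) -tw_hgrZ -antipoder tw_sum mulr_sumr.
    apply: eq_bigr => u _; rewrite /F /K antipoder.
    have [e0|/(counit_cop2 hb tb)[_ ->]] := eqVneq (counit H t.2.2) 0.
      by rewrite e0 scale0r mulr0 mul0r scale0r mulr0 antipode0 mul0r.
    rewrite twM -antipode_tw mulr_algr -!scalerAl -scalerAr antipodeZ -scalerAl.
    by rewrite mulrA.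
  rewrite exchange_big /=.
  rewrite -{1}[a](counitr H) mulr_suml antipode_sum; apply: eq_big_seq => s sa.
  under eq_big_seq => t tb do rewrite (FE2 t s tb sa).
  rewrite -mulr_suml -antipode_sum -mulr_sumr counitr.
  by rewrite -scalerAl antipodeZ mulr_algr.
have Ftri t : @trilinear3 k B B (F t).
  split=> *; rewrite /F.
  - by rewrite mulrDl -scalerAl antipode_linear !mulrDl -!scalerAl.
  - by rewrite tw_hgrP mulrDr -scalerAr !mulrDl -!scalerAl.
  - by rewrite tw_hgrP antipode_linear mulrDr -scalerAr.
under eq_bigr => t _ do rewrite -(comultA H (Ftri t)).
(* Coassociativity groups the factors the other way: in G, a1 and a2 are the
   factors of u, a3 is in s, and x, y, z stand for b1, b2, b3. *)
rewrite exchange_big /=.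
pose G (s u : (int * B) * (int * B)) x y z :=
  S (u.1.2 * twB u.2.1 x) * u.2.2 * y * S z * S (twB j s.2.2).
have Gtri s u : @trilinear3 k B B (G s u).
  split=> *; rewrite /G.
  - by rewrite tw_hgrP mulrDr -scalerAr antipode_linear !mulrDl -!scalerAl.
  - by rewrite mulrDr -scalerAr !mulrDl -!scalerAl.
  - by rewrite antipode_linear mulrDr -scalerAr !mulrDl -!scalerAl.
have f2 : @bilinear2 k B B (fun x y => S x * y).
  by split=> *; rewrite ?antipode_linear ?mulrDl ?mulrDr -?scalerAl -?scalerAr.
transitivity (\sum_(s <- cop a) \sum_(t <- cop b)
    (counit H s.1.2 * counit H t.1.2) *: (S t.2.2 * S (twB j s.2.2))).
  apply: eq_big_seq => s sa; rewrite exchange_big /=.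
  transitivity (\sum_(u <- cop s.1.2) \sum_(t <- cop b) \sum_(v <- cop t.2.2)
     G s u t.1.2 v.1.2 v.2.2).
    apply: eq_big_seq => u us; apply: eq_big_seq => t tb.
    rewrite /F /K mulr_sumr mulr_suml; apply: eq_bigr => v _; rewrite /G.
    rewrite (tw_homog _ (cop1_homog tb)) (tw_homog _ (cop2_homog us)).
    rewrite !(mulrzAr, antipodeMz, mulrzAl) ksignC.
    by rewrite !mulrA.
  rewrite (eq_bigr _ (fun u _ => esym (comultA H (Gtri s u) b))).
  rewrite exchange_big /=; apply: eq_big_seq => t tb.
  have := comultM H f2 s.1.2 t.1.2; rewrite antipodel counitM => /(congr1 (fun x => x * (S t.2.2 * S (twB j s.2.2)))).
  rewrite mulr_algl => ->; rewrite mulr_suml; apply: eq_big_seq => u us.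
  rewrite mulr_suml; apply: eq_big_seq => v vt; rewrite /G.
  rewrite (tw_homog _ (cop1_homog vt)) !(mulrzAr, antipodeMz, mulrzAl).
  by rewrite !mulrA.
transitivity (S b * S (twB j a)); last first.
  by rewrite (tw_homog _ ha) antipodeMz mulrzAr ksignC.
have -> : S b = \sum_(t <- cop b) counit H t.1.2 *: S t.2.2.
  rewrite -{1}[b](counitl H) antipode_sum.
  by apply: eq_bigr => t _; rewrite antipodeZ.
have -> : S (twB j a) = \sum_(s <- cop a) counit H s.1.2 *: S (twB j s.2.2).
  rewrite -{1}[a](counitl H) tw_sum antipode_sum.
  by apply: eq_bigr => s _; rewrite tw_hgrZ antipodeZ.
rewrite mulr_sumr; apply: eq_bigr => s _; rewrite mulr_suml.
by apply: eq_bigr => t _; rewrite -scalerAl -scalerAr scalerA mulrC.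
Qed.

(** * Homogeneous bases *)

Record hbasis (Y : gm) := HBasis {
  bn : nat;
  be : 'I_bn -> Y;
  bdg : 'I_bn -> int;
  bco : Y -> 'I_bn -> k;
  be_homog : forall j, homog (ggr Y) (bdg j) (be j);
  bcoP : forall c x y j, bco (c%:A *: x + y) j = c * bco x j + bco y j;
  be_sum : forall y, y = \sum_j (bco y j)%:A *: be j;
  bco_be : forall i j, bco (be j) i = (i == j)%:R
}.
End Hopf.
Arguments be {k B H Y} h _.
Arguments bdg {k B H Y} h _.
Arguments bco {k B H Y} h _ _.
Arguments be_homog {k B H Y} h _.
Arguments bcoP {k B H Y} h _ _ _ _.
Arguments be_sum {k B H Y} h _.
Arguments bco_be {k B H Y} h _ _.

Section Bases.
Variables (k : fieldType) (B : falgType k) (H : hopf_algebra B).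
Local Notation gm := (gmod H deg1).

Section HBasis.
Variables (Y : gm) (b : hbasis Y).
Lemma bcoD x y j : bco b (x + y) j = bco b x j + bco b y j.
Proof. by rewrite -[x]k1 bcoP !k1 mul1r. Qed.
Lemma bco0 j : bco b 0 j = 0.
Proof. by apply: (@addrI _ (bco b 0 j)); rewrite -bcoD !addr0. Qed.
Lemma bcoZ c x j : bco b (c%:A *: x) j = c * bco b x j.
Proof. by rewrite -[c%:A *: x]addr0 bcoP bco0 addr0. Qed.
Lemma bco_sum (I : Type) (s : seq I) (P : pred I) F j :
  bco b (\sum_(i <- s | P i) F i) j = \sum_(i <- s | P i) bco b (F i) j.
Proof. by apply: (big_morph (fun x => bco b x j)) => [x y|]; rewrite ?bcoD ?bco0. Qed.
Lemma bcoMz x m j : bco b (x *~ m) j = bco b x j *~ m.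
Proof. by apply: (additiveMz (f := fun x => bco b x j)) => ? ?; rewrite bcoD. Qed.
Lemma bco_comb (c : 'I_(bn b) -> k) i :
  bco b (\sum_j (c j)%:A *: be b j) i = c i.
Proof.
rewrite bco_sum (bigD1 i) //= bcoZ bco_be eqxx mulr1 big1 ?addr0 // => j ji.
by rewrite bcoZ bco_be eq_sym (negPf ji) mulr0.
Qed.
Lemma bco_homog g y j : homog (ggr Y) g y -> bco b y j != 0 -> bdg b j = g.
Proof.
move=> hy; rewrite -{1}hy {1}[y](be_sum b) gr_sum.
rewrite (eq_bigr (fun i => (bco b y i *+ (g == bdg b i))%:A *: be b i)) => [|i _].
  by rewrite bco_comb; case: (eqVneq g (bdg b j)) => [->//|_]; rewrite mulr0n eqxx.
by rewrite gr_k (gr_homog _ (be_homog b i)); case: eqP; rewrite ?mulr1n // mulr0n k0 scaler0.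
Qed.
Lemma hb_ext x y : (forall j, bco b x j = bco b y j) -> x = y.
Proof. by move=> e; rewrite [x](be_sum b) [y](be_sum b); apply: eq_bigr => j _; rewrite e. Qed.
End HBasis.

Section Span.
Variable M : gm.
Definition inspan (s : seq M) (x : M) : Prop :=
  exists c : nat -> k, x = \sum_(i < size s) (c i)%:A *: s`_i.

Lemma inspan0 s : inspan s 0.
Proof. by exists (fun=> 0); rewrite big1 // => i _; rewrite k0. Qed.
Lemma inspanD s x y : inspan s x -> inspan s y -> inspan s (x + y).
Proof.
move=> [c ->] [d ->]; exists (fun i => c i + d i); rewrite -big_split.
by apply: eq_bigr => i _; rewrite kD.
Qed.
Lemma inspanZ s a x : inspan s x -> inspan s (a%:A *: x).
Proof.
move=> [c ->]; exists (fun i => a * c i); rewrite scaler_sumr.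
by apply: eq_bigr => i _; rewrite kA.
Qed.
Lemma inspan_sum s (I : Type) (r : seq I) (P : pred I) F :
  (forall i, P i -> inspan s (F i)) -> inspan s (\sum_(i <- r | P i) F i).
Proof. by move=> h; elim/big_ind: _ => //; [exact: inspan0 | exact: inspanD]. Qed.
Lemma inspan_mem s x : x \in s -> inspan s x.
Proof.
move=> xs; have lt : (index x s < size s)%N by rewrite index_mem.
exists (fun i => (i == index x s)%:R).
rewrite (bigD1 (Ordinal lt)) //= eqxx k1 nth_index // big1 ?addr0 // => i ne.
have -> : (i == index x s :> nat) = false by apply: negbTE; apply: contra ne => /eqP e; apply/eqP/val_inj.
by rewrite k0.
Qed.
Lemma inspan_trans s s' x : (forall y, y \in s -> inspan s' y) -> inspan s x -> inspan s' x.
Proof.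
move=> h [c ->]; apply: inspan_sum => i _; apply: inspanZ; apply: h.
by rewrite mem_nth.
Qed.

Definition hspan (s : seq M) : Prop :=
  (forall x, x \in s -> exists g, homog (ggr M) g x) /\ forall x, inspan s x.

Lemma hspan_ex (r : seq M) : (forall x, inspan r x) -> exists s, hspan s.
Proof.
move=> sp; exists (flatten [seq [seq ggr M g x | g <- supp (ggr M) x] | x <- r]).
split=> [x /flatten_mapP[y _ /mapP[g _ ->]]|x].
  by exists g; apply: homog_gr.
apply: inspan_trans (sp x) => y yr; rewrite [y](supp_sum (ggr M)).
rewrite big_seq; apply: inspan_sum => g gs; apply: inspan_mem.
by apply/flatten_mapP; exists y => //; apply/mapP; exists g.
Qed.

Lemma fg_span : finitely_generated M -> exists s, forall x, inspan s x.
Proof.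
move=> [s gen]; exists [seq b *: x | b <- vbasis {:B}, x <- s] => x.
have [c ->] := gen x; apply: inspan_sum => i _.
rewrite (coord_vbasis (memvf (c i))) scaler_suml; apply: inspan_sum => l _.
rewrite kscaleA; apply: inspanZ; apply: inspan_mem.
by apply: allpairs_f; rewrite mem_nth // size_tuple.
Qed.

Lemma span_fg s : (forall x, inspan s x) -> finitely_generated M.
Proof. by move=> sp; exists s => x; have [c ->] := sp x; exists (fun i => (c i)%:A). Qed.

Definition dim_le n := exists s, size s = n /\ hspan s.

(** In a nontrivial relation some vector is a combination of the others and
    could be dropped. *)
Lemma min_indep s : hspan s -> (forall s', hspan s' -> (size s <= size s')%N) ->
  forall c : 'I_(size s) -> k, \sum_i (c i)%:A *: s`_i = 0 -> forall i, c i = 0.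
Proof.
move=> [hs sp] smin c c0 j; apply/eqP; apply: contraT => cj.
pose s' := take j s ++ drop j.+1 s.
have sub y : y \in s' -> y \in s.
  by rewrite mem_cat => /orP[/mem_take|/mem_drop].
have mem' i : i != j -> s`_i \in s'.
  move=> ij; rewrite mem_cat; have [lt|gt] := ltnP i j.
    by apply/orP; left; rewrite -(nth_take 0 lt) mem_nth // size_take_min leq_min lt ltn_ord.
  have gt' : (j < i)%N by rewrite ltn_neqAle gt andbT eq_sym.
  apply/orP; right; rewrite -[i in s`_i](subnKC gt') -nth_drop mem_nth //.
  by rewrite size_drop ltn_sub2r // (leq_ltn_trans gt' (ltn_ord i)).
suff : hspan s'.
  move/smin; rewrite size_cat size_take_min size_drop; have jl := ltn_ord j.
  by rewrite (minn_idPl (ltnW jl)) leqNgt -[X in (_ < X)%N](subnKC (ltnW jl)) ltn_add2l ltn_sub2l.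
split=> [x /sub /hs //|x]; apply: inspan_trans (sp x) => y ys.
have : (index y s < size s)%N by rewrite index_mem.
move=> lt; have [e|ne] := eqVneq (Ordinal lt) j; last first.
  by apply: inspan_mem; rewrite -(nth_index 0 ys); apply: (mem' (Ordinal lt)).
have -> : y = s`_j by rewrite -e /= nth_index.
have -> : s`_j = \sum_(i | i != j) (- (c j)^-1 * c i)%:A *: s`_i.
  move: c0; rewrite (bigD1 j) //= => /eqP; rewrite addr_eq0 => /eqP e0.
  rewrite -[LHS]k1 -(mulVf cj) -kA e0 scalerN scaler_sumr -sumrN.
  by apply: eq_bigr => i _; rewrite kA mulNr scaleNr scaleNr.
by apply: inspan_sum => i ij; apply/inspanZ/inspan_mem/mem'.
Qed.

Lemma basis_of_min s : hspan s -> (forall s', hspan s' -> (size s <= size s')%N) ->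
  exists b : hbasis M, bn b = size s.
Proof.
move=> hs smin; have ind := min_indep hs smin.
have [hg sp] := hs.
pose co x (i : 'I_(size s)) : k := projT1 (cid (sp x)) i.
have coE x : x = \sum_i (co x i)%:A *: s`_i by rewrite /co; case: cid.
have hd (i : 'I_(size s)) : exists g, homog (ggr M) g s`_i by apply: hg; rewrite mem_nth.
pose dg i := projT1 (cid (hd i)).
have dgP i : homog (ggr M) (dg i) s`_i by rewrite /dg; case: cid.
have un (c d : 'I_(size s) -> k) :
    \sum_i (c i)%:A *: s`_i = \sum_i (d i)%:A *: s`_i -> forall i, c i = d i.
  move=> e i; apply/eqP; rewrite -subr_eq0; apply/eqP.
  apply: (ind (fun i => c i - d i)).
  by under eq_bigr => l _ do rewrite kD scaleNr scaleNr; rewrite big_split /= sumrN e subrr.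
have coL c x y i : co (c%:A *: x + y) i = c * co x i + co y i.
  apply: (un (co (c%:A *: x + y)) (fun i => c * co x i + co y i)).
  rewrite -coE {1}[x]coE {1}[y]coE scaler_sumr -big_split; apply: eq_bigr => l _.
  by rewrite kD kA.
have coB i (j : 'I_(size s)) : co s`_j i = (i == j)%:R.
  apply: (un (co s`_j) (fun i => (i == j)%:R)); rewrite -coE.
  by rewrite (bigD1 j) //= eqxx k1 big1 ?addr0 // => l /negPf ->; rewrite k0.
by exists (HBasis dgP coL coE coB).
Qed.

(** A homogeneous spanning set of minimal size is a basis. The minimality is
    kept as part of the conclusion since it makes the length of the basis a
    dimension, monotone under quotients. *)
Lemma hbasis_ex : finitely_generated M -> exists b : hbasis M,
  forall s, hspan s -> (bn b <= size s)%N.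
Proof.
move=> /fg_span[s0 /hspan_ex[s1 hs1]].
have ex : exists n, `[< dim_le n >] by exists (size s1); apply/asboolP; exists s1.
have [n /asboolP[s [<- hs]] nmin] := ex_minnP ex.
have smin s' : hspan s' -> (size s <= size s')%N.
  by move=> hs'; apply: nmin; apply/asboolP; exists s'.
by have [b e] := basis_of_min hs smin; exists b; rewrite e.
Qed.
End Span.

End Bases.

(** * Tensor products *)

Section Tensor.
Variables (k : fieldType) (B : falgType k) (H : hopf_algebra B).
Local Notation gm := (gmod H deg1).
Local Notation fg := (fgmod H).
Local Notation S := (antipode H).
Local Notation twB := (tw (hgr H)).
Local Notation cop := (comult H).

Lemma bilinear_kmod (M : lmodType B) (f : B -> B -> M) :
  (forall c x x' y, f (c *: x + x') y = c%:A *: f x y + f x' y) ->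
  (forall c x y y', f x (c *: y + y') = c%:A *: f x y + f x y') ->
  @bilinear2 k B (kmod M) f.
Proof. by []. Qed.
Lemma trilinear_kmod (M : lmodType B) (f : B -> B -> B -> M) :
  (forall c x x' y z, f (c *: x + x') y z = c%:A *: f x y z + f x' y z) ->
  (forall c x y y' z, f x (c *: y + y') z = c%:A *: f x y z + f x y' z) ->
  (forall c x y z z', f x y (c *: z + z') = c%:A *: f x y z + f x y z') ->
  @trilinear3 k B (kmod M) f.
Proof. by []. Qed.
(** Coassociativity with values in a B-module, through its underlying vector
    space; the casts to that vector space are conversions. *)
Lemma comultA_kmod (M : lmodType B) (f : B -> B -> B -> M) : @trilinear3 k B (kmod M) f ->
  forall b,
    \sum_(t <- cop b) \sum_(u <- cop t.1.2) f u.1.2 u.2.2 t.2.2 =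
    \sum_(t <- cop b) \sum_(u <- cop t.2.2) f t.1.2 u.1.2 u.2.2.
Proof. exact: (@comultA k B H (kmod M)). Qed.

Local Notation kbil f := (kbilinear (fun (c : k) z => c%:A *: z) f).

(** The data of a map X (x) Y -> Z. The sign for moving the second factor of
    the coproduct of b past x is expressed by a twist of x, so that
    equivariance is stated for all x. *)
Definition pairing (X Y Z : gm) (f : X -> Y -> Z) : Prop :=
  [/\ kbil f,
      forall g h x y, homog (ggr X) g x -> homog (ggr Y) h y ->
        homog (ggr Z) (g + h : int) (f x y)
    & forall b x y, b *: f x y =
        \sum_(s <- cop b) f (s.1.2 *: tw (ggr X) s.2.1 x) (s.2.2 *: y)].

Section KBil.
Variables (X Y : gm) (W : zmodType) (sc : k -> W -> W) (f : X -> Y -> W).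
Hypotheses (fb : kbilinear sc f) (sc1 : forall w, sc 1 w = w).
Lemma kbilDl x x' y : f (x + x') y = f x y + f x' y.
Proof. by rewrite -[x]k1 fb.1 k1 sc1. Qed.
Lemma kbilDr x y y' : f x (y + y') = f x y + f x y'.
Proof. by rewrite -[y]k1 fb.2 k1 sc1. Qed.
Lemma kbil0l y : f 0 y = 0.
Proof. by apply: (@addrI _ (f 0 y)); rewrite -kbilDl !addr0. Qed.
Lemma kbil0r x : f x 0 = 0.
Proof. by apply: (@addrI _ (f x 0)); rewrite -kbilDr !addr0. Qed.
Lemma kbilMzl x y m : f (x *~ m) y = f x y *~ m.
Proof. by apply: (additiveMz (f := fun x => f x y)) => ? ?; rewrite kbilDl. Qed.
Lemma kbilMzr x y m : f x (y *~ m) = f x y *~ m.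
Proof. by apply: (additiveMz (f := f x)) => ? ?; rewrite kbilDr. Qed.
Lemma kbil_suml (I : Type) (s : seq I) (P : pred I) F y :
  f (\sum_(i <- s | P i) F i) y = \sum_(i <- s | P i) f (F i) y.
Proof. by apply: (big_morph (fun x => f x y)) => [? ?|]; rewrite ?kbilDl ?kbil0l. Qed.
Lemma kbil_sumr (I : Type) (s : seq I) (P : pred I) F x :
  f x (\sum_(i <- s | P i) F i) = \sum_(i <- s | P i) f x (F i).
Proof. by apply: (big_morph (f x)) => [? ?|]; rewrite ?kbilDr ?kbil0r. Qed.
Lemma kbil_ext (f' : X -> Y -> W) (fb' : kbilinear sc f') :
  (forall g h x y, homog (ggr X) g x -> homog (ggr Y) h y -> f x y = f' x y) ->
  forall x y, f x y = f' x y.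
Proof.
have D' x x' y : f' (x + x') y = f' x y + f' x' y by rewrite -[x]k1 fb'.1 k1 sc1.
have E' x y y' : f' x (y + y') = f' x y + f' x y' by rewrite -[y]k1 fb'.2 k1 sc1.
have z' y : f' 0 y = 0 by apply: (@addrI _ (f' 0 y)); rewrite -D' !addr0.
have w' x : f' x 0 = 0 by apply: (@addrI _ (f' x 0)); rewrite -E' !addr0.
move=> e x; elim/(@homog_ind _ _ (ggr X)): x => [|x x' hx hx'|g x hx] y.
- by rewrite kbil0l z'.
- by rewrite kbilDl D' hx hx'.
elim/(@homog_ind _ _ (ggr Y)): y => [|y y' hy hy'|h y hy].
- by rewrite kbil0r w'.
- by rewrite kbilDr E' hy hy'.
exact: e hx hy.
Qed.
End KBil.

Section KBilZ.
Variables (X Y : gm) (Z : lmodType B) (f : X -> Y -> Z) (fb : kbil f).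
Lemma kbilZl c x y : f (c%:A *: x) y = c%:A *: f x y.
Proof. by rewrite -[_ *: x]addr0 fb.1 (kbil0l fb) ?addr0 // => z; rewrite k1. Qed.
Lemma kbilZr c x y : f x (c%:A *: y) = c%:A *: f x y.
Proof. by rewrite -[_ *: y]addr0 fb.2 (kbil0r fb) ?addr0 // => z; rewrite k1. Qed.
End KBilZ.

Lemma kbil_comp (X Y X' Y' : gm) (Z Z' : lmodType B) (f : X -> Y -> Z) (h : Z -> Z')
    (a : X' -> X) (b : Y' -> Y) :
  kbil f -> klin h -> klin a -> klin b -> kbil (fun x y => h (f (a x) (b y))).
Proof.
move=> fb hl al bl; split=> c *.
  by rewrite al fb.1 hl.
by rewrite bl fb.2 hl.
Qed.
Lemma klin_id (M : lmodType B) : klin (@id M).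
Proof. by []. Qed.

Lemma pairing_homog (X Y Z : gm) (f : X -> Y -> Z) : kbil f ->
  (forall g h x y, homog (ggr X) g x -> homog (ggr Y) h y ->
        homog (ggr Z) (g + h : int) (f x y)) ->
  (forall b g h x y, homog (ggr X) g x -> homog (ggr Y) h y -> b *: f x y =
        \sum_(s <- cop b) f (s.1.2 *: x) (s.2.2 *: y) *~ ksign s.2.1 g) ->
  pairing f.
Proof.
move=> fb fd fe; split=> // b; apply: (kbil_ext (sc := fun c z => c%:A *: z)).
- exact: (kbil_comp fb (klin_act b) (klin_id (M := X)) (klin_id (M := Y))).
- by move=> w; rewrite k1.
- split=> c *; rewrite scaler_sumr -big_split; apply: eq_bigr => s _.
    by rewrite klin_tw klin_act fb.1.
  by rewrite klin_act fb.2.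
move=> g h x y hx hy; rewrite (fe b g h) //; apply: eq_bigr => s _.
rewrite (tw_homog _ hx) (klinMz (klin_act _)) (kbilMzl fb) // => w.
by rewrite k1.
Qed.

Lemma pairing_comp (X Y Z X' Y' Z' : gm) (f : X -> Y -> Z) (h : ghom Z Z')
    (a : ghom X' X) (b : ghom Y' Y) :
  pairing f -> pairing (fun x y => h (f (a x) (b y))).
Proof.
move=> [fb fd fe]; split.
- by apply: kbil_comp => //; apply: klin_lin.
- by move=> g l x y hx hy; apply/gfun_deg/fd; apply: gfun_deg.
move=> c x y; rewrite -linearZ /= fe linear_sum; apply: eq_bigr => s _.
by rewrite /= -ghom_tw -!linearZ.
Qed.

Section Universal.
Variables (X Y T : gm) (t : X -> Y -> T) (tT : is_tensor t).

Lemma tens_kbil : kbil t.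
Proof. by case: tT. Qed.

Lemma tens_klift (M : lmodType B) (f : X -> Y -> M) : kbil f ->
  exists u : T -> M, klin u /\ forall x y, u (t x y) = f x y.
Proof.
by move=> fb; case: tT => _ /(_ (kmod M) f fb) [u [ul ue _]] _ _; exists u.
Qed.

Lemma tens_ext (M : lmodType B) (u v : T -> M) : klin u -> klin v ->
  (forall x y, u (t x y) = v (t x y)) -> u =1 v.
Proof.
move=> ul vl e.
have vb : kbil (fun x y => v (t x y)).
  exact: (kbil_comp tens_kbil vl (klin_id (M := X)) (klin_id (M := Y))).
case: tT => _ /(_ (kmod M) _ vb) [w [_ _ wu]] _ _ z.
by rewrite (wu u ul e) (wu v vl (fun _ _ => erefl)).
Qed.

Lemma tens_ext_homog (M : lmodType B) (u v : T -> M) : klin u -> klin v ->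
  (forall g h x y, homog (ggr X) g x -> homog (ggr Y) h y -> u (t x y) = v (t x y)) ->
  u =1 v.
Proof.
move=> ul vl e; apply: (tens_ext ul vl).
apply: (kbil_ext (sc := fun c z => c%:A *: z)) => //.
- exact: (kbil_comp tens_kbil ul (klin_id (M := X)) (klin_id (M := Y))).
- by move=> w; rewrite k1.
exact: (kbil_comp tens_kbil vl (klin_id (M := X)) (klin_id (M := Y))).
Qed.

Lemma tens_pairing : pairing t.
Proof.
case: tT => tb _ td te; apply: pairing_homog => // b g h x y hx _.
exact: te.
Qed.

(** The universal property of the tensor product is linear over k;
    equivariance and degrees of the induced map can be checked on pure
    tensors. *)
Lemma tens_lift (Z : gm) (f : X -> Y -> Z) : pairing f ->
  exists u : ghom T Z, forall x y, u (t x y) = f x y.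
Proof.
move=> [fb fd fe]; have [u [ul ue]] := tens_klift fb.
have [_ td te] := tens_pairing.
have uZ b z : u (b *: z) = b *: u z.
  apply: (tens_ext (u := fun z => u (b *: z)) (v := fun z => b *: u z)).
  - by move=> c x y; rewrite klin_act ul.
  - by move=> c x y; rewrite ul klin_act.
  move=> x y; rewrite te ue fe (klin_sum ul); apply: eq_bigr => s _.
  by rewrite ue.
have ug g z : u (ggr T g z) = ggr Z g (u z).
  apply: (tens_ext_homog (u := fun z => u (ggr T g z)) (v := fun z => ggr Z g (u z))).
  - by move=> c x y; rewrite klin_gr ul.
  - by move=> c x y; rewrite ul klin_gr.
  move=> p q x y hx hy; rewrite (gr_homog _ (td _ _ _ _ hx hy)) ue.
  rewrite (gr_homog _ (fd _ _ _ _ hx hy)).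
  by case: eqP => _; rewrite ?ue // (klin0 ul).
have [U UE] := mk_ghom (klinD ul) uZ (fun g x (hx : homog (ggr T) g x) =>
  etrans (esym (ug g x)) (congr1 u hx)).
by exists U => x y; rewrite UE ue.
Qed.
End Universal.

Section TensRep.
Variables (Y : gm) (b : hbasis Y).

Lemma coef_homog q (a : B) i j : homog (hgr H) q a ->
  bco b (a *: be b j) i != 0 -> bdg b i = q + bdg b j.
Proof. by move=> ha; apply: bco_homog; apply: gact (be_homog b j). Qed.

Lemma bco_mul (a c : B) i j : bco b ((a * c) *: be b j) i =
  \sum_l bco b (a *: be b l) i * bco b (c *: be b j) l.
Proof.
rewrite -scalerA {1}[c *: be b j](be_sum b) scaler_sumr bco_sum.
by apply: eq_bigr => l _; rewrite kcomm bcoZ mulrC.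
Qed.

(** The matrices by which B acts on X (x) Y in a basis y_j of Y. The element
    sum_j x_j (x) y_j is encoded by the tuple of the x_j multiplied by
    (-1)^(deg x_j deg y_j): with these signs B acts on the entries from the
    left, by matrices which do not depend on X. *)
Definition tens_act (a : B) (i j : 'I_(bn b)) : B :=
  \sum_(t <- cop a) bco b (t.2.2 *: be b j) i *: twB (bdg b i) t.1.2.

Fact tens_act_bil i j : @bilinear2 k B B
  (fun x y => bco b (y *: be b j) i *: twB (bdg b i) x).
Proof.
split=> c *; first by rewrite tw_hgrP scalerDr !scalerA mulrC.
by rewrite scalerDl kscaleA bcoP scalerDl scalerA.
Qed.
Fact tens_actP c x y i j : tens_act (c *: x + y) i j = c *: tens_act x i j + tens_act y i j.
Proof. exact: (comult_linear H (tens_act_bil i j)). Qed.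
Fact tens_act1 i j : tens_act 1 i j = (i == j)%:R.
Proof.
rewrite /tens_act (comult1 H (tens_act_bil i j)) scale1r bco_be tw1.
by case: eqP; rewrite ?scale1r ?scale0r.
Qed.
Fact tens_actM x y i j : tens_act (x * y) i j = \sum_l tens_act x i l * tens_act y l j.
Proof.
rewrite /tens_act (comultM H (tens_act_bil i j)).
under [RHS]eq_bigr => l _ do rewrite mulr_suml.
rewrite [RHS]exchange_big; apply: eq_big_seq => s sx /=.
under [RHS]eq_bigr => l _ do rewrite mulr_sumr.
rewrite [RHS]exchange_big; apply: eq_big_seq => t ty /=.
rewrite bco_mul scaler_suml mulrz_suml; apply: eq_bigr => l _.
rewrite -scalerAl -scalerAr scalerA.
have [->|c0] := eqVneq (bco b (s.2.2 *: be b l) i) 0; first by rewrite !mul0r !scale0r mul0rz.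
rewrite twM !(tw_homog _ (cop1_homog ty)) (coef_homog (cop2_homog sx) c0).
rewrite scalerMzr !mulrzAr -mulrzA ksignDl mulrC; congr (_ *: (_ *~ _)).
by rewrite mulrAC ksign_sq mul1r.
Qed.
Fact tens_act_deg p a i j : homog (hgr H) p a ->
  homog (hgr H) (p + bdg b j - bdg b i) (tens_act a i j).
Proof.
move=> ha; rewrite /tens_act big_seq; apply: homog_sum => t ta.
have [->|c0] := eqVneq (bco b (t.2.2 *: be b j) i) 0.
  by rewrite scale0r; apply: homog_0.
have -> : p + bdg b j - bdg b i = t.1.1.
  by rewrite (coef_homog (cop2_homog ta) c0) -(comult_deg ha ta); ring.
rewrite /homog hgrZ; congr (_ *: _); apply: homog_tw; exact: cop1_homog ta.
Qed.
Definition tens_rep : mx_rep H (bn b) :=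
  MxRep tens_actP tens_act1 tens_actM tens_act_deg.

Definition tens_of (X : gm) : gm := coord_mod X tens_rep.
Definition tmap_of (X : gm) (x : X) (y : Y) : tens_of X :=
  [ffun j => (bco b y j)%:A *: tw (ggr X) (bdg b j) x].

Lemma ffun_Mz (V : zmodType) n (f : {ffun 'I_n -> V}) m i : (f *~ m) i = f i *~ m.
Proof. by apply: (additiveMz (f := fun f : {ffun 'I_n -> V} => f i)) => ? ?; rewrite ffunE. Qed.

Lemma tens_ofP (X : gm) : is_tensor (@tmap_of X).
Proof.
split.
- split=> c *; apply/ffunP=> j; rewrite [RHS]ffunE coord_k !ffunE.
    by rewrite twD tw_k scalerDr kcomm.
  by rewrite bcoP kD kA.
- move=> W f fb; have fD := kbilDl fb (@scale1r _ _); have fr := kbil_sumr fb (@scale1r _ _).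
  exists (fun z => \sum_j f (tw (ggr X) (bdg b j) ((z : {ffun 'I_(bn b) -> X}) j)) (be b j)).
  split.
  - move=> c z z'; rewrite scaler_sumr -big_split; apply: eq_bigr => j _.
    by rewrite ffunE coord_k twD tw_k fb.1.
  - move=> x y; rewrite [in RHS](be_sum b y) fr; apply: eq_bigr => j _.
    rewrite ffunE tw_k twKK -[_ *: x]addr0 -[_ *: be b j]addr0 fb.1 fb.2.
    by rewrite (kbil0l fb (@scale1r _ _)) (kbil0r fb (@scale1r _ _)).
  move=> u ul ue z.
  have e : z = \sum_j tmap_of (tw (ggr X) (bdg b j) ((z : {ffun 'I_(bn b) -> X}) j)) (be b j).
    apply/ffunP=> i; rewrite sum_ffunE (bigD1 i) //= ffunE bco_be eqxx k1 twKK.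
    by rewrite big1 ?addr0 // => j ji; rewrite ffunE bco_be eq_sym (negPf ji) k0.
  have uD x y : u (x + y) = u x + u y by rewrite -[x]k1 ul k1 scale1r.
  have u0 : u 0 = 0 by apply: (@addrI _ (u 0)); rewrite -uD !addr0.
  by rewrite {1}e (big_morph u uD u0); apply: eq_bigr => j _; rewrite ue.
- move=> g h x y hx hy; apply/coord_homog => j; rewrite ffunE.
  have [->|c0] := eqVneq (bco b y j) 0; first by rewrite k0; apply: homog_0.
  by rewrite /= (bco_homog hy c0) addrK; apply/homog_k/homog_tw.
move=> a g x y hx; apply/ffunP => i; rewrite coord_modZ sum_ffunE.
under eq_bigr => j _ do rewrite scaler_suml.
rewrite exchange_big; apply: eq_big_seq => s sa /=.
rewrite ffun_Mz [in RHS]ffunE.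
have -> : bco b (s.2.2 *: y) i = \sum_j bco b y j * bco b (s.2.2 *: be b j) i.
  rewrite {1}[y](be_sum b) scaler_sumr bco_sum.
  by apply: eq_bigr => j _; rewrite kcomm bcoZ.
rewrite !scaler_suml mulrz_suml; apply: eq_bigr => j _; rewrite ffunE tw_act.
have [->|c0] := eqVneq (bco b (s.2.2 *: be b j) i) 0.
  by rewrite mulr0 k0 mul0rz scale0r scale0r.
rewrite kscaleA kcomm kA mulrC !scalerMzr; congr (_ *: (_ *: _)).
rewrite !(tw_homog _ hx) -mulrzA (coef_homog (cop2_homog sa) c0) ksignDl.
by rewrite mulrAC ksign_sq mul1r.
Qed.
End TensRep.

End Tensor.

(** * Duals and internal homs *)

Section Dual.
Variables (k : fieldType) (B : falgType k) (H : hopf_algebra B).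
Local Notation gm := (gmod H deg1).
Local Notation fg := (fgmod H).
Local Notation S := (antipode H).
Local Notation twB := (tw (hgr H)).
Local Notation cop := (comult H).
Local Notation kbil f := (kbilinear (fun (c : k) z => c%:A *: z) f).

Section CoordFg.
Variables (X : gm) (n : nat) (R : mx_rep H n).
Definition delta (j : 'I_n) (x : X) : coord_mod X R := [ffun i => if i == j then x else 0].
Lemma delta_klin j : klin (delta j).
Proof.
move=> c x y; apply/ffunP=> i; rewrite [RHS]ffunE coord_k !ffunE.
by case: eqP; rewrite ?scaler0 ?addr0.
Qed.
Lemma delta_sum (f : coord_mod X R) : f = \sum_j delta j ((f : {ffun 'I_n -> X}) j).
Proof.
apply/ffunP=> i; rewrite sum_ffunE (bigD1 i) //= ffunE eqxx big1 ?addr0 // => j ji.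
by rewrite ffunE eq_sym (negPf ji).
Qed.
Lemma coord_fg : finitely_generated X -> finitely_generated (coord_mod X R).
Proof.
move/fg_span=> [s sp]; apply: (@span_fg _ _ _ _ [seq delta j x | j <- enum 'I_n, x <- s]).
move=> f; rewrite [f]delta_sum; apply: inspan_sum => j _.
have [c ->] := sp ((f : {ffun 'I_n -> X}) j).
rewrite (klin_sum (delta_klin j)); apply: inspan_sum => i _.
rewrite (klinZ (delta_klin j)); apply/inspanZ/inspan_mem.
by apply: allpairs_f; rewrite ?mem_enum // mem_nth.
Qed.
End CoordFg.

Lemma triv_k (c : k) (x : triv H) : c%:A *: x = c * (x : k) :> k.
Proof. by rewrite trivZ counitZ counit1 mulr1. Qed.

Lemma triv_homog g (x : triv H) : (x : k) != 0 -> homog (ggr (triv H)) g x -> g = 0.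
Proof.
move=> x0; rewrite /homog /= /triv_comp; case: eqP => // _ e.
by rewrite -e eqxx in x0.
Qed.
Lemma homog_triv g (x : triv H) : (x != 0 :> k -> g = 0) -> homog (ggr (triv H)) g x.
Proof.
have [->|_ /(_ isT) ->] := eqVneq (x : k) 0; first by move=> _; apply: homog_0.
by rewrite /homog /= /triv_comp eqxx.
Qed.

Section DualRep.
Variables (N : gm) (b : hbasis N).

(** The contragredient action (b f)(n) = (-1)^(deg b deg f) f(S(b) n) in the
    dual basis. As the coefficient vanishes unless b has degree deg e_j - deg
    e_i, the sign may be written with this difference in place of deg b, which
    makes the formula linear in b. *)
Definition dual_act (a : B) (i j : 'I_(bn b)) : B :=
  (bco b (S a *: be b i) j *~ ksign (bdg b j - bdg b i) (bdg b j))%:A.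

Fact dual_actP c x y i j : dual_act (c *: x + y) i j = c *: dual_act x i j + dual_act y i j.
Proof.
rewrite /dual_act antipode_linear scalerDl kscaleA bcoP mulrzDl scalerDl scalerA.
by rewrite mulrzAr.
Qed.
Lemma dual_act0 i j : dual_act 0 i j = 0.
Proof. by rewrite /dual_act antipode0 scale0r bco0 mul0rz scale0r. Qed.
Lemma dual_actD c c' i j : dual_act (c + c') i j = dual_act c i j + dual_act c' i j.
Proof. by rewrite -{1}[c]scale1r dual_actP scale1r. Qed.
Fact dual_act1 i j : dual_act 1 i j = (i == j)%:R.
Proof.
rewrite /dual_act antipode1 scale1r bco_be eq_sym.
case: eqP => [->|]; last by rewrite mul0rz scale0r.
by rewrite subrr ksign0l mulr1z scale1r.
Qed.
Lemma dual_coef p (a : B) i j : homog (hgr H) p a ->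
  dual_act a i j = (bco b (S a *: be b i) j *~ ksign p (p + bdg b i))%:A.
Proof.
move=> ha; rewrite /dual_act.
have [->|c0] := eqVneq (bco b (S a *: be b i) j) 0; first by rewrite !mul0rz.
by rewrite (coef_homog (antipode_deg ha) c0) addrK.
Qed.
Fact dual_actM x y i j : dual_act (x * y) i j = \sum_l dual_act x i l * dual_act y l j.
Proof.
elim/(@homog_ind _ _ (hgr H)): x => [|x x' hx hx'|p x hx].
- by rewrite mul0r dual_act0 big1 // => l _; rewrite dual_act0 mul0r.
- rewrite mulrDl dual_actD hx hx' -big_split; apply: eq_bigr => l _ /=.
  by rewrite dual_actD mulrDl.
elim/(@homog_ind _ _ (hgr H)): y => [|y y' hy hy'|q y hy].
- by rewrite mulr0 dual_act0 big1 // => l _; rewrite dual_act0 mulr0.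
- rewrite mulrDr dual_actD hy hy' -big_split; apply: eq_bigr => l _ /=.
  by rewrite dual_actD mulrDr.
rewrite (dual_coef _ _ (hgrM hx hy)) (antipodeM hx hy) -[(_ *~ _) *: be b i]scalerMzl bcoMz bco_mul.
rewrite -mulrzA mulrz_suml scaler_suml; apply: eq_bigr => l _.
rewrite (dual_coef _ _ hx) (dual_coef _ _ hy) mulr_algl scalerA.
congr (_ *: _); rewrite mulrzAl mulrzAr -mulrzA mulrC.
have [->|c0] := eqVneq (bco b (S x *: be b i) l) 0; first by rewrite mul0r !mul0rz.
rewrite (coef_homog (antipode_deg hx) c0); congr (_ *~ _).
rewrite !(ksignDl, ksignDr) (ksignC q p).
transitivity (ksign p q * ksign p q * (ksign p p * ksign p (bdg b i) *
   (ksign p q * ksign q q * ksign q (bdg b i)))); first by ring.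
by rewrite ksign_sq; ring.
Qed.
Fact dual_act_deg p a i j : homog (hgr H) p a ->
  homog (hgr H) (p + (- bdg b j) - (- bdg b i)) (dual_act a i j).
Proof.
move=> ha; rewrite (dual_coef _ _ ha).
have [->|c0] := eqVneq (bco b (S a *: be b i) j) 0.
  by rewrite mul0rz scale0r; apply: homog_0.
rewrite (coef_homog (antipode_deg ha) c0).
have -> : p - (p + bdg b i) - - bdg b i = 0 by ring.
exact: hgr_alg.
Qed.
Definition dual_rep : mx_rep H (bn b) :=
  @MxRep _ _ _ _ (fun j => - bdg b j) dual_act dual_actP dual_act1 dual_actM dual_act_deg.

Definition dual_of : gm := coord_mod (triv H) dual_rep.

Definition dpair (f : dual_of) (n : N) : triv H :=
  \sum_j ((f : {ffun 'I_(bn b) -> triv H}) j : k) * bco b n j.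

Lemma dpair_kbil : kbil dpair.
Proof.
split=> c *; rewrite triv_k /dpair mulr_sumr -big_split; apply: eq_bigr => j _ /=.
  by rewrite ffunE coord_k triv_k mulrDl mulrA.
by rewrite bcoP mulrDr mulrCA.
Qed.
Lemma dpair_deg h g f n : homog (ggr dual_of) h f -> homog (ggr N) g n ->
  homog (ggr (triv H)) (h + g : int) (dpair f n).
Proof.
move=> /coord_homog hf hn; apply: (homog_sum (gr := ggr (triv H))) => j _.
apply: homog_triv; rewrite mulf_eq0 negb_or => /andP[f0 n0].
have := triv_homog f0 (hf j); rewrite /= opprK => <-.
by rewrite (bco_homog hn n0).
Qed.
Lemma dpair_act p h a f n : homog (hgr H) p a -> homog (ggr dual_of) h f ->
  dpair (a *: f) n = dpair f (S a *: n) *~ ksign p h.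
Proof.
move=> ha /coord_homog hf; rewrite /dpair.
under eq_bigr => i _ do rewrite coord_modZ mulr_suml.
rewrite exchange_big mulrz_suml; apply: eq_bigr => j _ /=.
have -> : bco b (S a *: n) j = \sum_i bco b n i * bco b (S a *: be b i) j.
  rewrite {1}[n](be_sum b) scaler_sumr bco_sum.
  by apply: eq_bigr => i _; rewrite kcomm bcoZ.
rewrite mulr_sumr mulrz_suml; apply: eq_bigr => i _.
rewrite /dual_act triv_k.
have [->|c0] := eqVneq (bco b (S a *: be b i) j) 0.
  by rewrite !(mul0rz, mul0r, mulr0).
have [->|f0] := eqVneq (f j : k) 0; first by rewrite !(mul0rz, mul0r, mulr0).
have := triv_homog f0 (hf j); rewrite /= opprK => /eqP; rewrite addr_eq0 => /eqP ->.
rewrite (coef_homog (antipode_deg ha) c0) addrK ksignNr !mulrzAl; congr (_ *~ _).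
by ring.
Qed.
(** The antipode axiom makes evaluation invariant. The twists by g account for
    an element of degree g to the left of f, as in W (x) N^*. *)
Lemma dpair_inner g h c f n : homog (ggr dual_of) h f ->
  \sum_(v <- cop c) dpair (twB g v.1.2 *: f) (twB (g + h) v.2.2 *: n) =
  (counit H c)%:A *: dpair f n.
Proof.
move=> hf; have tk1 (w : triv H) := k1 w.
have -> : (counit H c)%:A *: dpair f n = dpair f ((counit H c)%:A *: n).
  by rewrite (kbilZr dpair_kbil).
rewrite -(tw1 H (g + h)) -tw_hgrZ -antipodel tw_sum scaler_suml.
rewrite (kbil_sumr dpair_kbil) //; apply: eq_big_seq => v vc.
have hv := homog_tw g (cop1_homog vc).
rewrite (dpair_act _ hv hf) -(kbilMzr dpair_kbil) //; congr (dpair f _).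
rewrite scalerA scalerMzl -mulrzAl twM; congr (_ * _ *: _).
rewrite addrC -tw_tw antipode_tw (tw_homog h (homog_tw g (antipode_deg (cop1_homog vc)))).
by rewrite ksignC.
Qed.
Definition dv (j : 'I_(bn b)) : dual_of := delta (X := triv H) dual_rep j (1 : k).
Lemma dpair_dv j n : dpair (dv j) n = bco b n j.
Proof.
rewrite /dpair (bigD1 j) //= ffunE eqxx mul1r big1 ?addr0 // => i ij.
by rewrite ffunE (negPf ij) mul0r.
Qed.
Lemma dv_sum f : f = \sum_j (dpair f (be b j))%:A *: dv j.
Proof.
have ck (c : k) (h : dual_of) i : (c%:A *: h : {ffun _ -> triv H}) i = c%:A *: (h : {ffun _ -> triv H}) i := coord_k c h i.
apply/ffunP=> i; rewrite sum_ffunE (bigD1 i) //= ck ffunE eqxx.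
rewrite big1 ?addr0 => [|j ji]; last by rewrite ck ffunE eq_sym (negPf ji) scaler0.
apply: esym; rewrite triv_k mulr1 /dpair (bigD1 i) //= bco_be eqxx mulr1.
by rewrite big1 ?addr0 // => j ji; rewrite bco_be (negPf ji) mulr0.
Qed.
End DualRep.

Definition hb (N : fg) : hbasis N := projT1 (cid (hbasis_ex (fgcarP N))).

Lemma triv_fg : finitely_generated (triv H).
Proof.
exists [:: (1 : k) : triv H] => x; exists (fun=> (x : k)%:A).
rewrite big_ord1 /=; have := triv_k x ((1 : k) : triv H); rewrite mulr1 => e.
by rewrite -{1}e.
Qed.
Definition ftriv : fg := FGMod triv_fg.
Definition dual (N : fg) : fg := FGMod (coord_fg (dual_rep (hb N)) triv_fg).

Definition tens (X : gm) (Y : fg) : gm := tens_of (hb Y) X.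
Definition tmap (X : gm) (Y : fg) : X -> Y -> tens X Y := @tmap_of _ _ _ _ (hb Y) X.
Arguments tmap : clear implicits.
Lemma tensP (X : gm) (Y : fg) : is_tensor (tmap X Y). Proof. exact: tens_ofP. Qed.
Definition ftens (X Y : fg) : fg := FGMod (coord_fg (tens_rep (hb Y)) (fgcarP X)).

Section IHom.
Variables (N : fg) (W : gm).
(** In finite dimension the internal hom is W (x) N^*; its elements are seen
    as linear maps N -> W through the evaluation app. *)
Definition ihom : gm := tens W (dual N).
Local Notation it := (tmap W (dual N)).

Lemma app_ex (n : N) : exists u : ihom -> W, klin u /\
  forall w (f : dual N), u (it w f) = (dpair f n)%:A *: w.
Proof.
apply: (tens_klift (tensP W (dual N))); split=> c *.
  by rewrite scalerDr kcomm.
by rewrite (dpair_kbil (hb N)).1 triv_k kD kA.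
Qed.
Definition app (u : ihom) (n : N) : W := projT1 (cid (app_ex n)) u.
Lemma app_klin n : klin (app^~ n).
Proof. by rewrite /app; case: cid => u []. Qed.
Lemma app_it w (f : dual N) n : app (it w f) n = (dpair f n)%:A *: w.
Proof. by rewrite /app; case: cid => u []. Qed.
Lemma app_kbil : kbil app.
Proof.
split=> c; first by move=> *; rewrite app_klin.
move=> u n n'; apply: (tens_ext (tensP W (dual N)) (u := app^~ _)
  (v := fun u => c%:A *: app u n + app u n')).
- exact: app_klin.
- by move=> d x y; rewrite !app_klin !scalerDr kcomm addrACA.
by move=> w f; rewrite !app_it (dpair_kbil (hb N)).2 triv_k kD kA.
Qed.

Lemma ihomE (u : ihom) : u = \sum_j it (app u (be (hb N) j)) (dv (b := hb N) j).
Proof.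
have tb := tens_kbil (tensP W (dual N)); have k1' (w : ihom) := k1 w.
apply: (tens_ext (tensP W (dual N)) (u := id)
   (v := fun u => \sum_j it (app u (be (hb N) j)) (dv (b := hb N) j))) => //.
  move=> c x y; rewrite scaler_sumr -big_split; apply: eq_bigr => j _.
  by rewrite app_klin tb.1.
move=> w f; rewrite {1}[f]dv_sum (kbil_sumr tb) //; apply: eq_bigr => j _.
by rewrite app_it (kbilZl tb) (kbilZr tb).
Qed.
Lemma app_ext (u v : ihom) : (forall n, app u n = app v n) -> u = v.
Proof. by move=> e; rewrite [u]ihomE [v]ihomE; apply: eq_bigr => j _; rewrite e. Qed.
Lemma app_surj (h : N -> W) : klin h -> exists u : ihom, forall n, app u n = h n.
Proof.
move=> hl; exists (\sum_j it (h (be (hb N) j)) (dv (b := hb N) j)) => n.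
rewrite (klin_sum (app_klin n)) {2}[n](be_sum (hb N)) (klin_sum hl).
by apply: eq_bigr => j _; rewrite app_it dpair_dv (klinZ hl).
Qed.
Lemma app_gr g h u n : homog (ggr N) h n ->
  ggr W (g + h : int) (app u n) = app (ggr ihom g u) n.
Proof.
move=> hn; have [_ td _] := tens_pairing (tensP W (dual N)).
apply: (tens_ext_homog (tensP W (dual N)) (u := fun u => ggr W (g + h : int) (app u n))
  (v := fun u => app (ggr ihom g u) n)).
- by move=> c x y; rewrite app_klin klin_gr.
- by move=> c x y; rewrite klin_gr app_klin.
move=> p q w f hw hf; rewrite (gr_homog _ (td _ _ _ _ hw hf)) app_it gr_k.
have [e0|f0] := eqVneq (dpair f n : k) 0.
  rewrite e0 k0; case: eqP; rewrite ?app_it ?e0 ?k0 //.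
  by rewrite (klin0 (app_klin n)).
have hq : q = - h.
  by apply/eqP; rewrite -addr_eq0; apply/eqP; apply: triv_homog f0 (dpair_deg hf hn).
rewrite (gr_homog _ hw) hq -subr_eq opprK.
by case: eqP; rewrite ?app_it // (klin0 (app_klin n)) scaler0.
Qed.
Lemma app_homog g u : homog (ggr ihom) g u <->
  forall h n, homog (ggr N) h n -> homog (ggr W) (g + h : int) (app u n).
Proof.
split=> [hu h n hn|hu]; first by rewrite /homog (app_gr _ _ hn) hu.
apply: app_ext => n; elim/(@homog_ind _ _ (ggr N)): n => [|x y hx hy|h x hx].
- by rewrite !(kbil0r app_kbil) // => w; rewrite k1.
- by rewrite !(kbilDr app_kbil) ?hx ?hy // => w; rewrite k1.
by rewrite -(app_gr _ _ hx); apply: hu.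
Qed.
(** By coassociativity, acting on w (x) f (x) n and then evaluating contracts
    the two inner factors, where dpair_inner applies. *)
Lemma app_pairing : pairing app.
Proof.
have wk1 (w : W) := k1 w; have tk1 (w : triv H) := k1 w.
have sumMk (s : B) (w : W) F' : \sum_(v <- cop s) (F' v : k)%:A *: w = (\sum_(v <- cop s) F' v)%:A *: w.
  by rewrite -!scaler_suml.
split; first exact: app_kbil.
  by move=> g h u n hu; apply: (app_homog g u).1.
have [tb td te] := tens_pairing (tensP W (dual N)).
move=> b u n; apply: (tens_ext_homog (tensP W (dual N)) (u := fun u => b *: app u n)
  (v := fun u => \sum_(s <- cop b) app (s.1.2 *: tw (ggr ihom) s.2.1 u) (s.2.2 *: n))).
- by move=> c x y; rewrite app_klin klin_act.
- move=> c x y; rewrite scaler_sumr -big_split; apply: eq_bigr => s _.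
  by rewrite klin_tw klin_act app_klin.
move=> g h w f hw hf; rewrite app_it.
pose F x y z := (dpair (twB g y *: f) (twB (g + h) z *: n) : k)%:A *: (x *: w).
have pb := dpair_kbil (hb N).
have Ft : @trilinear3 k B (kmod W) F.
  apply: trilinear_kmod => c *; rewrite /F.
  - by rewrite scalerDl [(c *: _) *: w]kscaleA scalerDr !kA mulrC.
  - by rewrite tw_hgrP scalerDl [(c *: _) *: f]kscaleA pb.1 triv_k kD kA.
  - by rewrite tw_hgrP scalerDl [(c *: _) *: n]kscaleA pb.2 triv_k kD kA.
transitivity (\sum_(s <- cop b) \sum_(v <- cop s.2.2) F s.1.2 v.1.2 v.2.2).
  have -> : b *: ((dpair f n : k)%:A *: w) =
     (dpair f n : k)%:A *: (\sum_(s <- cop b) (counit H s.2.2 *: s.1.2) *: w).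
    by rewrite -scaler_suml counitr kcomm.
  rewrite scaler_sumr.
  apply: eq_bigr => s _; rewrite /F sumMk (dpair_inner g _ n hf) triv_k.
  by rewrite [(_ *: s.1.2) *: w]kscaleA !kA mulrC.
rewrite -(comultA_kmod H Ft); apply: eq_big_seq => s sb.
rewrite (tw_homog _ (td _ _ _ _ hw hf)) (klinMz (klin_act _)) te (klinMz (app_klin _)).
rewrite (klin_sum (app_klin _)) mulrz_suml; apply: eq_big_seq => v vs.
rewrite app_it (tw_homog _ hw) /F.
rewrite (tw_homog _ (cop2_homog vs)) (tw_homog _ (cop2_homog sb)).
have pk (d : triv H) m (y : W) : ((d *~ m : triv H) : k)%:A *: y = ((d : k)%:A *: y) *~ m.
  exact: (additiveMz (f := fun d : triv H => (d : k)%:A *: y)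
    (fun x z => kD (x : k) (z : k) y)).
rewrite -!scalerMzl (kbilMzl pb) // (kbilMzr pb) // !pk -!scalerMzr.
rewrite [ksign (g + h) _]ksignC [ksign g _]ksignC -!mulrzA.
by congr (_ *~ _); apply: mulrC.
Qed.

(** The action of B on the first argument can be moved to the other argument
    and the value by means of the antipode. So a pairing determines the action
    on its first argument, which is how the equivariance of curried maps is
    proved. *)
Lemma pairing_act (P : gm) (al : P -> N -> W) : pairing al -> forall b p n,
  al (b *: p) n =
  \sum_(s <- cop b) s.1.2 *: al (tw (ggr P) s.2.1 p) (S s.2.2 *: n).
Proof.
move=> [ab _ ae] b p n; have wk1 (w : W) := k1 w.
have e1 c : al (b *: c) n = \sum_(s <- cop b) (counit H s.2.2)%:A *: al (s.1.2 *: c) n.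
  rewrite -{1}[b](counitr H) scaler_suml (kbil_suml ab) //.
  by apply: eq_bigr => s _; rewrite [in LHS]kscaleA (kbilZl ab).
elim/(@homog_ind _ _ (ggr P)): p => [|p p' hp hp'|h p hp].
- rewrite scaler0 (kbil0l ab) // big1 // => s _.
  by rewrite tw0 (kbil0l ab) // scaler0.
- rewrite scalerDr (kbilDl ab) // hp hp' -big_split; apply: eq_bigr => s _ /=.
  by rewrite twD (kbilDl ab) // scalerDr.
pose F x y z := al (x *: p) ((twB h y * S (twB h z)) *: n).
have Ft : @trilinear3 k B (kmod W) F.
  apply: trilinear_kmod => c *; rewrite /F.
  - by rewrite scalerDl kscaleA ab.1.
  - by rewrite tw_hgrP mulrDl -scalerAl scalerDl kscaleA ab.2.
  - by rewrite tw_hgrP antipode_linear mulrDr -scalerAr scalerDl kscaleA ab.2.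
rewrite e1; transitivity (\sum_(s <- cop b) \sum_(v <- cop s.2.2) F s.1.2 v.1.2 v.2.2).
  apply: eq_bigr => s _; rewrite /F -(kbil_sumr ab) // -scaler_suml.
  under eq_bigr => v _ do rewrite antipode_tw -twM.
  by rewrite -tw_sum antipoder tw_hgrZ tw1 (kbilZr ab).
rewrite -(comultA_kmod H Ft); apply: eq_big_seq => s sb.
rewrite ae; apply: eq_big_seq => v vs; rewrite /F tw_tw.
rewrite (tw_homog _ hp) (tw_homog _ (cop2_homog vs)) (tw_homog _ (cop2_homog sb)).
rewrite antipodeMz !(mulrzAl, mulrzAr) -!scalerMzl -scalerMzr !(kbilMzr ab) // (kbilMzl ab) //.
by rewrite scalerA -!mulrzA ksignDl ![ksign h _]ksignC mulrC.
Qed.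

Lemma curry (P : gm) (al : P -> N -> W) : pairing al ->
  exists g : ghom P ihom, forall p n, app (g p) n = al p n.
Proof.
move=> ap; have [ab ad _] := ap; have wk1 (w : W) := k1 w.
have al_klin p : klin (al p) by move=> c x y; rewrite ab.2.
pose g p := projT1 (cid (app_surj (al_klin p))).
have gE p n : app (g p) n = al p n by rewrite /g; case: cid.
have gD x y : g (x + y) = g x + g y.
  by apply: app_ext => n; rewrite (klinD (app_klin n)) !gE (kbilDl ab).
have g_tw i p : g (tw (ggr P) i p) = tw (ggr ihom) i (g p).
  elim/(@homog_ind _ _ (ggr P)): p => [|p p' hp hp'|h p hp].
  - have g0 : g 0 = 0 by apply: (@addrI _ (g 0)); rewrite -gD !addr0.
    by rewrite tw0 g0 tw0.
  - by rewrite twD !gD hp hp' twD.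
  have hg : homog (ggr ihom) h (g p).
    by apply/app_homog => h' n hn; rewrite gE; apply: ad.
  by rewrite (tw_homog _ hp) (tw_homog _ hg) (additiveMz gD).
have gZ b x : g (b *: x) = b *: g x.
  apply: app_ext => n; rewrite gE (pairing_act ap) (pairing_act app_pairing).
  by apply: eq_bigr => s _; rewrite -g_tw gE.
have gd h p : homog (ggr P) h p -> homog (ggr ihom) h (g p).
  by move=> hp; apply/app_homog => h' n hn; rewrite gE; apply: ad.
by have [G GE] := mk_ghom gD gZ gd; exists G => p n; rewrite GE gE.
Qed.
End IHom.
End Dual.

Section Rigid.
Variables (k : fieldType) (B : falgType k) (H : hopf_algebra B).
Local Notation gm := (gmod H deg1).
Local Notation fg := (fgmod H).
Local Notation S := (antipode H).
Local Notation twB := (tw (hgr H)).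
Local Notation cop := (comult H).
Local Notation kbil f := (kbilinear (fun (c : k) z => c%:A *: z) f).

(** * Kernels, direct sums and projective modules *)

Section MatrixOf.
Variables M N : fg.
Definition mx_of (u : M -> N) : 'M[k]_(bn (hb M), bn (hb N)) :=
  \matrix_(j, i) bco (hb N) (u (be (hb M) j)) i.
Definition row_of (M : fg) (x : M) : 'rV[k]_(bn (hb M)) := \row_j bco (hb M) x j.
Definition of_row (M : fg) (v : 'rV[k]_(bn (hb M))) : M := \sum_j (v 0 j)%:A *: be (hb M) j.
Lemma row_ofK (P : fg) (x : P) : of_row (row_of x) = x.
Proof. by rewrite /of_row [RHS](be_sum (hb P)); apply: eq_bigr => j _; rewrite mxE. Qed.
Lemma of_rowK (P : fg) (v : 'rV_(bn (hb P))) : row_of (of_row v) = v.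
Proof. by apply/rowP=> i; rewrite mxE bco_comb. Qed.
Lemma of_rowD (P : fg) c (v w : 'rV_(bn (hb P))) : of_row (c *: v + w) = c%:A *: of_row v + of_row w.
Proof.
rewrite /of_row scaler_sumr -big_split; apply: eq_bigr => j _.
by rewrite !mxE kD kA.
Qed.
Lemma of_row_sum (P : fg) (I : Type) (r : seq I) (c : I -> k) (v : I -> 'rV_(bn (hb P))) :
  of_row (\sum_(i <- r) c i *: v i) = \sum_(i <- r) (c i)%:A *: of_row (v i).
Proof.
elim: r => [|i r IH]; last by rewrite !big_cons of_rowD IH.
by rewrite !big_nil /of_row big1 // => j _; rewrite mxE k0.
Qed.
Lemma row_of_klin (P : fg) c (x y : P) : row_of (c%:A *: x + y) = c *: row_of x + row_of y.
Proof. by apply/rowP=> i; rewrite !mxE bcoP. Qed.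
Lemma mx_ofE u x : klin u -> row_of (u x) = row_of x *m mx_of u.
Proof.
move=> ul; apply/rowP=> i; rewrite !mxE {1}[x](be_sum (hb M)) (klin_sum ul) bco_sum.
by apply: eq_bigr => j _; rewrite !mxE (klinZ ul) bcoZ.
Qed.

Lemma ker_fg (f : ghom M N) : finitely_generated (ker f).
Proof.
pose K := kermx (mx_of f).
have kl l : f (of_row (row l K)) = 0.
  rewrite -[f _]row_ofK (mx_ofE _ (klin_lin f)) of_rowK -row_mul mulmx_ker.
  by rewrite /of_row big1 // => j _; rewrite !mxE k0.
pose y l := projT1 (cid (ker_lift (kl l))).
have yE l : ker_inc f (y l) = of_row (row l K) by rewrite /y; case: cid.
apply: (@span_fg _ _ _ _ [seq y l | l <- enum 'I_(bn (hb M))]) => z.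
have : row_of (ker_inc f z) *m mx_of f = 0.
  by rewrite -(mx_ofE _ (klin_lin f)) ker_inc0; apply/rowP=> i; rewrite !mxE bco0.
move/sub_kermxP/submxP=> [w we].
suff -> : z = \sum_l (w 0 l)%:A *: y l.
  by apply: inspan_sum => l _; apply/inspanZ/inspan_mem/map_f; rewrite mem_enum.
apply: ker_inc_inj; rewrite -[LHS]row_ofK we mulmx_sum_row linear_sum of_row_sum.
by apply: eq_bigr => l _; rewrite linearZ yE.
Qed.
End MatrixOf.

Definition fker (M N : fg) (f : ghom M N) : fg := FGMod (ker_fg f).

(** A linear retraction exists by linear algebra; it has no reason to be
    equivariant. *)
Lemma klin_retraction (X Y : fg) (i : ghom X Y) : injective i ->
  exists r : Y -> X, klin r /\ forall x, r (i x) = x.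
Proof.
move=> ii; have fr : row_free (mx_of i).
  rewrite -kermx_eq0; apply/rowV0P => v /sub_kermxP v0.
  have : i (of_row v) = 0.
    rewrite -[i _]row_ofK (mx_ofE _ (klin_lin i)) of_rowK v0 /of_row big1 // => j _.
    by rewrite !mxE k0.
  rewrite -(linear0 i) => /ii e; rewrite -[v]of_rowK e.
  by apply/rowP=> j; rewrite !mxE bco0.
exists (fun y => of_row (row_of y *m pinvmx (mx_of i))); split.
  by move=> c x y; rewrite row_of_klin mulmxDl -scalemxAl of_rowD.
by move=> x; rewrite (mx_ofE _ (klin_lin i)) -mulmxA (mulmxVp fr) mulmx1 row_ofK.
Qed.

Lemma gfun0 (M N : gm) (f : ghom M N) : f 0 = 0. Proof. exact: linear0. Qed.
Lemma gfunD (M N : gm) (f : ghom M N) x y : f (x + y) = f x + f y. Proof. exact: linearD. Qed.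
Lemma gfunN (M N : gm) (f : ghom M N) x : f (- x) = - f x. Proof. exact: linearN. Qed.
Lemma gfunB (M N : gm) (f : ghom M N) x y : f (x - y) = f x - f y. Proof. exact: linearB. Qed.
Lemma gfunZ (M N : gm) (f : ghom M N) b x : f (b *: x) = b *: f x. Proof. exact: linearZ. Qed.

Section DSumMaps.
Variables (M N : gm).
Lemma inl_ex : exists f : ghom M (dsum M N), forall x, f x = (x, 0).
Proof.
apply: mk_ghom => [x y|b x|g x hx].
- by apply: injective_projections; rewrite /= ?addr0 ?add0r ?scaler0.
- by apply: injective_projections; rewrite /= ?addr0 ?add0r ?scaler0.
by rewrite /homog /= /dsum_comp /= hx gr0.
Qed.
Definition dinl := projT1 (cid inl_ex).
Lemma dinlE x : dinl x = (x, 0). Proof. by rewrite /dinl; case: cid. Qed.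
Lemma inr_ex : exists f : ghom N (dsum M N), forall x, f x = (0, x).
Proof.
apply: mk_ghom => [x y|b x|g x hx].
- by apply: injective_projections; rewrite /= ?addr0 ?add0r ?scaler0.
- by apply: injective_projections; rewrite /= ?addr0 ?add0r ?scaler0.
by rewrite /homog /= /dsum_comp /= hx gr0.
Qed.
Definition dinr := projT1 (cid inr_ex).
Lemma dinrE x : dinr x = (0, x). Proof. by rewrite /dinr; case: cid. Qed.
Lemma fst_ex : exists f : ghom (dsum M N) M, forall x, f x = x.1.
Proof. by apply: mk_ghom => // g x; rewrite /homog /= /dsum_comp => {2}<-. Qed.
Definition dfst := projT1 (cid fst_ex).
Lemma dfstE x : dfst x = x.1. Proof. by rewrite /dfst; case: cid. Qed.
Lemma snd_ex : exists f : ghom (dsum M N) N, forall x, f x = x.2.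
Proof. by apply: mk_ghom => // g x; rewrite /homog /= /dsum_comp => {2}<-. Qed.
Definition dsnd := projT1 (cid snd_ex).
Lemma dsndE x : dsnd x = x.2. Proof. by rewrite /dsnd; case: cid. Qed.
Definition dsumE := (dinlE, dinrE, dfstE, dsndE).
End DSumMaps.

Lemma dpair_ex (M N P : gm) (f : ghom P M) (g : ghom P N) :
  exists h : ghom P (dsum M N), forall x, h x = (f x, g x).
Proof.
exists (gadd (gcomp (dinl M N) f) (gcomp (dinr M N) g)) => x /=.
by rewrite !dsumE; apply: injective_projections; rewrite /= ?addr0 ?add0r ?scaler0.
Qed.
Lemma dcopair_ex (M N P : gm) (f : ghom M P) (g : ghom N P) :
  exists h : ghom (dsum M N) P, forall x, h x = f x.1 + g x.2.
Proof.
by exists (gadd (gcomp f (dfst M N)) (gcomp g (dsnd M N))) => x /=; rewrite !dsumE.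
Qed.
Lemma dprod_ex (M N M' N' : gm) (f : ghom M M') (g : ghom N N') :
  exists h : ghom (dsum M N) (dsum M' N'), forall x, h x = (f x.1, g x.2).
Proof.
have [h hE] := dpair_ex (gcomp f (dfst M N)) (gcomp g (dsnd M N)).
by exists h => x; rewrite hE /= !dsumE.
Qed.

Lemma dsum_fg (M N : fg) : finitely_generated (dsum M N).
Proof.
have [s sp] := fg_span (fgcarP M); have [r rp] := fg_span (fgcarP N).
apply: (@span_fg _ _ _ _ ([seq dinl M N x | x <- s] ++ [seq dinr M N x | x <- r])).
move=> z; have -> : z = dinl M N z.1 + dinr M N z.2.
  by rewrite !dsumE [LHS]surjective_pairing; apply: injective_projections; rewrite /= ?addr0 ?add0r ?scaler0.
apply: inspanD.
  have [c ->] := sp z.1; rewrite linear_sum; apply: inspan_sum => i _.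
  by rewrite linearZ; apply/inspanZ/inspan_mem; rewrite mem_cat map_f // mem_nth.
have [c ->] := rp z.2; rewrite linear_sum; apply: inspan_sum => i _.
by rewrite linearZ; apply/inspanZ/inspan_mem; rewrite mem_cat orbC map_f // mem_nth.
Qed.
Definition fdsum (M N : fg) : fg := FGMod (dsum_fg M N).

Lemma proj_retract (X P : gm) (a : ghom X P) (b : ghom P X) :
  (forall x, b (a x) = x) -> projective P -> projective X.
Proof.
move=> ba pP M N p f ps; have [h he] := pP M N p (gcomp f b) ps.
by exists (gcomp h a) => x /=; rewrite he /= ba.
Qed.

Lemma proj_dsum (P Q : gm) : projective P -> projective Q -> projective (dsum P Q).
Proof.
move=> pP pQ M N p f ps.
have [h he] := pP M N p (gcomp f (dinl P Q)) ps.
have [l le] := pQ M N p (gcomp f (dinr P Q)) ps.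
have [u ue] := dcopair_ex h l; exists u => x.
transitivity (f (dinl P Q x.1) + f (dinr P Q x.2)); first by rewrite ue gfunD he le.
rewrite -gfunD !dsumE.
by congr (f _); rewrite [RHS]surjective_pairing; apply: injective_projections; rewrite /= ?addr0 ?add0r ?scaler0.
Qed.

Lemma reg_fg : finitely_generated (reg H).
Proof. by exists [:: 1] => x; exists (fun=> x); rewrite big_ord1 /=; apply: esym; apply: mulr1. Qed.
Definition freg : fg := FGMod reg_fg.
Lemma reg_proj : projective (reg H).
Proof.
move=> M N p f ps; have [x0 x0E] := ps (f (1 : B)).
have hx : homog (ggr M) 0 (ggr M 0 x0) := homog_gr _ _ _.
have px : p (ggr M 0 x0) = f (1 : B).
  by rewrite ghom_gr x0E -ghom_gr; congr (f _); apply: hgr1.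
have [h hE] : exists h : ghom (reg H) M, forall b, h b = b *: ggr M 0 x0.
  apply: mk_ghom => [x y|b x|g x hg].
  - by rewrite scalerDl.
  - by rewrite scalerA.
  by have := gact (hg : homog (hgr H) g x) hx; rewrite /= addr0.
exists h => x; rewrite hE gfunZ px -gfunZ; congr (f _); exact: mulr1.
Qed.

(** By adjunction, a lifting problem for X (x) Y along M -> N is a lifting
    problem for X along [Y, M] -> [Y, N]. The latter map is surjective since
    linear maps from Y can be lifted on a basis. *)
Lemma proj_tens (X : gm) (Y : fg) (T : gm) (t : X -> Y -> T) :
  is_tensor t -> projective X -> projective T.
Proof.
move=> tT pX M N p f ps; have tp := tens_pairing tT.
have [fc fcE] := curry (pairing_comp f (gid X) (gid Y) tp).
have [q qE] := curry (pairing_comp p (gid _) (gid Y) (app_pairing Y M)).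
have qs v : exists u, q u = v.
  pose w j := projT1 (cid (ps (app v (be (hb Y) j)))).
  have wE j : p (w j) = app v (be (hb Y) j) by rewrite /w; case: cid.
  have hk : klin (fun y => \sum_j (bco (hb Y) y j)%:A *: w j).
    move=> c x y; rewrite scaler_sumr -big_split; apply: eq_bigr => j _.
    by rewrite bcoP kD kA.
  have [u uE] := app_surj hk; exists u; apply: app_ext => y.
  rewrite qE /= uE linear_sum [y in RHS](be_sum (hb Y)).
  rewrite (kbil_sumr (app_kbil Y N)) => [|w0]; last by rewrite k1.
  by apply: eq_bigr => j _; rewrite linearZ wE (kbilZr (app_kbil Y N)).
have [h hE] := pX _ _ q fc qs.
have [g gE] := tens_lift tT (pairing_comp (gid M) h (gid Y) (app_pairing Y M)).
exists g; apply: (tens_ext tT) => [||x y]; try exact: klin_lin.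
  by move=> c x y; rewrite !linearP.
by rewrite gE /= -[RHS]fcE -hE qE.
Qed.

(** * Commutativity of the tensor product *)

Section Swap.
Variables (X Y : gm) (W : zmodType) (sc : k -> W -> W) (f : X -> Y -> W).
Hypotheses (fb : kbilinear sc f) (sc1 : forall w, sc 1 w = w).
Hypothesis scD : forall c x y, sc c (x + y) = sc c x + sc c y.

(** The flipped bilinear map with its Koszul sign, (y, x) |-> (-1)^(deg x deg
    y) f(x, y), extended to all elements. *)
Definition swap (y : Y) (x : X) : W :=
  \sum_(g <- supp (ggr Y) y) f (tw (ggr X) g x) (ggr Y g y).

Lemma swap_sum s y x : uniq s -> {subset supp (ggr Y) y <= s} ->
  swap y x = \sum_(g <- s) f (tw (ggr X) g x) (ggr Y g y).
Proof.
move=> us sub; rewrite /swap [RHS](bigID (mem (supp (ggr Y) y))) /=.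
rewrite [X in _ = _ + X]big1 ?addr0 => [|g /gr_out ->]; last exact: kbil0r fb sc1 _.
rewrite -[RHS]big_filter; apply: perm_big; apply: uniq_perm; rewrite ?supp_uniq ?filter_uniq // => g.
by rewrite mem_filter /=; case: (boolP (g \in supp _ y)) => [/sub ->|].
Qed.
Lemma swap_homog g y x : homog (ggr Y) g y -> swap y x = f (tw (ggr X) g x) y.
Proof.
move=> hy; rewrite (swap_sum (s := undup (g :: supp (ggr Y) y))) ?undup_uniq //; last first.
  by move=> h hh; rewrite mem_undup inE hh orbT.
rewrite (bigD1_seq g) ?undup_uniq ?mem_undup ?inE ?eqxx //= hy big1 ?addr0 // => h hg.
by rewrite (gr_homog _ hy) (negPf hg) (kbil0r fb).
Qed.
Lemma swap_kbil : kbilinear sc swap.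
Proof.
have sc0 c : sc c 0 = 0 by apply: (@addrI _ (sc c 0)); rewrite -scD !addr0.
have scS c (I : Type) (s : seq I) F : sc c (\sum_(i <- s) F i) = \sum_(i <- s) sc c (F i).
  exact: (big_morph (sc c) (scD c) (sc0 c)).
split=> [c y y' x|c y x x'].
  pose s := undup (supp (ggr Y) (c%:A *: y + y') ++ supp (ggr Y) y ++ supp (ggr Y) y').
  rewrite !(swap_sum (s := s)) ?undup_uniq //; try by move=> g hg; rewrite mem_undup !mem_cat hg ?orbT.
  by rewrite scS -big_split; apply: eq_bigr => g _; rewrite klin_gr fb.2.
rewrite /swap scS -big_split; apply: eq_bigr => g _; by rewrite klin_tw fb.1.
Qed.
End Swap.

(** Graded cocommutativity says exactly that the signed flip is compatible
    with the diagonal actions. *)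
Lemma tens_swap (coH : graded_cocommutative H) (X Y T : gm) (t : X -> Y -> T) :
  is_tensor t -> is_tensor (swap t).
Proof.
move=> tT; have [tb td te] := tens_pairing tT; have wk1 (w : T) := k1 w.
have scD (c : k) (x y : T) : c%:A *: (x + y) = c%:A *: x + c%:A *: y by rewrite scalerDr.
have sb := swap_kbil tb wk1 scD.
split=> //.
- move=> W f fb; have s1 := @scale1r k W; have sD := @scalerDr k W.
  have [u [ul ue uu]] : exists u : T -> W, [/\ klinear u, forall x y, u (t x y) = swap f x y
          & forall u' : T -> W, klinear u' ->
              (forall x y, u' (t x y) = swap f x y) -> u' =1 u].
    by case: tT => _ univ _ _; apply: univ (swap_kbil fb s1 sD).
  have uD x y : u (x + y) = u x + u y by rewrite -[x]k1 ul k1 s1.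
  have ut x y : u (swap t y x) = f y x.
    have b1 : kbilinear *:%R (fun y x => u (swap t y x)).
      by split=> *; rewrite ?sb.1 ?sb.2 ul.
    apply: (kbil_ext b1 s1 fb) => g h {}y {}x hy hx.
    rewrite (swap_homog tb wk1 _ hy) ue (swap_homog fb s1 _ (homog_tw g hx)).
    by rewrite !(tw_homog _ hx) (tw_homog _ hy) (kbilMzl fb) // (kbilMzr fb) // -mulrzA ksignC ksign_sq.
  exists u; split=> // u' ul' ue'; apply: uu => // x y.
  have b1 : kbilinear *:%R (fun x y => u' (t x y)).
    by split=> *; rewrite ?tb.1 ?tb.2 ul'.
  apply: (kbil_ext b1 s1 (swap_kbil fb s1 sD)) => g h {}x {}y hx hy.
  have uD' a b : u' (a + b) = u' a + u' b by rewrite -[a]k1 ul' k1 s1.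
  rewrite (swap_homog fb s1 _ hx) (tw_homog _ hy) (kbilMzl fb) // -ue' (swap_homog tb wk1 _ hy).
  by rewrite (tw_homog _ hx) (kbilMzl tb) // (additiveMz uD') -mulrzA ksignC ksign_sq.
- move=> g h y x hy hx; rewrite (swap_homog tb wk1 _ hy) addrC.
  exact: td (homog_tw _ hx) hy.
move=> b h y x hy; elim/(@homog_ind _ _ (ggr X)): x => [|x x' hx hx'|g x hx].
- rewrite (kbil0r sb) // scaler0 big1 // => s _.
  by rewrite scaler0 (kbil0r sb) // mul0rz.
- rewrite (kbilDr sb) // scalerDr hx hx' -big_split; apply: eq_bigr => s _ /=.
  by rewrite scalerDr (kbilDr sb) // mulrzDl.
rewrite (swap_homog tb wk1 _ hy) (tw_homog _ hx) (kbilMzl tb) // -scalerMzr te.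
pose F a c := t (a *: x) (twB g c *: y).
have Fb : @bilinear2 k B (kmod T) F.
  apply: bilinear_kmod => c *; rewrite /F; first by rewrite scalerDl kscaleA tb.1.
  by rewrite tw_hgrP scalerDl kscaleA tb.2.
transitivity ((\sum_(s <- cop b) F s.1.2 s.2.2) *~ ksign h g).
  congr (_ *~ _); apply: eq_big_seq => s sb'; rewrite /F (tw_homog _ hx) (tw_homog _ (cop2_homog sb')).
  by rewrite -scalerMzr -scalerMzl (kbilMzl tb) // (kbilMzr tb) // ksignC.
have -> : \sum_(s <- cop b) F s.1.2 s.2.2 =
   \sum_(s <- cop b) F s.2.2 s.1.2 *~ ksign s.1.1 s.2.1 := coH (kmod T) F Fb b.
rewrite mulrz_suml; apply: eq_big_seq => s sb'; rewrite /F.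
rewrite (swap_homog tb wk1 _ (gact (cop1_homog sb') hy)).
rewrite (tw_homog _ (gact (cop2_homog sb') hx)) (tw_homog _ (cop1_homog sb')).
rewrite -scalerMzl (kbilMzl tb) // (kbilMzr tb) // -!mulrzA; congr (_ *~ _).
rewrite /= !(ksignDl, ksignDr) [ksign s.2.1 _]ksignC [ksign g _]ksignC.
transitivity (ksign s.1.1 g * ksign s.1.1 s.2.1 * ksign h g * 1); first by ring.
by rewrite -(ksign_sq h s.2.1); ring.
Qed.

End Rigid.

(** * Rigidity *)

Section Frob.
Variables (k : fieldType) (B : falgType k) (H : hopf_algebra B).
Hypothesis coH : graded_cocommutative H.
Local Notation gm := (gmod H deg1).
Local Notation fg := (fgmod H).
Local Notation cop := (comult H).

Lemma proj_tens_l (X Y : fg) (T : gm) (t : X -> Y -> T) :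
  is_tensor t -> projective Y -> projective T.
Proof. by move=> tT; apply: (proj_tens (tens_swap coH tT)). Qed.

Lemma triv_pairing (X W : gm) (f : ghom X W) :
  pairing (fun (c : triv H) x => (c : k)%:A *: f x).
Proof.
have fb : kbilinear (fun (c : k) z => c%:A *: z) (fun (c : triv H) x => (c : k)%:A *: f x).
  split=> c *; first by rewrite triv_k kD kA.
  by rewrite linearP scalerDr kcomm.
apply: pairing_homog => //.
  move=> g h c x hc hx; have [->|c0] := eqVneq (c : k) 0.
    by rewrite k0; apply: homog_0.
  by rewrite (triv_homog c0 hc) add0r; apply/homog_k/gfun_deg.
move=> b g h c x hc hx; have [->|c0] := eqVneq (c : k) 0.
  rewrite k0 scaler0 big1 // => s _.
  by rewrite scaler0 k0 mul0rz.
rewrite (triv_homog c0 hc) kcomm -gfunZ -{1}[b](counitl H) scaler_suml linear_sum scaler_sumr.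
apply: eq_bigr => s _; rewrite ksign0r mulr1z trivZ.
by rewrite [(_ *: s.2.2) *: x]kscaleA linearZ kA mulrC.
Qed.

(** The image p of 1 is an invariant element: B acts on it through the counit,
    so in the coproduct of b only the factor that acts on n is left. *)
Lemma pairing_inv (P N W : gm) (al : P -> N -> W) (g : ghom (triv H) P) :
  pairing al -> exists f : ghom N W, forall n, f n = al (g (1 : k)) n.
Proof.
move=> [ab ad ae]; have wk1 (w : W) := k1 w.
have h1 : homog (ggr (triv H)) 0 (1 : k) by apply: homog_triv.
have hg := gfun_deg g h1.
apply: mk_ghom => [x y|b n|i n hn].
- exact: (kbilDr ab wk1).
- rewrite ae -{1}[b](counitl H) scaler_suml (kbil_sumr ab) //.
  apply: eq_bigr => s _; rewrite (tw_homog _ hg) ksign0r mulr1z.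
  have -> : s.1.2 *: g (1 : k) = (counit H s.1.2)%:A *: g (1 : k).
    rewrite -!gfunZ; congr (g _).
    by rewrite [RHS]triv_k trivZ.
  by rewrite [(_ *: s.2.2) *: n]kscaleA (kbilZl ab) (kbilZr ab).
by have := ad _ _ _ _ hg hn; rewrite add0r.
Qed.

Lemma inv_hom (X : fg) (W : gm) (f : ghom X W) :
  exists g : ghom (triv H) (ihom X W), forall x, app (g (1 : k)) x = f x.
Proof.
have [g gE] := curry (triv_pairing f).
by exists g => x; rewrite gE k1.
Qed.

Definition fihom (N W : fg) : fg := ftens W (dual N).

(** The map f is an invariant element of [X, Y], so X -> [X, Y] (x) X, x |-> f
    (x) x is equivariant; evaluation brings it back to f. *)
Lemma hom_factor (X Y : fg) (f : ghom X Y) :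
  exists (a : ghom X (ftens (fihom X Y) X)) (b : ghom (ftens (fihom X Y) X) Y),
    forall x, f x = b (a x).
Proof.
have [g gE] := inv_hom f.
have [a aE] := pairing_inv g (tens_pairing (tensP (ihom X Y) X)).
have [b bE] := tens_lift (tensP (ihom X Y) X) (app_pairing X Y).
by exists a, b => x; rewrite aE bE gE.
Qed.

Lemma proj_ihom (N : fg) (W : gm) : projective W -> projective (ihom N W).
Proof. exact: proj_tens (tensP W (dual N)). Qed.

(** A triangle identity of the adjunction exhibits [N, W] as a retract of [N,
    [N, W] (x) N]. *)
Lemma proj_ihom_l (N W : fg) : projective N -> projective (fihom N W).
Proof.
move=> pN; have tT := tensP (fihom N W) N.
have pT : projective (tens (fihom N W) N) := proj_tens_l tT pN.
have [a aE] := curry (tens_pairing tT).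
have [ev evE] := tens_lift tT (app_pairing N W).
have [b bE] := curry (pairing_comp ev (gid _) (gid N) (app_pairing N (tens (fihom N W) N))).
apply: (@proj_retract _ _ _ (fihom N W) (ihom N (tens (fihom N W) N)) a b) => [x|].
  by apply: (@app_ext _ _ _ N W) => n; rewrite bE /= aE evE.
exact: proj_ihom.
Qed.

(** Restriction along i is a surjection [Y, P] -> [X, P], since it is one on
    linear maps, and its target is projective. A section maps the invariant
    element f of [X, P] to an invariant element of [Y, P]. *)
Lemma proj_inj (X Y : fg) (P : gm) (i : ghom X Y) (f : ghom X P) :
  projective P -> injective i -> exists g : ghom Y P, forall x, g (i x) = f x.
Proof.
move=> pP ii; have [r [rl rK]] := klin_retraction ii.
have [rs rsE] := curry (pairing_comp (gid P) (gid _) i (app_pairing Y P)).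
have rsS v : exists u, rs u = v.
  have hk : klin (fun y => app v (r y)).
    by move=> c x y; rewrite rl (app_kbil X P).2.
  have [u uE] := app_surj hk; exists u; apply: app_ext => x.
  by rewrite rsE /= uE rK.
have [s sE] := proj_ihom (N := X) pP (gid _) rsS.
have [f' f'E] := inv_hom f.
have [g gE] := pairing_inv (gcomp s f') (app_pairing Y P).
exists g => x; rewrite gE -f'E.
transitivity (app (rs (s (f' (1 : k)))) x); first by rewrite rsE.
by rewrite sE.
Qed.

Lemma counit_ex : exists e : ghom (reg H) (triv H), forall b, e b = counit H b :> k.
Proof.
apply: mk_ghom => [x y|b x|g x hx]; first exact: counitD.
- by rewrite trivZ; apply: counitM.
apply: homog_triv => e0; apply/eqP; apply: contraR e0 => g0.
by rewrite (counit_deg hx g0).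
Qed.
Definition eps : ghom (freg H) (ftriv H) := projT1 (cid counit_ex).
Lemma epsE b : eps b = counit H b :> k. Proof. by rewrite /eps; case: cid. Qed.

Lemma unit_pairing (X : gm) : pairing (fun x (c : triv H) => (c : k)%:A *: x : X).
Proof.
have fb : kbilinear (fun (c : k) z => c%:A *: z) (fun x (c : triv H) => (c : k)%:A *: x : X).
  split=> c *; first by rewrite scalerDr kcomm.
  by rewrite triv_k kD kA.
apply: pairing_homog => //.
  move=> g h x c hx hc; have [->|c0] := eqVneq (c : k) 0.
    by rewrite k0; apply: homog_0.
  by rewrite (triv_homog c0 hc) addr0; apply/homog_k.
move=> b g h x c hx hc.
rewrite kcomm -{1}[b](counitr H) scaler_suml scaler_sumr.
apply: eq_big_seq => s sb; rewrite trivZ [(_ *: s.1.2) *: x]kscaleA kA.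
have [e0|n0] := eqVneq s.2.1 0; first by rewrite e0 ksign0l mulr1z mulrC.
by rewrite (counit_deg (cop2_homog sb) n0) mulr0 mul0r k0 mul0rz.
Qed.

(** The counit B -> k tensored with Z. *)
Lemma cover_ex (Z : gm) (Zf : finitely_generated Z) :
  exists P : fg, projective P /\ exists p : ghom P Z, forall z, exists x, p x = z.
Proof.
pose Z' : fg := FGMod Zf.
have pr : pairing (fun (b : freg H) (z : Z') => (eps b : k)%:A *: z).
  exact: (pairing_comp (gid Z') eps (gid Z') (triv_pairing (gid Z'))).
have [p pE] := tens_lift (tensP (freg H) Z') pr.
exists (ftens (freg H) Z'); split.
  exact: proj_tens (tensP (freg H) Z') (@reg_proj _ _ H).
exists p => z; exists (tmap ((1 : B) : freg H) (z : Z')).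
by rewrite pE epsE counit1 k1.
Qed.

(** Apply [-, U] to the short exact sequence of the counit, V -> B -> k, using
    that U is [k, U]. The point of this particular embedding into an injective
    module is that its cokernel is an internal hom into U. *)
Lemma cosyz (U : fg) : exists (V : fg) (I : fg) (i : ghom U I) (p : ghom I (fihom V U)),
  projective I /\ short_exact i p.
Proof.
pose V := fker eps.
have [i iE] := curry (pairing_comp (gid U) (gid U) eps (unit_pairing U)).
have [p pE] := @curry _ _ _ V U _ _ (pairing_comp (gid U) (gid _) (ker_inc eps) (app_pairing (freg H) U)).
exists V, (fihom (freg H) U), i, p; split.
  exact: (@proj_ihom_l (freg H) U (@reg_proj _ _ H)).
have eps1 : (eps (1 : B) : k) = 1 by rewrite epsE counit1.
have vl (b : B) : eps (b - (counit H b)%:A : B) = 0.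
  rewrite gfunB; apply/eqP; rewrite subr_eq0; apply/eqP.
  by rewrite !epsE counitZ counit1 mulr1.
pose v b := projT1 (cid (ker_lift (vl b))).
have vE b : ker_inc eps (v b) = (b - (counit H b)%:A : B) by rewrite /v; case: cid.
have ukb := kbilDr (app_kbil (freg H) U) (@k1 _ _ _).
split.
- move=> x y exy; have : app (i x) ((1 : B) : freg H) = app (i y) ((1 : B) : freg H) by rewrite exy.
  by rewrite !iE /= eps1 !k1.
- move=> z.
  have vk : klin (v : freg H -> V).
    move=> c x y; apply: ker_inc_inj; rewrite gfunD gfunZ !vE.
    have -> : counit H (c%:A *: x + y : freg H) = c * counit H x + counit H y.
      rewrite counitD; congr (_ + _); rewrite counitM counitZ counit1 mulr1 //.
    rewrite scalerDl opprD addrACA; congr (_ + _); rewrite scalerBr; congr (_ - _).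
    by rewrite -[RHS]/(c%:A * (counit H x)%:A : B) mulr_algl scalerA.
  have hk : klin (fun b : freg H => app z (v b)).
    by move=> c x y; rewrite vk (app_kbil V U).2.
  have [u uE] := app_surj hk; exists u; apply: app_ext => n.
  rewrite pE /= uE; congr (app z _); apply: ker_inc_inj; rewrite vE.
  have := ker_inc0 n; rewrite -/eps => e0.
  have -> : counit H (ker_inc eps n) = 0 by rewrite -epsE e0.
  by rewrite scale0r subr0.
move=> u; split=> [pu0|[x <-]].
  exists (@app _ _ _ (freg H) U u ((1 : B) : freg H)); apply: app_ext => b; rewrite iE /=.
  have {2}-> : b = ker_inc eps (v b) + (counit H b)%:A *: ((1 : B) : freg H).
    rewrite vE; apply: esym; rewrite -[RHS](subrK (counit H b)%:A).
    by congr (_ + _); apply: mulr1.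
  have e0 : app u (ker_inc eps (v b)) = 0.
    have : app (p u) (v b) = app (0 : ihom V U) (v b) by rewrite pu0.
    by rewrite pE /= => ->; apply: (klin0 (@app_klin _ _ _ V U (v b))).
  by rewrite ukb e0 add0r (kbilZr (app_kbil (freg H) U)) epsE.
apply: app_ext => n; rewrite pE /= iE /= ker_inc0.
by rewrite (klin0 (app_klin n)) k0.
Qed.

Lemma tens_map (X X' Y T T' : gm) (t : X -> Y -> T) (t' : X' -> Y -> T') (f : ghom X X') :
  is_tensor t -> is_tensor t' -> exists u : ghom T T', forall x y, u (t x y) = t' (f x) y.
Proof.
move=> tT tT'; have [u uE] := tens_lift tT (pairing_comp (gid T') f (gid Y) (tens_pairing tT')).
by exists u => x y; rewrite uE.
Qed.
Lemma tens_ghom_ext (X Y T Z : gm) (t : X -> Y -> T) (u v : ghom T Z) :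
  is_tensor t -> (forall x y, u (t x y) = v (t x y)) -> forall z, u z = v z.
Proof. by move=> tT e; apply: (tens_ext tT) => //; apply: klin_lin. Qed.

End Frob.

(** * The stable category *)

Section Stable.
Variables (k : fieldType) (B : falgType k) (H : hopf_algebra B).
Local Notation gm := (gmod H deg1).
Local Notation fg := (fgmod H).

Definition null (X Y : gm) (f : ghom X Y) : Prop :=
  exists (P : gm) (a : ghom X P) (b : ghom P Y), projective P /\ forall x, f x = b (a x).

Lemma gopp_ex (X Y : gm) (f : ghom X Y) : exists g : ghom X Y, forall x, g x = - f x.
Proof.
apply: mk_ghom => [x y|b x|g x hx]; rewrite ?gfunD ?opprD ?gfunZ ?scalerN //.
by rewrite /homog grN (gfun_deg f hx).
Qed.
Definition gopp (X Y : gm) (f : ghom X Y) := projT1 (cid (gopp_ex f)).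
Lemma goppE (X Y : gm) (f : ghom X Y) x : gopp f x = - f x.
Proof. by rewrite /gopp; case: cid. Qed.
Definition gsub (X Y : gm) (f g : ghom X Y) := gadd f (gopp g).
Lemma gsubE (X Y : gm) (f g : ghom X Y) x : gsub f g x = f x - g x.
Proof. by rewrite /= goppE. Qed.

Lemma null_eq (X Y : gm) (f g : ghom X Y) : (forall x, f x = g x) -> null f -> null g.
Proof. by move=> e [P [a [b [pP E]]]]; exists P, a, b; split=> // x; rewrite -e. Qed.
Lemma null0 (X Y : gm) (f : ghom X Y) : (forall x, f x = 0) -> null f.
Proof.
move=> f0; exists (reg H), (gzero X (reg H)), (gzero (reg H) Y); split.
  exact: reg_proj.
by move=> x; rewrite f0.
Qed.
Lemma null_add (X Y : gm) (f g : ghom X Y) : null f -> null g -> null (gadd f g).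
Proof.
move=> [P [a [b [pP E]]]] [Q [c [d [pQ F]]]].
have [u uE] := dpair_ex a c; have [v vE] := dcopair_ex b d.
by exists (dsum P Q), u, v; split=> [|x]; [apply: proj_dsum | rewrite vE uE /= E F].
Qed.
Lemma null_opp (X Y : gm) (f : ghom X Y) : null f -> null (gopp f).
Proof.
move=> [P [a [b [pP E]]]]; exists P, a, (gopp b).
by split=> // x; rewrite !goppE E.
Qed.
Lemma null_compl (X Y Z : gm) (g : ghom Y Z) (f : ghom X Y) : null f -> null (gcomp g f).
Proof.
by move=> [P [a [b [pP E]]]]; exists P, a, (gcomp g b); split=> // x; rewrite /= E.
Qed.
Lemma null_compr (X Y Z : gm) (g : ghom Y Z) (f : ghom X Y) : null g -> null (gcomp g f).
Proof.
by move=> [P [a [b [pP E]]]]; exists P, (gcomp a f), b; split=> // x; rewrite /= E.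
Qed.
Lemma se_null (X Y : gm) (f g : ghom X Y) : stably_equal f g <-> null (gsub f g).
Proof.
by split=> -[P [a [b [pP E]]]]; exists P, a, b; split=> // x; move: (E x); rewrite gsubE.
Qed.
Lemma se_eq (X Y : gm) (f g : ghom X Y) : (forall x, f x = g x) -> stably_equal f g.
Proof. by move=> e; apply/se_null/null0 => x; rewrite gsubE e subrr. Qed.
Lemma se_sym (X Y : gm) (f g : ghom X Y) : stably_equal f g -> stably_equal g f.
Proof.
move/se_null/null_opp => n; apply/se_null; apply: null_eq n => x.
by rewrite goppE !gsubE opprB.
Qed.
Lemma se_trans (X Y : gm) (f g h : ghom X Y) :
  stably_equal f g -> stably_equal g h -> stably_equal f h.
Proof.
move=> /se_null n /se_null m; apply/se_null; apply: null_eq (null_add n m) => x.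
by rewrite /= !goppE addrA subrK.
Qed.

(** Classes of maps modulo stable equality, so that equations in the stable
    category are equalities in an abelian group. *)
Definition shom (X Y : fg) : Type :=
  {P : ghom X Y -> Prop | exists f, P = @stably_equal _ _ _ X Y f}.
HB.instance Definition _ X Y := gen_eqMixin (shom X Y).
HB.instance Definition _ X Y := gen_choiceMixin (shom X Y).

Definition cls (X Y : fg) (f : ghom X Y) : shom X Y :=
  exist (fun P => exists f, P = @stably_equal _ _ _ X Y f) (stably_equal f) (ex_intro _ f erefl).
Definition rep (X Y : fg) (s : shom X Y) : ghom X Y := projT1 (cid (projT2 s)).
Lemma repK (X Y : fg) (s : shom X Y) : cls (rep s) = s.
Proof. by case: s => P ex; apply: eq_exist; rewrite /rep /=; case: cid => f <-. Qed.
Lemma cls_eq (X Y : fg) (f g : ghom X Y) : stably_equal f g <-> cls f = cls g.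
Proof.
split=> [e|[/(congr1 (fun P => P g)) /= ->]]; last exact: se_eq.
apply: eq_exist; apply: funext => h; apply: propext.
by split; [apply: se_trans (se_sym e) | apply: se_trans e].
Qed.
Lemma cls_eqE (X Y : fg) (f g : ghom X Y) : (forall x, f x = g x) -> cls f = cls g.
Proof. by move=> /se_eq /cls_eq. Qed.
Lemma rep_cls (X Y : fg) (f : ghom X Y) : stably_equal (rep (cls f)) f.
Proof. by apply/cls_eq; rewrite repK. Qed.

Section Zmod.
Variables X Y : fg.
Definition sadd (s t : shom X Y) : shom X Y := cls (gadd (rep s) (rep t)).
Definition szero : shom X Y := cls (gzero X Y).
Definition sopp (s : shom X Y) : shom X Y := cls (gopp (rep s)).
Lemma sadd_cls f g : sadd (cls f) (cls g) = cls (gadd f g).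
Proof.
apply/cls_eq/se_null.
have /se_null n := rep_cls f; have /se_null m := rep_cls g.
apply: null_eq (null_add n m) => x.
by rewrite /= !goppE /= opprD addrACA.
Qed.
Lemma sopp_cls f : sopp (cls f) = cls (gopp f).
Proof.
apply/cls_eq/se_null; have /se_null n := rep_cls f.
by apply: null_eq (null_opp n) => x; rewrite !(gsubE, goppE) opprB opprK addrC.
Qed.
Lemma shom_ind (P : shom X Y -> Prop) : (forall f, P (cls f)) -> forall s, P s.
Proof. by move=> h s; rewrite -(repK s). Qed.
Fact saddA : associative sadd.
Proof.
elim/shom_ind=> f; elim/shom_ind=> g; elim/shom_ind=> h.
by rewrite !sadd_cls; apply: cls_eqE => x /=; rewrite addrA.
Qed.
Fact saddC : commutative sadd.
Proof.
elim/shom_ind=> f; elim/shom_ind=> g.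
by rewrite !sadd_cls; apply: cls_eqE => x /=; rewrite addrC.
Qed.
Fact sadd0 : left_id szero sadd.
Proof.
by elim/shom_ind=> f; rewrite !sadd_cls; apply: cls_eqE => x /=; rewrite add0r.
Qed.
Fact saddN : left_inverse szero sopp sadd.
Proof.
elim/shom_ind=> f; rewrite sopp_cls !sadd_cls; apply: cls_eqE => x /=.
by rewrite goppE addNr.
Qed.
HB.instance Definition _ := GRing.isZmodule.Build (shom X Y) saddA saddC sadd0 saddN.
End Zmod.

Lemma clsD (X Y : fg) (f g : ghom X Y) : cls (gadd f g) = cls f + cls g.
Proof. by rewrite -sadd_cls. Qed.
Lemma cls0 (X Y : fg) : cls (gzero X Y) = 0.
Proof. by []. Qed.
Lemma cls_null (X Y : fg) (f : ghom X Y) : null f <-> cls f = 0.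
Proof.
rewrite -cls0; split=> [n|/cls_eq/se_null n].
  by apply/cls_eq/se_null; apply: null_eq n => x; rewrite gsubE /= subr0.
by apply: null_eq n => x; rewrite gsubE /= subr0.
Qed.

Definition scomp (X Y Z : fg) (g : shom Y Z) (f : shom X Y) : shom X Z :=
  cls (gcomp (rep g) (rep f)).
Local Notation "g ** f" := (scomp g f) (at level 40, left associativity).
Definition sid (X : fg) : shom X X := cls (gid X).

Lemma clsM (X Y Z : fg) (g : ghom Y Z) (f : ghom X Y) : cls (gcomp g f) = cls g ** cls f.
Proof.
apply: esym; apply/cls_eq/se_null.
have /se_null n := rep_cls f; have /se_null m := rep_cls g.
apply: null_eq (null_add (null_compl (rep (cls g)) n) (null_compr f m)) => x.
by rewrite /= !goppE /= gfunB addrA subrK.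
Qed.
#[global] Opaque scomp.

Section Comp.
Variables X Y Z W : fg.
Lemma scompA (h : shom Z W) (g : shom Y Z) (f : shom X Y) : h ** (g ** f) = h ** g ** f.
Proof.
elim/shom_ind: f => f; elim/shom_ind: g => g; elim/shom_ind: h => h.
by rewrite -!clsM; apply: cls_eqE.
Qed.
Lemma scompDl (g g' : shom Y Z) (f : shom X Y) : (g + g') ** f = g ** f + g' ** f.
Proof.
elim/shom_ind: f => f; elim/shom_ind: g => g; elim/shom_ind: g' => g'.
by rewrite -clsD -!clsM -clsD; apply: cls_eqE.
Qed.
Lemma scompDr (g : shom Y Z) (f f' : shom X Y) : g ** (f + f') = g ** f + g ** f'.
Proof.
elim/shom_ind: f => f; elim/shom_ind: g => g; elim/shom_ind: f' => f'.
by rewrite -clsD -!clsM -clsD; apply: cls_eqE => x /=; rewrite gfunD.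
Qed.
Lemma scomp0l (f : shom X Y) : (0 : shom Y Z) ** f = 0.
Proof. by apply: (@addrI _ (0 ** f)); rewrite -scompDl !addr0. Qed.
Lemma scomp0r (g : shom Y Z) : g ** (0 : shom X Y) = 0.
Proof. by apply: (@addrI _ (g ** 0)); rewrite -scompDr !addr0. Qed.
Lemma scompNl (g : shom Y Z) (f : shom X Y) : (- g) ** f = - (g ** f).
Proof. by apply/eqP; rewrite -addr_eq0 -scompDl addNr scomp0l. Qed.
Lemma scompNr (g : shom Y Z) (f : shom X Y) : g ** (- f) = - (g ** f).
Proof. by apply/eqP; rewrite -addr_eq0 -scompDr addNr scomp0r. Qed.
Lemma scomp1l (f : shom X Y) : sid Y ** f = f.
Proof. by elim/shom_ind: f => f; rewrite -clsM; apply: cls_eqE. Qed.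
Lemma scomp1r (f : shom X Y) : f ** sid X = f.
Proof. by elim/shom_ind: f => f; rewrite -clsM; apply: cls_eqE. Qed.
End Comp.
Lemma scompACA (X Y Z W V : fg) (x : shom W V) (y : shom Z W) (z : shom Y Z) (w : shom X Y) :
  (x ** y) ** (z ** w) = x ** (y ** z) ** w.
Proof. by rewrite !scompA. Qed.

Definition siso (X Y : fg) : Prop :=
  exists (f : shom X Y) (g : shom Y X), g ** f = sid X /\ f ** g = sid Y.
Definition sret (X Y : fg) : Prop :=
  exists (i : shom X Y) (r : shom Y X), r ** i = sid X.
Record isbip (X Y Z : fg) (i : shom X Z) (j : shom Y Z) (p : shom Z X) (q : shom Z Y) : Prop :=
  IsBip {
    bip_pi : p ** i = sid X;
    bip_qj : q ** j = sid Y;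
    bip_pj : p ** j = 0;
    bip_qi : q ** i = 0;
    bip_sum : i ** p + j ** q = sid Z }.
Definition bip (X Y Z : fg) : Prop := exists i j p q, @isbip X Y Z i j p q.

Lemma siso_refl X : siso X X.
Proof. by exists (sid X), (sid X); rewrite scomp1l. Qed.
Lemma siso_sym X Y : siso X Y -> siso Y X.
Proof. by move=> [f [g [e e']]]; exists g, f. Qed.
Lemma sret_trans X Y Z : sret X Y -> sret Y Z -> sret X Z.
Proof.
move=> [i [r e]] [j [s e']]; exists (j ** i), (r ** s).
by rewrite scompA -[r ** s ** j]scompA e' scomp1r.
Qed.
Lemma siso_trans X Y Z : siso X Y -> siso Y Z -> siso X Z.
Proof.
move=> [f [g [e e']]] [f' [g' [d d']]]; exists (f' ** f), (g ** g'); split.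
  by rewrite scompA -[g ** g' ** f']scompA d scomp1r.
by rewrite scompA -[f' ** f ** g]scompA e' scomp1r.
Qed.
Lemma siso_ret X Y : siso X Y -> sret X Y.
Proof. by move=> [f [g [e e']]]; exists f, g. Qed.
Lemma bip_ret1 X Y Z : bip X Y Z -> sret X Z.
Proof. by move=> [i [j [p [q [e _ _ _ _]]]]]; exists i, p. Qed.
Lemma bip_sym X Y Z : bip X Y Z -> bip Y X Z.
Proof. by move=> [i [j [p [q [e1 e2 e3 e4 e5]]]]]; exists j, i, q, p; split=> //; rewrite addrC. Qed.
Lemma bip_ret2 X Y Z : bip X Y Z -> sret Y Z.
Proof. by move/bip_sym/bip_ret1. Qed.

Lemma isomorphicP (X Y : fg) : @isomorphic (stmod H) X Y <-> siso X Y.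
Proof.
split=> [[f [g [e e']]]|[f [g []]]].
  by exists (cls f), (cls g); rewrite -!clsM; split; apply/cls_eq.
elim/shom_ind: f => f; elim/shom_ind: g => g; rewrite -!clsM => /cls_eq e /cls_eq e'.
by exists f, g.
Qed.
Lemma is_zeroP (X : fg) : @is_zero (stmod H) X <-> sid X = 0.
Proof. by rewrite -cls0; split=> [/cls_eq|/cls_eq]. Qed.
Lemma is_zero_proj (X : fg) : @is_zero (stmod H) X <-> projective X.
Proof.
split=> [[P [a [b [pP E]]]]|pX].
  by apply: (proj_retract (a := a) (b := b)) pP => x; rewrite -E /= subr0.
by exists X, (gid X), (gid X); split=> // x; rewrite /= subr0.
Qed.
Lemma sid0_proj (X : fg) : sid X = 0 <-> projective X.
Proof. by rewrite -is_zero_proj -is_zeroP. Qed.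
Lemma shom0l (X Y : fg) (f : shom X Y) : sid X = 0 -> f = 0.
Proof. by move=> e; rewrite -(scomp1r f) e scomp0r. Qed.
Lemma shom0r (X Y : fg) (f : shom X Y) : sid Y = 0 -> f = 0.
Proof. by move=> e; rewrite -(scomp1l f) e scomp0l. Qed.

Lemma isbip_dsum (X Y : fg) :
  isbip (cls (dinl X Y : ghom X (fdsum X Y))) (cls (dinr X Y : ghom Y (fdsum X Y)))
        (cls (dfst X Y : ghom (fdsum X Y) X)) (cls (dsnd X Y : ghom (fdsum X Y) Y)).
Proof.
split; rewrite -?clsM -?clsD -?cls0; apply: cls_eqE => x /=; rewrite !dsumE //.
by apply: injective_projections; rewrite /= ?addr0 ?add0r.
Qed.
Lemma bip_dsum (X Y : fg) : bip X Y (fdsum X Y).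
Proof. by do 4!eexists; apply: isbip_dsum. Qed.

Lemma bip_uniq X Y X' Y' Z Z' : bip X Y Z -> bip X' Y' Z' -> siso X X' -> siso Y Y' -> siso Z Z'.
Proof.
move=> [i [j [p [q [e1 e2 e3 e4 e5]]]]] [i' [j' [p' [q' [d1 d2 d3 d4 d5]]]]].
move=> [f [f' [ef ef']]] [g [g' [eg eg']]].
exists (i' ** f ** p + j' ** g ** q), (i ** f' ** p' + j ** g' ** q').
have L (X0 Y0 Z0 W0 V0 U0 : fg) (a : shom V0 U0) (b : shom W0 V0) (c : shom Z0 W0) (d : shom Y0 Z0) (e : shom X0 Y0)
   (f0 : shom _ _) : a ** b ** c ** (d ** e ** f0 : shom _ _) = a ** b ** (c ** d) ** e ** f0 :> shom _ _.
  by rewrite !scompA.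
split; rewrite scompDl !scompDr !L.
  by rewrite d1 d2 d3 d4 !(scomp0l, scomp0r, scomp1r) addr0 add0r -[i ** f' ** f]scompA ef
    -[j ** g' ** g]scompA eg !scomp1r.
by rewrite e1 e2 e3 e4 !(scomp0l, scomp0r, scomp1r) addr0 add0r -[i' ** f ** f']scompA ef'
    -[j' ** g ** g']scompA eg' !scomp1r.
Qed.
Lemma bip_zero X Y Z : bip X Y Z -> sid Y = 0 -> siso X Z.
Proof.
move=> [i [j [p [q [e1 e2 e3 e4 e5]]]]] Y0; exists i, p; split=> //.
by rewrite -e5 (shom0r q Y0) scomp0r addr0.
Qed.
Lemma bip_assoc X Y Z W V : bip X Y W -> bip W Z V -> exists U, bip Y Z U /\ bip X U V.
Proof.
move=> [i [j [p [q [e1 e2 e3 e4 e5]]]]] [i' [j' [p' [q' [d1 d2 d3 d4 d5]]]]].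
exists (fdsum Y Z); split; first exact: bip_dsum.
have [a1 a2 a3 a4 a5] := isbip_dsum Y Z.
set b := cls (dinl Y Z : ghom Y (fdsum Y Z)) in a1 a2 a3 a4 a5 *.
set c := cls (dinr Y Z : ghom Z (fdsum Y Z)) in a1 a2 a3 a4 a5 *.
set r := cls (dfst Y Z : ghom (fdsum Y Z) Y) in a1 a2 a3 a4 a5 *.
set s := cls (dsnd Y Z : ghom (fdsum Y Z) Z) in a1 a2 a3 a4 a5 *.
exists (i' ** i), (i' ** j ** r + j' ** s), (p ** p'), (b ** q ** p' + c ** q').
split.
- by rewrite scompACA d1 scomp1r.
- rewrite !scompDl !scompDr.
  have -> : b ** q ** p' ** (i' ** j ** r) = b ** r.
    by rewrite -(scompA i') scompACA d1 scomp1r !scompA -(scompA b) e2 scomp1r.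
  have -> : b ** q ** p' ** (j' ** s) = 0 by rewrite scompACA d3 scomp0r scomp0l.
  have -> : c ** q' ** (i' ** j ** r) = 0 by rewrite -(scompA i') scompACA d4 scomp0r scomp0l.
  have -> : c ** q' ** (j' ** s) = c ** s by rewrite scompACA d2 scomp1r.
  by rewrite addr0 add0r.
- rewrite scompDr; have -> : p ** p' ** (i' ** j ** r) = p ** j ** r.
    by rewrite -(scompA i') scompACA d1 scomp1r scompA.
  by rewrite scompACA d3 e3 !(scomp0r, scomp0l) addr0.
- by rewrite scompDl (scompACA (b ** q)) (scompACA c) d4 d1 scomp1r -(scompA b) e4
    !(scomp0r, scomp0l) addr0.
rewrite scompDl !scompDr.
have -> : i' ** j ** r ** (b ** q ** p') = i' ** (j ** q) ** p'.
  by rewrite -(scompA b) scompACA a1 scomp1r !scompA.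
have -> : i' ** j ** r ** (c ** q') = 0 by rewrite scompACA a3 scomp0r scomp0l.
have -> : j' ** s ** (b ** q ** p') = 0 by rewrite -(scompA b) scompACA a4 scomp0r scomp0l.
have -> : j' ** s ** (c ** q') = j' ** q' by rewrite scompACA a2 scomp1r.
rewrite addr0 add0r addrA scompACA.
by rewrite -scompDl -scompDr e5 scomp1r d5.
Qed.

End Stable.

(** * Short exact sequences and exact triangles *)

Section Triangles.
Variables (k : fieldType) (B : falgType k) (H : hopf_algebra B).
Local Notation gm := (gmod H deg1).
Local Notation fg := (fgmod H).
Local Notation "g ** f" := (scomp g f) (at level 40, left associativity).

Lemma inj_lift (W X Y : gm) (i : ghom X Y) (h : ghom W Y) : injective i ->
  (forall w, exists x, i x = h w) -> exists h' : ghom W X, forall w, i (h' w) = h w.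
Proof.
move=> ii ex; pose f w := projT1 (cid (ex w)).
have fE w : i (f w) = h w by rewrite /f; case: cid.
have [h' hE] : exists h' : ghom W X, forall w, h' w = f w.
  apply: mk_ghom => [x y|b x|g x hx]; apply: ii.
  - by rewrite gfunD !fE gfunD.
  - by rewrite gfunZ !fE gfunZ.
  by rewrite ghom_gr fE; apply: gfun_deg.
by exists h' => w; rewrite hE.
Qed.

Section Exact.
Variables (X Y Z : gm) (i : ghom X Y) (p : ghom Y Z) (ex : short_exact i p).
Lemma se_inj : injective i. Proof. by case: ex. Qed.
Lemma se_surj z : exists y, p y = z. Proof. by case: ex. Qed.
Lemma se_pi x : p (i x) = 0. Proof. by case: ex => _ _ e; apply/e; exists x. Qed.
Lemma se_ker y : p y = 0 -> exists x, i x = y. Proof. by case: ex => _ _ e /e. Qed.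

Lemma se_lift (W : gm) (h : ghom W Y) : (forall w, p (h w) = 0) ->
  exists h' : ghom W X, forall w, i (h' w) = h w.
Proof. by move=> ph; apply: inj_lift se_inj _ => w; apply/se_ker/ph. Qed.

Lemma se_desc (W : gm) (h : ghom Y W) : (forall x, h (i x) = 0) ->
  exists h' : ghom Z W, forall y, h' (p y) = h y.
Proof.
move=> hi; pose f z := h (projT1 (cid (se_surj z))).
have fE y : f (p y) = h y.
  rewrite /f; case: cid => y' e /=; apply/eqP; rewrite -subr_eq0 -gfunB.
  have : p (y' - y) = 0 by rewrite gfunB e subrr.
  by move/se_ker => [x <-]; rewrite hi.
have [h' hE] : exists h' : ghom Z W, forall z, h' z = f z.
  apply: mk_ghom => [x y|b x|g x hx].
  - have [a <-] := se_surj x; have [b <-] := se_surj y.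
    by rewrite -gfunD !fE gfunD.
  - by have [a <-] := se_surj x; rewrite -gfunZ !fE gfunZ.
  have [a e] := se_surj x; rewrite -hx -e -ghom_gr fE.
  by apply: gfun_deg; apply: homog_gr.
by exists h' => y; rewrite hE fE.
Qed.
End Exact.

Lemma ker_exact (Y Z : fg) (p : ghom Y Z) : (forall z, exists y, p y = z) ->
  short_exact (ker_inc p : ghom (fker p) Y) p.
Proof.
move=> ps; split=> //; first exact: ker_inc_inj.
by move=> y; split=> [/ker_lift //|[x <-]]; apply: ker_inc0.
Qed.

Definition tri (X Y Z : fg) : Prop :=
  exists (X' Y' Z' : fg) (i : ghom X' Y') (p : ghom Y' Z'),
    [/\ short_exact i p, siso X X', siso Y Y' & siso Z Z'].

Lemma has_triangleP (X Y Z : fg) : @has_triangle (stmod H) X Y Z <-> tri X Y Z.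
Proof.
split.
  move=> [f [g [X' [Y' [Z' [i [p [a [b [c [ex [ia ib ic] _ _]]]]]]]]]]].
  exists X', Y', Z', i, p; split=> //.
  - by apply/isomorphicP; exists a.
  - by apply/isomorphicP; exists b.
  by apply/isomorphicP; exists c.
move=> [X' [Y' [Z' [i [p [ex /isomorphicP[a [a' [a1 a2]]] /isomorphicP[b [b' [b1 b2]]]
  /isomorphicP[c [c' [c1 c2]]]]]]]]].
exists (gcomp b' (gcomp i a)), (gcomp c' (gcomp p b)).
exists X', Y', Z', i, p, a, b, c.
split=> //.
- by split; [exists a' | exists b' | exists c'].
- move: b2 => /cls_eq e; apply/cls_eq; rewrite !clsM scompA -clsM e.
  by rewrite scomp1l.
move: c2 => /cls_eq e; apply/cls_eq; rewrite !clsM scompA -clsM e.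
by rewrite scomp1l.
Qed.

Lemma tri_ses (X Y Z : fg) (i : ghom X Y) (p : ghom Y Z) : short_exact i p -> tri X Y Z.
Proof. by move=> ex; exists X, Y, Z, i, p; split=> //; apply: siso_refl. Qed.

Lemma tri_iso (X Y Z X' Y' Z' : fg) : siso X X' -> siso Y Y' -> siso Z Z' ->
  tri X Y Z -> tri X' Y' Z'.
Proof.
move=> ex ey ez [X1 [Y1 [Z1 [i [p [e a b c]]]]]]; exists X1, Y1, Z1, i, p; split=> //.
- exact: siso_trans (siso_sym ex) a.
- exact: siso_trans (siso_sym ey) b.
exact: siso_trans (siso_sym ez) c.
Qed.

Lemma tri_bip (X Y Z : fg) : bip X Y Z -> tri X Z Y.
Proof.
move=> bz; apply: (tri_iso (X := X) (Y := fdsum X Y) (Z := Y)); try exact: siso_refl.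
  by apply: bip_uniq bz _ _; [exact: bip_dsum | exact: siso_refl | exact: siso_refl].
apply: (tri_ses (i := dinl X Y : ghom X (fdsum X Y)) (p := dsnd X Y : ghom (fdsum X Y) Y)).
split.
- by move=> x y; rewrite !dsumE => -[].
- by move=> y; exists (0, y); rewrite dsumE.
move=> y; rewrite dsumE; split=> [y0|[x <-]]; last by rewrite dsumE.
by exists y.1; rewrite dsumE -y0 -surjective_pairing.
Qed.

(** The identity of U extends to maps P -> I and I -> P since projectives are
    injective; the composite differs from the identity of P by a map which
    vanishes on U, so on cokernels the difference factors through P. *)
Lemma schanuel (U P Z I Z' : fg) (i : ghom U P) (p : ghom P Z) (j : ghom U I) (q : ghom I Z') :
  projective P -> projective I -> short_exact i p -> short_exact j q -> sret Z Z'.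
Proof.
move=> pP pI e e'.
have [f fE] := proj_inj j pI (se_inj e).
have [g gE] := proj_inj i pP (se_inj e').
have [fb fbE] := @se_desc _ _ _ _ _ e _ (gcomp q f) (fun x => etrans (congr1 q (fE x)) (se_pi e' x)).
have [gb gbE] := @se_desc _ _ _ _ _ e' _ (gcomp p g) (fun x => etrans (congr1 p (gE x)) (se_pi e x)).
exists (cls fb), (cls gb); rewrite -clsM; apply/cls_eq/se_null.
have [c cE] : exists c : ghom Z P, forall y, c (p y) = gsub (gcomp g f) (gid P) y.
  by apply: (se_desc e) => x; rewrite gsubE /= fE gE subrr.
exists P, c, p; split=> // z; have [y <-] := se_surj e z.
by rewrite gsubE /= fbE /= gbE /= cE gsubE gfunB.
Qed.

(** The failure of the right square to commute factors through a projective,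
    hence lifts to the middle term and can be subtracted from b. *)
Lemma se_strict (X Y Z X' Y' Z' : fg) (i : ghom X Y) (p : ghom Y Z)
    (i' : ghom X' Y') (p' : ghom Y' Z') (b : ghom Y Y') (c : ghom Z Z') :
  short_exact i p -> short_exact i' p' -> cls p' ** cls b = cls c ** cls p ->
  exists (b' : ghom Y Y') (a : ghom X X'), [/\ cls b' = cls b,
    forall y, p' (b' y) = c (p y) & forall x, i' (a x) = b' (i x)].
Proof.
move=> e e'; rewrite -!clsM => /cls_eq[Q [u [v [pQ E]]]].
have [w wE] := pQ _ _ p' v (se_surj e').
pose b' := gsub b (gcomp w u).
have b'E y : p' (b' y) = c (p y).
  by rewrite /b' gsubE gfunB /= wE -E /= opprB addrC subrK.
have [a aE] := @se_lift _ _ _ _ _ e' _ (gcomp b' i)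
  (fun x => etrans (b'E (i x)) (etrans (congr1 c (se_pi e x)) (gfun0 c))).
exists b', a; split=> //; apply/cls_eq/se_null.
exists Q, u, (gopp w); split=> // y.
by rewrite /b' !gsubE goppE /= addrAC subrr add0r.
Qed.

(** After changing b by a map that factors through a projective, b - 1 has
    image in X, that is b - 1 = i d with i d stably zero. On X this gives a =
    1 + d i, and (d i)^2 = d (i d) i = 0. *)
Lemma se_unipotent (X Y Z : fg) (i : ghom X Y) (p : ghom Y Z)
    (a : ghom X X) (b : ghom Y Y) (c : ghom Z Z) :
  short_exact i p -> cls b = sid Y -> cls c = sid Z ->
  (forall y, p (b y) = c (p y)) -> (forall x, i (a x) = b (i x)) ->
  exists a' : shom X X, a' ** cls a = sid X /\ cls a ** a' = sid X.
Proof.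
move=> e /cls_eq/se_null nb /cls_eq/se_null[R [u [v [pR E]]]] pb ia.
have [w wE] := pR _ _ p v (se_surj e).
pose n' := gsub (gsub b (gid Y)) (gcomp (gcomp w u) p).
have nn : null n'.
  apply: null_add => //; apply/null_opp/null_compr.
  by exists R, u, w.
have pn y : p (n' y) = 0.
  rewrite /n' !gsubE !gfunB /= wE -E gsubE /= pb.
  by rewrite subrr.
have [d dE] := se_lift e pn.
have nE x : n' (i x) = i (a x) - i x.
  by rewrite /n' !gsubE /= (se_pi e) !gfun0 subr0 ia.
have aE : cls a = sid X + cls d ** cls i.
  rewrite -clsM -clsD; apply: cls_eqE => x /=; apply: (se_inj e).
  by rewrite gfunD dE nE addrC subrK.
have dd : cls d ** cls i ** (cls d ** cls i) = 0.
  rewrite scompA -(scompA (cls d)) -(clsM i d).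
  have -> : cls (gcomp i d) = 0.
    by apply/cls_null; apply: null_eq nn => y; rewrite /= dE.
  by rewrite scomp0r scomp0l.
exists (sid X - cls d ** cls i); rewrite aE.
by split; rewrite !(scompDl, scompDr, scompNl, scompNr) dd !(scomp1l, scomp1r) ?oppr0 ?addr0
  ?addrK ?subrK.
Qed.

(** Strictify the isomorphism of the right squares and its inverse. The two
    composites induced on X and on its counterpart need not be identities, but
    they are invertible. *)
Lemma fib_iso (X Y Z X' Y' Z' : fg) (i : ghom X Y) (p : ghom Y Z)
    (i' : ghom X' Y') (p' : ghom Y' Z') (b : shom Y Y') (b' : shom Y' Y)
    (c : shom Z Z') (c' : shom Z' Z) :
  short_exact i p -> short_exact i' p' ->
  b' ** b = sid Y -> b ** b' = sid Y' -> c' ** c = sid Z -> c ** c' = sid Z' ->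
  cls p' ** b = c ** cls p -> siso X X'.
Proof.
move=> e e' b'b bb' c'c cc' E.
have E' : cls p ** b' = c' ** cls p'.
  rewrite -[RHS]scomp1r -bb' scompA -(scompA c') E !scompA c'c.
  by rewrite scomp1l.
move: b b' c c' b'b bb' c'c cc' E E'.
elim/shom_ind=> b; elim/shom_ind=> b'; elim/shom_ind=> c; elim/shom_ind=> c'.
move=> b'b bb' c'c cc' E E'.
have [b1 [a [b1E pb ia]]] := se_strict e e' E.
have [b2 [a' [b2E pb' ia']]] := se_strict e' e E'.
have [d [d1 d2]] : exists d : shom X X, d ** cls (gcomp a' a) = sid X /\ cls (gcomp a' a) ** d = sid X.
  apply: (@se_unipotent _ _ _ _ _ _ (gcomp b2 b1) (gcomp c' c) e) => [||y|x] /=.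
  - by rewrite clsM b1E b2E.
  - by rewrite clsM.
  - by rewrite pb' pb.
  by rewrite ia' ia.
have [d' [d1' d2']] : exists d : shom X' X', d ** cls (gcomp a a') = sid X' /\ cls (gcomp a a') ** d = sid X'.
  apply: (@se_unipotent _ _ _ _ _ _ (gcomp b1 b2) (gcomp c c') e') => [||y|x] /=.
  - by rewrite clsM b1E b2E.
  - by rewrite clsM.
  - by rewrite pb pb'.
  by rewrite ia ia'.
move: d1 d2'; rewrite !clsM => d1 d2'.
exists (cls a), (d ** cls a'); split; first by rewrite -scompA.
have -> : d ** cls a' = cls a' ** d'.
  rewrite -[LHS]scomp1r -d2' !scompA -(scompA d) d1.
  by rewrite scomp1l.
by rewrite scompA.
Qed.

(** * Fibres of diagonal maps *)

(** Adding a projective cover of Z to Y makes the map surjective without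
    changing it stably. *)
Lemma half_fib (Y Z : fg) (c : shom Y Z) : exists (K Y' : fg) (i : ghom K Y') (p : ghom Y' Z)
   (e : shom Y' Y) (e' : shom Y Y'),
  [/\ short_exact i p, e' ** e = sid Y', e ** e' = sid Y & cls p = c ** e].
Proof.
have [P [pP [q qs]]] := cover_ex (fgcarP Z).
have P0 : sid P = 0 by apply/sid0_proj.
have [p pE] := dcopair_ex (rep c) q.
exists (fker (p : ghom (fdsum Y P) Z)), (fdsum Y P), (ker_inc p), p.
exists (cls (dfst Y P : ghom (fdsum Y P) Y)), (cls (dinl Y P : ghom Y (fdsum Y P))).
have [e1 e2 e3 e4 e5] := isbip_dsum Y P; split=> //.
- apply: ker_exact => z; have [x <-] := qs z.
  by exists (0, x); rewrite pE /= gfun0 add0r.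
- by rewrite -e5 (shom0l (cls (dinr Y P : ghom P (fdsum Y P))) P0) scomp0l addr0.
rewrite -[in RHS](repK c) -clsM.
pose d1 : ghom (fdsum Y P) Y := dfst Y P; pose d2 : ghom (fdsum Y P) P := dsnd Y P.
have -> : cls (gcomp (rep c) d1) = cls (gadd (gcomp (rep c) d1) (gcomp q d2)).
  by rewrite clsD [cls (gcomp q _)]clsM (shom0l (cls q) P0) scomp0l addr0.
by apply: cls_eqE => x; rewrite pE /= !dsumE.
Qed.

Lemma isbip_inv (X Y Z Z' : fg) i j p q i' j' p' q' :
  @isbip _ _ H X Y Z i j p q -> @isbip _ _ H X Y Z' i' j' p' q' ->
  (i ** p' + j ** q') ** (i' ** p + j' ** q) = sid Z.
Proof.
move=> [e1 e2 e3 e4 e5] [d1 d2 d3 d4 d5].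
rewrite !(scompDl, scompDr) !scompACA d1 d2 d3 d4.
by rewrite !(scomp1r, scomp0r, scomp0l) addr0 add0r.
Qed.

Lemma isbip_conj (X Y X' Y' Z : fg) i j p q (e : shom X' X) e' (f : shom Y' Y) f' :
  @isbip _ _ H X Y Z i j p q -> e' ** e = sid X' -> e ** e' = sid X ->
  f' ** f = sid Y' -> f ** f' = sid Y ->
  isbip (i ** e) (j ** f) (e' ** p) (f' ** q).
Proof.
move=> [e1 e2 e3 e4 e5] d1 d2 d3 d4; split.
- by rewrite scompA -(scompA e') e1 scomp1r.
- by rewrite scompA -(scompA f') e2 scomp1r.
- by rewrite scompA -(scompA e') e3 scomp0r scomp0l.
- by rewrite scompA -(scompA f') e4 scomp0r scomp0l.
by rewrite !scompA -(scompA i) -(scompA j) d2 d4 !scomp1r.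
Qed.

Lemma bip_siso (X Y Z Z' : fg) : bip X Y Z -> siso Z Z' -> bip X Y Z'.
Proof.
move=> [i [j [p [q [e1 e2 e3 e4 e5]]]]] [f [f' [d d']]].
exists (f ** i), (f ** j), (p ** f'), (q ** f'); split.
- by rewrite scompA -(scompA p) d scomp1r.
- by rewrite scompA -(scompA q) d scomp1r.
- by rewrite scompA -(scompA p) d scomp1r.
- by rewrite scompA -(scompA q) d scomp1r.
by rewrite !scompA -(scompA f i p) -(scompA f j q) -scompDl -scompDr e5 scomp1r.
Qed.

(** The orthogonality hypotheses make g stably diagonal, so its fibre is the
    direct sum of the fibres of the two diagonal entries, by uniqueness of
    fibres. *)
Lemma fib_bip (X Y Z YA YD ZA ZD : fg) (i : ghom X Y) (g : ghom Y Z) :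
  short_exact i g -> bip YA YD Y -> bip ZA ZD Z ->
  (forall s : shom YA ZD, s = 0) -> (forall s : shom YD ZA, s = 0) ->
  exists KA KD, [/\ bip KA KD X, tri KA YA ZA & tri KD YD ZD].
Proof.
move=> ex [i1 [i2 [p1 [p2 by_]]]] [j1 [j2 [q1 [q2 bz]]]] oAD oDA.
have [KA [YA' [iA [gA [eA [eA' [exA a1 a2 gAE]]]]]]] := half_fib (q1 ** cls g ** i1).
have [KD [YD' [iD [gD [eD [eD' [exD d1 d2 gDE]]]]]]] := half_fib (q2 ** cls g ** i2).
exists KA, KD; split.
- have [g' g'E] := dprod_ex gA gD; have [i' i'E] := dprod_ex iA iD.
  have ex' : short_exact (i' : ghom (fdsum KA KD) (fdsum YA' YD')) (g' : ghom _ (fdsum ZA ZD)).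
    split.
    - move=> x y; rewrite !i'E => -[/(se_inj exA) e1 /(se_inj exD) e2].
      exact: injective_projections.
    - move=> z; have [y1 e1] := se_surj exA z.1; have [y2 e2] := se_surj exD z.2.
      by exists (y1, y2); rewrite g'E /= e1 e2 -surjective_pairing.
    move=> y; rewrite g'E; split=> [[e1 e2]|[x <-]]; last first.
      by rewrite i'E /= (se_pi exA) (se_pi exD).
    have [x1 e1'] := se_ker exA e1; have [x2 e2'] := se_ker exD e2.
    by exists (x1, x2); rewrite i'E /= e1' e2' -surjective_pairing.
  have bY := isbip_conj by_ a1 a2 d1 d2.
  have bY' := isbip_dsum YA' YD'; have bZ' := isbip_dsum ZA ZD.
  apply: bip_siso (bip_dsum KA KD) _.
  apply: (fib_iso ex' ex (isbip_inv bY' bY) (isbip_inv bY bY') (isbip_inv bZ' bz) (isbip_inv bz bZ')).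
  have g'S : cls (g' : ghom (fdsum YA' YD') (fdsum ZA ZD)) =
     cls (dinl ZA ZD : ghom ZA (fdsum ZA ZD)) ** cls gA ** cls (dfst YA' YD' : ghom (fdsum YA' YD') YA')
   + cls (dinr ZA ZD : ghom ZD (fdsum ZA ZD)) ** cls gD ** cls (dsnd YA' YD' : ghom (fdsum YA' YD') YD').
    rewrite -!clsM -clsD; apply: cls_eqE => x; rewrite g'E /= !dsumE.
    by apply: injective_projections; rewrite /= ?addr0 ?add0r.
  rewrite g'S; case: bZ' => z1 z2 z3 z4 _; case: bz => w1 w2 w3 w4 w5.
  have LA (X0 Y0 Z0 W0 V0 U0 : fg) (x : shom W0 V0) (y : shom Z0 W0) (z : shom Y0 Z0) (w : shom X0 Y0)
    (v : shom U0 X0) : (x ** y) ** (z ** w ** v) = x ** (y ** z) ** w ** v by rewrite !scompA.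
  rewrite [RHS]scompDl !scompDr !LA z1 z2 z3 z4 !(scomp0r, scomp0l, scomp1r) addr0 add0r.
  have EA : cls g ** i1 = j1 ** q1 ** cls g ** i1.
    rewrite -[LHS]scomp1l -w5 scompDl -(scompA j2 q2) (oAD (q2 ** (cls g ** i1))).
    by rewrite scomp0r addr0 scompA.
  have ED : cls g ** i2 = j2 ** q2 ** cls g ** i2.
    rewrite -[LHS]scomp1l -w5 scompDl -(scompA j1 q1) (oDA (q1 ** (cls g ** i2))).
    by rewrite scomp0r add0r scompA.
  by rewrite gAE gDE !scompA EA ED.
- apply: tri_iso (tri_ses exA); try exact: siso_refl.
  by exists eA, eA'.
apply: tri_iso (tri_ses exD); try exact: siso_refl.
by exists eD, eD'.
Qed.

(** Cover Z by a projective module P: the pullback of P along Y -> Z is an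
    extension of P by X, hence X + P, and it is also an extension of Y by the
    syzygy of Z. *)
Lemma ses_rotate (X Y Z : fg) (i : ghom X Y) (g : ghom Y Z) : short_exact i g ->
  exists (Om P : fg) (j : ghom Om P) (p : ghom P Z) (l : ghom Om (fdsum X P)) (m : ghom (fdsum X P) Y),
  [/\ projective P, short_exact j p & short_exact l m].
Proof.
move=> ex; have [P [pP [p ps]]] := cover_ex (fgcarP Z).
have exP := ker_exact ps.
have [q qE] := pP _ _ g p (se_surj ex).
have [r rE] := @se_lift _ _ _ _ _ ex _ (gcomp q (ker_inc p : ghom (fker p) P))
  (fun w => etrans (qE _) (se_pi exP w)).
have [l lE] := dpair_ex (gopp r) (ker_inc p : ghom (fker p) P).
have [m mE] := dcopair_ex i q.
exists (fker p), P, (ker_inc p), p, l, m; split=> //; split.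
- by move=> x y; rewrite !lE => -[_]; apply: ker_inc_inj.
- move=> y; have [a pa] := ps (g y).
  have : g (y - q a) = 0 by rewrite gfunB qE pa subrr.
  by move/(se_ker ex) => [x xE]; exists (x, a); rewrite mE /= xE subrK.
move=> y; rewrite mE; split=> [e|[x <-]]; last first.
  by rewrite lE /= goppE gfunN rE addNr.
have : p y.2 = 0 by have := congr1 g e; rewrite gfunD gfun0 (se_pi ex) add0r qE.
move/(se_ker exP) => [w wE]; exists w; rewrite lE goppE.
apply: injective_projections => //=; apply: (se_inj ex).
by rewrite gfunN rE /= wE; apply/eqP; rewrite eq_sym -addr_eq0 e.
Qed.

End Triangles.

(** * Thick ideals and orthogonality *)

Section Ideals.
Variables (k : fieldType) (B : falgType k) (H : hopf_algebra B).
Variable coH : graded_cocommutative H.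
Local Notation fg := (fgmod H).
Local Notation "g ** f" := (scomp g f) (at level 40, left associativity).
Local Notation tenp X Y Z := (@ten (stmod H) X Y Z).

(** Thick ideals in terms of equalities of stable morphisms; isomorphisms are
    special retracts. *)
Record tideal (A : fg -> Prop) : Prop := TIdeal {
  ti_ret : forall X Y, sret X Y -> A Y -> A X;
  ti_zero : forall X, sid X = 0 -> A X;
  ti_tri : forall X Y Z, tri X Y Z ->
    [/\ A X -> A Y -> A Z, A Y -> A Z -> A X & A X -> A Z -> A Y];
  ti_ten : forall X Y Z, tenp X Y Z -> A X -> A Z
}.

Lemma thick_tideal (A : fg -> Prop) : @thick_ideal (stmod H) A <-> tideal A.
Proof.
split=> [[[[t1 t2 t3] ret] tn]|[ret z tr tn]].
  split=> // [X Y [i [r]]|X /is_zeroP /t2 //|X Y Z /has_triangleP /t3 //].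
  elim/shom_ind: i => i; elim/shom_ind: r => r.
  by rewrite -clsM => /cls_eq; apply: ret.
split; last exact: tn.
split; first split.
- by move=> X Y /isomorphicP/siso_sym/siso_ret; apply: ret.
- by move=> X /is_zeroP; apply: z.
- by move=> X Y Z /has_triangleP; apply: tr.
move=> X Y i r e; apply: ret; exists (cls (i : ghom _ _)), (cls (r : ghom _ _)).
by rewrite -clsM; apply/cls_eq.
Qed.

Lemma ten_ihom (N W : fg) : tenp W (dual N) (fihom N W).
Proof. by exists (@tmap _ _ _ W (dual N)); apply: tensP. Qed.
Lemma ten_ftens (X Y : fg) : tenp X Y (ftens X Y).
Proof. by exists (@tmap _ _ _ X Y); apply: tensP. Qed.
Lemma ten_sym (X Y Z : fg) : tenp X Y Z -> tenp Y X Z.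
Proof. by move=> [t tT]; exists (swap t); apply: tens_swap. Qed.

(** Rotating an exact sequence shows that cofibres are cosyzygies of fibres,
    up to projective summands, and the cosyzygy of an object is a tensor
    product with it. *)
Lemma tideal_crit (A : fg -> Prop) :
  (forall X Y, sret X Y -> A Y -> A X) -> (forall X, sid X = 0 -> A X) ->
  (forall (X Y Z : fg) (i : ghom X Y) (p : ghom Y Z), short_exact i p -> A Y -> A Z -> A X) ->
  (forall X Y Z, tenp X Y Z -> A X -> A Z) -> tideal A.
Proof.
move=> ret z fib tn; split=> // X Y Z [X' [Y' [Z' [i [p [ex /siso_sym ix /siso_sym iy /siso_sym iz]]]]]].
have iR U V : siso U V -> (A U <-> A V).
  by move=> e; split; apply: ret; apply: siso_ret => //; apply: siso_sym.
rewrite -(propext (iR _ _ ix)) -(propext (iR _ _ iy)) -(propext (iR _ _ iz)) {X Y Z ix iy iz}.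
have AP (U P : fg) : A U -> projective P -> A (fdsum U P).
  move=> AU /sid0_proj P0; apply: ret AU; apply/siso_ret/siso_sym.
  exact: bip_zero (bip_dsum U P) P0.
have cof (X Y Z : fg) (j : ghom X Y) (q : ghom Y Z) : short_exact j q -> A X -> A Y -> A Z.
  move=> e AX AY; have [Om [P [a [b [l [m [pP e1 e2]]]]]]] := ses_rotate e.
  have AO : A Om by apply: fib e2 _ _ => //; apply: AP.
  have [V [I [c [d [pI e3]]]]] := cosyz coH Om.
  by apply: ret (schanuel pP pI e1 e3) _; apply: tn (ten_ihom V Om) AO.
split; [exact: cof ex|exact: fib ex|move=> AX AZ].
have [Om [P [a [b [l [m [pP e1 e2]]]]]]] := ses_rotate ex.
apply: cof e2 _ (AP _ _ AX pP); apply: fib e1 _ AZ.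
by apply/z/sid0_proj.
Qed.

Section TI.
Variables (A : fg -> Prop) (tA : tideal A).
Lemma ti_bip X Y Z : bip X Y Z -> A X -> A Y -> A Z.
Proof. by move/tri_bip/(ti_tri tA) => [_ _]. Qed.
Lemma ti_fib (X Y Z : fg) (i : ghom X Y) (p : ghom Y Z) : short_exact i p -> A Y -> A Z -> A X.
Proof. by move/tri_ses/(ti_tri tA) => []. Qed.
Lemma ti_ihom N W : A W -> A (fihom N W).
Proof. exact: ti_ten tA _ _ _ (ten_ihom N W). Qed.
Lemma ti_tenl X Y Z : tenp X Y Z -> A Y -> A Z.
Proof. by move/ten_sym; apply: ti_ten tA _ _ _. Qed.
End TI.

Definition disj (A A' : fg -> Prop) : Prop := forall X, A X -> A' X -> sid X = 0.

(** The object [X, Y] (x) X through which every map X -> Y factors belongs to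
    both ideals. *)
Lemma hom_orth (A A' : fg -> Prop) : tideal A -> tideal A' -> disj A A' ->
  forall X Y, A X -> A' Y -> forall s : shom X Y, s = 0.
Proof.
move=> tA tA' dj X Y AX AY; elim/shom_ind=> f; have [a [b E]] := hom_factor f.
apply/cls_null; exists (ftens (fihom X Y) X), a, b; split=> //.
apply/sid0_proj/dj; first exact: (ti_tenl tA (ten_ftens _ _) AX).
by apply: (ti_ten tA' (ten_ftens _ _)); apply: ti_ihom.
Qed.

Definition perp (A : fg -> Prop) : fg -> Prop :=
  fun X => forall Y, A Y -> forall s : shom X Y, s = 0.

(** The left orthogonal is an ideal because A contains with W all the internal
    homs [N, W], and cosyzygies are among them. *)
Lemma perp_tideal (A : fg -> Prop) : tideal A -> tideal (perp A).
Proof.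
move=> tA; apply: tideal_crit.
- move=> X Y [i [r e]] pY W AW s.
  by rewrite -(scomp1r s) -e scompA (pY W AW (s ** r)) scomp0l.
- by move=> X X0 W _ s; apply: shom0l.
(* A map f : X -> W extends to Y because its obstruction is a map from Z to
   the cosyzygy [V, W] of W, which is again an object of A. *)
- move=> X Y Z i p ex pY pZ W AW; elim/shom_ind=> f.
  have [V [I [a [b [pI exW]]]]] := cosyz coH W.
  have [phi phiE] := proj_inj (gcomp a f) pI (se_inj ex).
  have [psi psiE] : exists psi : ghom Z (fihom V W), forall y, psi (p y) = b (phi y).
    by apply: (se_desc (h := gcomp b phi) ex) => x; rewrite /= phiE /= (se_pi exW).
  have /cls_null[Q [u [v [pQ E]]]] := pZ _ (ti_ihom tA V AW) (cls psi).
  have [w wE] := pQ _ _ b v (se_surj exW).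
  have [chi chiE] : exists chi : ghom Y W, forall y, a (chi y) = phi y - w (u (p y)).
    have bz y : b (gsub phi (gcomp (gcomp w u) p) y) = 0.
      by rewrite gsubE gfunB /= wE -E psiE subrr.
    have [chi chiE] := se_lift exW bz.
    by exists chi => y; rewrite chiE gsubE.
  have <- : cls chi ** cls i = cls f.
    rewrite -clsM; apply: cls_eqE => x; apply: (se_inj exW).
    by rewrite chiE (se_pi ex) !gfun0 subr0 phiE.
  by rewrite (pY W AW (cls chi)) scomp0l.
(* Maps X (x) N -> W are maps X -> [N, W]. *)
move=> X N Z [t tT] pX W AW; elim/shom_ind=> f.
have [fc fcE] := curry (pairing_comp f (gid X) (gid N) (tens_pairing tT)).
have /cls_null[Q [a [b [pQ E]]]] := pX _ (ti_ihom tA N AW) (cls (fc : ghom X (fihom N W))).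
have [u uE] := tens_lift (tensP Q N) (pairing_comp (gid W) b (gid N) (app_pairing N W)).
have [l lE] := tens_map a tT (tensP Q N).
apply/cls_null; exists (tens Q N), l, u; split.
  exact: proj_tens (tensP Q N) pQ.
apply: (tens_ghom_ext (u := f) (v := gcomp u l) tT) => x n /=.
by rewrite lE uE /= -E fcE.
Qed.

Definition gen (S : fg -> Prop) : fg -> Prop :=
  fun X => forall A, tideal A -> (forall Y, S Y -> A Y) -> A X.
Lemma gen_tideal S : tideal (gen S).
Proof.
split.
- by move=> X Y r gY A tA sA; apply: ti_ret tA _ _ r (gY _ tA sA).
- by move=> X X0 A tA sA; apply: ti_zero.
- move=> X Y Z t; split=> g1 g2 A tA sA; have [t1 t2 t3] := ti_tri tA t;
    [apply: t1|apply: t2|apply: t3]; by [apply: g1|apply: g2].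
by move=> X Y Z t gX A tA sA; apply: ti_ten tA _ _ _ t (gX _ tA sA).
Qed.
Lemma gen_mem S X : S X -> gen S X.
Proof. by move=> SX A _; apply. Qed.
Lemma gen_min S A : tideal A -> (forall Y, S Y -> A Y) -> forall X, gen S X -> A X.
Proof. by move=> tA sA X; apply. Qed.
Lemma gen_sub (S S' : fg -> Prop) : (forall X, S X -> S' X) -> forall X, gen S X -> gen S' X.
Proof. by move=> sub; apply: gen_min (gen_tideal S') _ => Y /sub; apply: gen_mem. Qed.

Definition gen1 (X : fg) : fg -> Prop := gen (fun Y => Y = X).
Lemma gen1_mem X : gen1 X X. Proof. exact: gen_mem. Qed.
Lemma gen1_min X A : tideal A -> A X -> forall Y, gen1 X Y -> A Y.
Proof. by move=> tA AX; apply: gen_min => // Y ->. Qed.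

Lemma perp_disj A : disj (perp A) A.
Proof. by move=> X pX AX; apply: pX. Qed.
Lemma disj_sym A A' : disj A A' -> disj A' A.
Proof. by move=> d X AX AX'; apply: d. Qed.

(** If the generators Y of one ideal satisfy that the ideals of Y and A are
    disjoint, then they belong to the orthogonal of A, hence so does the ideal
    that they generate. This is applied on both sides in turn. *)
Lemma gen_disj (S S' : fg -> Prop) :
  (forall X Y, S X -> S' Y -> disj (gen1 X) (gen1 Y)) -> disj (gen S) (gen S').
Proof.
move=> d; have step (A' : fg -> Prop) (SA : fg -> Prop) : tideal A' ->
    (forall X, SA X -> disj (gen1 X) A') -> disj (gen SA) A'.
  move=> tA' dj X gX AX; apply: (perp_disj (A := A')) AX; apply: gX.
    exact: perp_tideal.
  move=> Y SY W AW s; apply: (hom_orth (gen_tideal _) tA' (dj Y SY)) => //.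
  exact: gen1_mem.
apply: (step _ _ (gen_tideal _)) => // X SX; apply: disj_sym.
apply: (step _ _ (gen_tideal _)) => // Y SY; apply: disj_sym.
exact: d.
Qed.

End Ideals.

(** * Fitting's lemma and local objects *)

Section Fitting.
Variables (k : fieldType) (B : falgType k) (H : hopf_algebra B).
Local Notation fg := (fgmod H).
Local Notation "g ** f" := (scomp g f) (at level 40, left associativity).

Definition sunit (X : fg) (s : shom X X) : Prop :=
  exists t, t ** s = sid X /\ s ** t = sid X.
(** The stable endomorphism ring is local; the zero object is included. *)
Definition loc (X : fg) : Prop := forall s : shom X X, sunit s \/ sunit (sid X - s).

Lemma sunit_lr (X : fg) (s a b : shom X X) : a ** s = sid X -> s ** b = sid X -> sunit s.
Proof.
move=> as1 sb; exists a; split=> //.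
have -> : a = b by rewrite -(scomp1r a) -sb scompA as1 scomp1l.
exact: sb.
Qed.

Definition spow (X : fg) (s : shom X X) n := iter n (scomp s) (sid X).
Lemma spowSr (X : fg) (s : shom X X) n : spow s n.+1 = spow s n ** s.
Proof.
elim: n => [|n IH]; first by rewrite /= scomp1l scomp1r.
by rewrite -[RHS]scompA -IH.
Qed.
Lemma spow_nil (X : fg) (s : shom X X) n : spow s n = 0 -> sunit (sid X - s).
Proof.
move=> s0; suff [t [t1 t2]] : exists t, t ** (sid X - s) = sid X - spow s n /\
    (sid X - s) ** t = sid X - spow s n.
  by exists t; rewrite t1 t2 s0 subr0.
elim: n {s0} => [|n [t [t1 t2]]].
  by exists 0; rewrite scomp0l scomp0r subrr.
exists (t + spow s n); split.
  by rewrite scompDl t1 scompDr scompNr -spowSr scomp1r addrA subrK.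
by rewrite scompDr t2 scompDl scompNl scomp1l addrA subrK.
Qed.
Lemma spow_unit (X : fg) (s : shom X X) n : sunit (spow s n.+1) -> sunit s.
Proof.
move=> [u [u1 u2]]; apply: (@sunit_lr _ _ (u ** spow s n) (spow s n ** u)).
  by rewrite -scompA -spowSr.
by rewrite scompA.
Qed.

Section OneModule.
Variable X : fg.
Let n := bn (hb X).
Local Notation mx_of := (@mx_of _ _ _ X X).
Lemma mx_ext (M N : 'M[k]_n) : (forall x : X, row_of x *m M = row_of x *m N) -> M = N.
Proof.
move=> e; apply/row_matrixP => i; rewrite !rowE -[delta_mx _ _]of_rowK; exact: e.
Qed.
Lemma mx_of_comm u v : klin u -> klin v -> (forall x, u (v x) = v (u x)) ->
  mx_of u *m mx_of v = mx_of v *m mx_of u.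
Proof. by move=> ul vl c; apply: mx_ext => x; rewrite !mulmxA -!mx_ofE // c. Qed.

(** Matrices of graded B-linear endomorphisms. *)
Definition equivariant (M : 'M[k]_n) : Prop :=
  (forall b : B, mx_of (fun x => b *: x) *m M = M *m mx_of (fun x => b *: x)) /\
  (forall g, mx_of (ggr X g) *m M = M *m mx_of (ggr X g)).

Lemma ghom_of_mx (M : 'M[k]_n) : equivariant M ->
  exists f : ghom X X, forall x, f x = of_row (row_of x *m M).
Proof.
move=> [cb cg]; apply: mk_ghom => [x y|b x|g x hx].
- by rewrite -[x]k1 row_of_klin mulmxDl -scalemxAl of_rowD !k1.
- rewrite (mx_ofE _ (klin_act b)) -mulmxA cb mulmxA.
  rewrite -[row_of x *m M]of_rowK -(mx_ofE _ (klin_act b)) row_ofK.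
  by rewrite of_rowK.
have := cg g => e; rewrite /homog -[LHS]row_ofK (mx_ofE _ (klin_gr (M := X) g)) of_rowK.
by rewrite -mulmxA -e mulmxA -(mx_ofE _ (klin_gr (M := X) g)) hx.
Qed.

Lemma mx_of_equivariant (f : ghom X X) : equivariant (mx_of f).
Proof.
by split=> *; apply: mx_of_comm => [||x]; rewrite ?gfunZ ?ghom_gr //;
  [exact: klin_act|exact: klin_lin|exact: klin_gr|exact: klin_lin].
Qed.

(** If G and G^2 have the same rank, the space is the direct sum of the image
    and the kernel of G, and e is the projection onto the image. It commutes
    with everything that commutes with G, and G is invertible on the image: e
    = D G = G D'. *)
Lemma fitting_mx (G : 'M[k]_n) : \rank (G *m G) = \rank G ->
  exists e D D' : 'M[k]_n, [/\ e *m e = e, e *m G = G, e = D *m G, e = G *m D' &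
    forall C, C *m G = G *m C -> C *m e = e *m C].
Proof.
move=> rG.
have fact (M : 'M[k]_n) : \rank (M *m M) = \rank M -> exists D, M = D *m (M *m M).
  move=> rM; apply/submxP.
  have [_ ] := mxrank_leqif_eq (submxMl M M).
  by rewrite rM eqxx => /esym/andP[].
have [D DE] := fact G rG.
have [D1 D1E] : exists D1, G^T = D1 *m (G^T *m G^T).
  by apply: fact; rewrite -trmx_mul !mxrank_tr.
pose D' := D1^T.
have D'E : G = G *m G *m D'.
  by rewrite -[LHS]trmxK D1E !trmx_mul !trmxK.
have eE : D *m G = G *m D'.
  by rewrite [in LHS]D'E mulmxA -[D *m (G *m G)]DE.
have eG : D *m G *m G = G by rewrite -mulmxA -DE.
have Ge : G *m (D *m G) = G by rewrite eE mulmxA -D'E.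
exists (D *m G), D, D'; split=> //.
  by rewrite -mulmxA Ge.
move=> C CG; transitivity (D *m G *m C *m (D *m G)).
  by rewrite [in LHS]eE mulmxA CG -[in LHS]eG -!mulmxA; congr (_ *m (_ *m _)); rewrite mulmxA -CG -mulmxA -eE.
by rewrite -!mulmxA; congr (_ *m _); rewrite mulmxA -CG -mulmxA Ge.
Qed.

(** Indecomposability of the module itself and not of its stable class, so
    that dimensions can be compared. *)
Definition indec : Prop := forall e : ghom X X, (forall x, e (e x) = e x) ->
  (forall x, e x = 0) \/ (forall x, e x = x).

Definition gpow (f : ghom X X) m := iter m (gcomp f) (gid X).
Lemma cls_gpow (f : ghom X X) m : cls (gpow f m) = spow (cls f) m.
Proof. by elim: m => [//|m IH]; rewrite /= clsM IH. Qed.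
Lemma gpowD (f : ghom X X) m l x : gpow f (m + l)%N x = gpow f m (gpow f l x).
Proof. by elim: m => [//|m IH]; rewrite /= IH. Qed.

(** Choose a power of f of minimal rank. The projection of the Fitting
    decomposition is 0 or 1, so f is nilpotent or invertible. *)
Lemma indec_loc : indec -> loc X.
Proof.
move=> ind; elim/shom_ind=> f.
pose G m := mx_of (gpow f m.+1).
have GE m x : row_of (gpow f m.+1 x) = row_of x *m G m by apply/mx_ofE/klin_lin.
have ex : exists r, `[< exists m, \rank (G m) = r >].
  by exists (\rank (G 0)); apply/asboolP; exists 0.
have [r /asboolP[m rm] rmin] := ex_minnP ex.
have GG : G m *m G m = G (m + m.+1)%N.
  by apply: mx_ext => x; rewrite mulmxA -!GE -gpowD.
have rG : \rank (G m *m G m) = \rank (G m).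
  apply/eqP; rewrite eqn_leq mxrankM_maxl rm GG; apply: rmin.
  by apply/asboolP; exists (m + m.+1)%N.
have [e [D [D' [ee eG eD eD' cen]]]] := fitting_mx rG.
have [cG1 cG2] := mx_of_equivariant (gpow f m.+1).
have ce : equivariant e by split=> *; apply: cen; [apply: cG1|apply: cG2].
have [E EE] := ghom_of_mx ce.
have EEx x : E (E x) = E x.
  by rewrite [LHS]EE [in LHS]EE of_rowK -mulmxA ee -EE.
have [E0|E1] := ind E EEx.
  have e0 : e = 0.
    apply: mx_ext => x; rewrite mulmx0 -[LHS]of_rowK -EE E0.
    by apply/rowP=> i; rewrite !mxE bco0.
  right; apply: (@spow_nil _ _ m.+1); rewrite -cls_gpow.
  apply/cls_null/null0 => x.
  by rewrite -[LHS]row_ofK GE -eG e0 mul0mx mulmx0 /of_row big1 // => j _; rewrite mxE k0.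
have e1 : e = 1%:M by apply: mx_ext => x; rewrite mulmx1 -[LHS]of_rowK -EE E1.
have DG : D *m G m = 1%:M by rewrite -eD.
have GD' : G m *m D' = 1%:M by rewrite -eD'.
have DD' : D = D' by rewrite -[LHS]mulmx1 -GD' mulmxA DG mul1mx.
have GD : G m *m D = 1%:M by rewrite DD'.
have cenD C : C *m G m = G m *m C -> C *m D = D *m C.
  move=> c; rewrite -[LHS]mul1mx -DG -!mulmxA; congr (_ *m _).
  by rewrite mulmxA -c -mulmxA GD mulmx1.
have cD : equivariant D by split=> *; apply: cenD; [apply: cG1|apply: cG2].
have [L LE] := ghom_of_mx cD.
left; apply: (@spow_unit _ _ m); rewrite -cls_gpow.
exists (cls L); rewrite -!clsM; split; apply: cls_eqE => x.
  by rewrite /= -/(gpow f m.+1 x) LE GE -mulmxA GD mulmx1 row_ofK.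
transitivity (gpow f m.+1 (L x)) => //.
by rewrite -[LHS]row_ofK GE LE of_rowK -mulmxA DG mulmx1 row_ofK.
Qed.
End OneModule.

Lemma hb_min (X : fg) (s : seq X) : hspan s -> (bn (hb X) <= size s)%N.
Proof. by rewrite /hb; case: cid => b /= h; apply: h. Qed.

Lemma dim_lt (X Y : fg) (q : ghom X Y) x0 : (forall y, exists x, q x = y) ->
  q x0 = 0 -> x0 <> 0 -> (bn (hb Y) < bn (hb X))%N.
Proof.
move=> qs q0 x00.
have [j cj] : exists j, bco (hb X) x0 j != 0.
  apply/not_existsP => z; apply: x00; apply: (hb_ext (b := hb X)) => j.
  by rewrite bco0; apply/eqP; move/negP: (z j); rewrite negbK.
pose s := [seq q (be (hb X) i) | i <- enum 'I_(bn (hb X)) & i != j].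
have szs : (size s < bn (hb X))%N.
  rewrite size_map size_filter -[X in (_ < X)%N](size_enum_ord (bn (hb X))).
  rewrite -(count_predC (pred1 j)) addnC -[X in (X < _)%N]addn0 ltn_add2l.
  by rewrite -has_count; apply/hasP; exists j; rewrite ?mem_enum //=.
apply: leq_ltn_trans szs; apply: hb_min; split.
  by move=> y /mapP[i _ ->]; exists (bdg (hb X) i); apply/gfun_deg/be_homog.
have mems i : i != j -> inspan s (q (be (hb X) i)).
  by move=> ij; apply/inspan_mem/map_f; rewrite mem_filter ij mem_enum.
move=> y; have [x <-] := qs y; rewrite [x](be_sum (hb X)) linear_sum.
apply: inspan_sum => i _; rewrite linearZ; apply: inspanZ.
have [->|] := eqVneq i j; last exact: mems.
have -> : q (be (hb X) j) = \sum_(i | i != j) (- (bco (hb X) x0 j)^-1 * bco (hb X) x0 i)%:A *: q (be (hb X) i).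
  move: q0; rewrite {1}[x0](be_sum (hb X)) linear_sum (bigD1 j) //= gfunZ.
  move/eqP; rewrite addr_eq0 => /eqP e0.
  rewrite -[LHS]k1 -(mulVf cj) -kA e0 scalerN scaler_sumr -sumrN.
  by apply: eq_bigr => i' _; rewrite gfunZ kA mulNr scaleNr scaleNr.
by apply: inspan_sum => i' ij; apply/inspanZ/mems.
Qed.

(** A nontrivial idempotent splits a module into its kernel and its image,
    both of smaller dimension; a module without one is local by indec_loc. *)
Lemma KS_ind (Q : fg -> Prop) : (forall X, loc X -> Q X) ->
  (forall X Y Z, bip X Y Z -> Q X -> Q Y -> Q Z) -> forall X, Q X.
Proof.
move=> Ql Qs X; have [d] := ubnP (bn (hb X)); elim: d X => // d IH X; rewrite ltnS => dX.
have [/indec_loc/Ql //|] := EM (indec X).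
move=> /existsNP[e /not_implyP[ee /not_orP[/existsNP[x0 e0] /existsNP[x1 e1]]]].
have c1E x : gsub (gid X) e x = x - e x by rewrite gsubE.
pose K1 := fker (gsub (gid X) e); pose K2 := fker e.
have [p pE] : exists p : ghom X K1, forall x, ker_inc (gsub (gid X) e) (p x) = e x.
  apply: inj_lift (@ker_inc_inj _ _ _ X X _) _ => x; apply: ker_lift.
  by rewrite c1E ee subrr.
have [q qE] : exists q : ghom X K2, forall x, ker_inc e (q x) = x - e x.
  have [q qE] : exists q : ghom X K2, forall x, ker_inc e (q x) = gsub (gid X) e x.
    apply: inj_lift (@ker_inc_inj _ _ _ X X _) _ => x; apply: ker_lift.
    by rewrite c1E gfunB ee subrr.
  by exists q => x; rewrite qE c1E.
have k1E (w : K1) : e (ker_inc (gsub (gid X) e) w) = ker_inc (gsub (gid X) e) w.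
  by have := ker_inc0 w; rewrite c1E => /eqP; rewrite subr_eq0 => /eqP.
have k2E (w : K2) : e (ker_inc e w) = 0 by apply: ker_inc0.
apply: (Qs K1 K2).
- exists (cls (ker_inc (gsub (gid X) e) : ghom K1 X)), (cls (ker_inc e : ghom K2 X)), (cls p), (cls q).
  split; rewrite -?clsM -?clsD -?cls0; apply: cls_eqE => x /=.
  + by apply: (@ker_inc_inj _ _ _ X X); rewrite pE k1E.
  + by apply: (@ker_inc_inj _ _ _ X X); rewrite qE k2E subr0.
  + by apply: (@ker_inc_inj _ _ _ X X); rewrite pE k2E gfun0.
  + by apply: (@ker_inc_inj _ _ _ X X); rewrite qE k1E subrr gfun0.
  by rewrite pE qE addrC subrK.
- apply: IH; apply: leq_trans dX; apply: (@dim_lt _ _ p (x1 - e x1)) => [y||].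
  + by exists (ker_inc _ y); apply: (@ker_inc_inj _ _ _ X X); rewrite pE k1E.
  + by apply: (@ker_inc_inj _ _ _ X X); rewrite pE gfunB ee subrr gfun0.
  by move=> e2; apply: e1; apply/eqP; rewrite eq_sym -subr_eq0 e2.
apply: IH; apply: leq_trans dX; apply: (@dim_lt _ _ q (e x0)) => [y||//].
  by exists (ker_inc _ y); apply: (@ker_inc_inj _ _ _ X X); rewrite qE k2E subr0.
by apply: (@ker_inc_inj _ _ _ X X); rewrite qE ee subrr gfun0.
Qed.

(** The identity of X is the sum of its factorizations through the two
    summands, and one of them is invertible. *)
Lemma loc_bip (X Y Z W : fg) : loc X -> bip Y Z W -> sret X W -> sret X Y \/ sret X Z.
Proof.
move=> lX [i [j [p [q [e1 e2 e3 e4 e5]]]]] [a [r ra]].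
have e : r ** i ** (p ** a) + r ** j ** (q ** a) = sid X.
  by rewrite !scompA -(scompA r i) -(scompA r j) -scompDl -scompDr e5 scomp1r.
have [[t [t1 _]]|[t [t1 _]]] := lX (r ** i ** (p ** a)).
  by left; exists (p ** a), (t ** (r ** i)); rewrite -scompA.
have e' : r ** j ** (q ** a) = sid X - r ** i ** (p ** a).
  by rewrite -e addrAC subrr add0r.
by right; exists (q ** a), (t ** (r ** j)); rewrite -scompA e'.
Qed.

End Fitting.

(** * Finite coproducts and biproducts *)

Section Sums.
Variables (k : fieldType) (B : falgType k) (H : hopf_algebra B).
Variable coH : graded_cocommutative H.
Local Notation fg := (fgmod H).
Local Notation "g ** f" := (scomp g f) (at level 40, left associativity).
Local Notation tenp X Y Z := (@ten (stmod H) X Y Z).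

Definition scoprod (J : Type) (F : J -> fg) (X : fg) (inj : forall j, shom (F j) X) : Prop :=
  forall Y (f : forall j, shom (F j) Y),
    exists u, (forall j, u ** inj j = f j) /\ forall v, (forall j, v ** inj j = f j) -> v = u.

Lemma coproductP (J : Type) (F : J -> fg) (X : fg) (inj : forall j, ghom (F j) X) :
  @is_coproduct (stmod H) J F X inj <-> scoprod (fun j => cls (inj j)).
Proof.
split=> [cp Y f|cp Y f].
  have [u [uE uu]] := cp Y (fun j => rep (f j)).
  exists (cls (u : ghom X Y)); split=> [j|].
    by rewrite -clsM -[RHS]repK; apply/cls_eq; apply: uE.
  elim/shom_ind=> v vE; apply/cls_eq; apply: uu => j; apply/cls_eq.
  by rewrite clsM vE repK.
have [u [uE uu]] := cp Y (fun j => cls (f j : ghom (F j) Y)).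
exists (rep u); split=> [j|v vE].
  by apply/cls_eq; rewrite clsM repK uE.
apply/cls_eq; rewrite repK; apply: uu => j; rewrite -clsM.
by apply/cls_eq; apply: vE.
Qed.

Lemma scoprod_uniq (J : Type) (F : J -> fg) (X Y : fg) (inj : forall j, shom (F j) X)
  (inj' : forall j, shom (F j) Y) : scoprod inj -> scoprod inj' -> siso X Y.
Proof.
move=> cX cY; have [u [uE _]] := cX Y inj'; have [v [vE _]] := cY X inj.
exists u, v; split.
  have [w [_ ww]] := cX X inj; transitivity w; [|apply: esym]; apply: ww => j.
    by rewrite -scompA uE vE.
  by rewrite scomp1l.
have [w [_ ww]] := cY Y inj'; transitivity w; [|apply: esym]; apply: ww => j.
  by rewrite -scompA vE uE.
by rewrite scomp1l.
Qed.

(** Finite coproducts are built from binary biproducts, which are the form in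
    which direct sums are used elsewhere. *)
Lemma scoprod_sum (J J' : Type) (F : J + J' -> fg) (X Y Z : fg)
    (inj : forall j, shom (F (inl j)) X) (inj' : forall j, shom (F (inr j)) Y) :
  scoprod inj -> scoprod inj' -> bip X Y Z ->
  exists i : forall s, shom (F s) Z, scoprod i.
Proof.
move=> cX cY [i [j [p [q [e1 e2 e3 e4 e5]]]]].
exists (fun s => match s return shom (F s) Z with
  | inl a => i ** inj a | inr b => j ** inj' b end) => W f.
have [u [uE uu]] := cX W (fun a => f (inl a)).
have [v [vE vv]] := cY W (fun a => f (inr a)).
exists (u ** p + v ** q); split=> [[a|b]|w wE].
- rewrite scompDl !scompA -(scompA u) -(scompA v) e1 e4 scomp0r scomp0l addr0.
  by rewrite scomp1r.
- rewrite scompDl !scompA -(scompA u) -(scompA v) e2 e3 scomp0r scomp0l add0r.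
  by rewrite scomp1r.
have eu : w ** i = u by apply: uu => a; rewrite -scompA; apply: (wE (inl a)).
have ev : w ** j = v by apply: vv => b; rewrite -scompA; apply: (wE (inr b)).
by rewrite -(scomp1r w) -e5 scompDr !scompA eu ev.
Qed.

Section Reindex.
Variables (J J' : Type) (g : J -> J') (h : J' -> J).
Hypotheses (gh : forall j, g (h j) = j) (hg : forall j, h (g j) = j).

Lemma scoprod_reindex (F : J -> fg) (X : fg) (inj : forall j, shom (F j) X) :
  scoprod inj -> scoprod (fun j' => inj (h j')).
Proof.
move=> cX Y f.
pose f' j : shom (F j) Y := eq_rect (h (g j)) (fun j0 => shom (F j0) Y) (f (g j)) j (hg j).
have f'E j' : f' (h j') = f j'.
  rewrite /f'; move: (hg (h j')); rewrite gh => E.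
  by rewrite (Prop_irrelevance E erefl).
have [u [uE uu]] := cX Y f'; exists u; split=> [j'|v vE]; first by rewrite uE f'E.
have gen j0 j' : h j' = j0 -> v ** inj j0 = f' j0 by move=> <-; rewrite f'E.
by apply: uu => j; apply: gen (hg j).
Qed.

Lemma scoprod_reindex' (F : J' -> fg) (X : fg) (inj : forall j, shom (F (g j)) X) :
  scoprod inj -> exists i : forall j', shom (F j') X, scoprod i.
Proof.
move=> /scoprod_reindex cX.
have e : F = (fun j' => F (g (h j'))) by apply: funext => j'; rewrite gh.
by rewrite e; exists (fun j' => inj (h j')).
Qed.
End Reindex.

(** Free modules are zero objects of the stable category. *)
Definition fzero : fg := freg H.
Lemma fzero0 : sid fzero = 0. Proof. by apply/sid0_proj/reg_proj. Qed.

Lemma scoprod0 (J : Type) (F : J -> fg) (X : fg) (inj : forall j, shom (F j) X) :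
  (J -> False) -> sid X = 0 -> scoprod inj.
Proof.
move=> J0 X0 Y f; exists 0; split=> [j|v _]; first by case: (J0 j).
exact: shom0l.
Qed.

Lemma bip_0r (X Y : fg) : sid Y = 0 -> bip X Y X.
Proof.
move=> Y0; exists (sid X), 0, (sid X), 0.
by split; rewrite ?scomp1r ?scomp0l ?scomp0r ?Y0 ?addr0.
Qed.

Section TenBip.
Variable N : fg.

(** The tensor product with N is well defined on stable morphisms, as the
    tensor product of a projective module with N is projective. *)
Lemma tens_map_cls (X X' T T' : fg) (t : X -> N -> T) (t' : X' -> N -> T') (s : shom X X') :
  is_tensor t -> is_tensor t' -> exists S : shom T T',
    forall (f : ghom X X') (u : ghom T T'), cls f = s ->
      (forall x y, u (t x y) = t' (f x) y) -> cls u = S.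
Proof.
move=> tT tT'; elim/shom_ind: s => f0; have [u0 u0E] := tens_map f0 tT tT'.
exists (cls u0) => f u /cls_eq/se_null[P [a [b [pP E]]]] uE.
have [v vE] := tens_map a tT (tensP P N); have [w wE] := tens_map b (tensP P N) tT'.
apply/cls_eq/se_null; exists (tens P N), v, w; split; first exact: proj_tens (tensP P N) pP.
apply: (tens_ghom_ext (u := gsub u u0) (v := gcomp w v) tT) => x y.
have k1' (z : T') := k1 z.
rewrite gsubE /= uE u0E vE wE -E gsubE.
have tb := tens_kbil tT'.
by rewrite (kbilDl tb) // -scaleN1r -[in RHS](scaleN1r (f0 x)) -[-1 : B]scaleN1r
  (kbilZl tb) scaleN1r.
Qed.

Lemma ten_bip (X Y Z T1 T2 T : fg) : bip X Y Z -> tenp X N T1 -> tenp Y N T2 -> tenp Z N T ->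
  bip T1 T2 T.
Proof.
move=> [i [j [p [q []]]]]; elim/shom_ind: i => i; elim/shom_ind: j => j.
elim/shom_ind: p => p; elim/shom_ind: q => q; rewrite -!clsM -clsD -!cls0.
move=> e1 e2 e3 e4 e5 [t1 tT1] [t2 tT2] [t tT].
have [i' iE] := tens_map i tT1 tT; have [j' jE] := tens_map j tT2 tT.
have [p' pE] := tens_map p tT tT1; have [q' qE] := tens_map q tT tT2.
have st (X1 X2 U1 U2 : fg) (s1 : X1 -> N -> U1) (s2 : X2 -> N -> U2) (f g : ghom X1 X2) (u v : ghom U1 U2) :
   is_tensor s1 -> is_tensor s2 -> cls f = cls g -> (forall x y, u (s1 x y) = s2 (f x) y) ->
   (forall x y, v (s1 x y) = s2 (g x) y) -> cls u = cls v.
  move=> sT1 sT2 fg uE vE; have [S SE] := tens_map_cls (cls g) sT1 sT2.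
  by rewrite (SE f u) // (SE g v).
have z0 (X1 X2 U1 U2 : fg) (s1 : X1 -> N -> U1) (s2 : X2 -> N -> U2) : is_tensor s2 ->
   forall x y, gzero U1 U2 (s1 x y) = s2 (gzero X1 X2 x) y.
  move=> sT2 x y /=; rewrite (kbil0l (tens_kbil sT2)) // => w; exact: k1.
exists (cls i'), (cls j'), (cls p'), (cls q'); split; rewrite -?clsM -?clsD -?cls0.
- by apply: (st _ _ _ _ _ _ _ _ _ _ tT1 tT1 e1) => x y //=; rewrite iE pE.
- by apply: (st _ _ _ _ _ _ _ _ _ _ tT2 tT2 e2) => x y //=; rewrite jE qE.
- apply: (st _ _ _ _ _ _ _ _ _ _ tT2 tT1 e3) => x y; first by rewrite /= jE pE.
  exact: z0.
- apply: (st _ _ _ _ _ _ _ _ _ _ tT1 tT2 e4) => x y; first by rewrite /= iE qE.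
  exact: z0.
apply: (st _ _ _ _ _ _ _ _ _ _ tT tT e5) => x y //=.
by rewrite pE iE qE jE (kbilDl (tens_kbil tT)) // => w; apply: k1.
Qed.
End TenBip.

(** * Sums of ideals with trivial intersections *)

Section Family.
Variables (I : Type) (Ti : I -> fg -> Prop).

(** The finite direct sums of objects of the T_i with i in J, built up by
    binary sums to allow induction. The set J is recorded to keep track of the
    components of an object. *)
Inductive sums (J : I -> Prop) : fg -> Prop :=
| sums0 X : sid X = 0 -> sums J X
| sums1 i X : J i -> Ti i X -> sums J X
| sums2 X Y Z : bip X Y Z -> sums J X -> sums J Y -> sums J Z.

Lemma sums_mono (J J' : I -> Prop) X : (forall i, J i -> J' i) -> sums J X -> sums J' X.
Proof.
move=> sub; elim=> [{}X X0|i {}X Ji TX|X1 X2 {}X b _ h1 _ h2].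
- exact: sums0.
- exact: sums1 (sub i Ji) TX.
exact: sums2 b h1 h2.
Qed.

Lemma sums_min (J : I -> Prop) (A : fg -> Prop) : tideal A ->
  (forall i X, J i -> Ti i X -> A X) -> forall X, sums J X -> A X.
Proof.
move=> tA sub X; elim=> [{}X X0|i {}X Ji TX|X1 X2 {}X b _ h1 _ h2].
- exact: ti_zero.
- exact: sub Ji TX.
exact: ti_bip b h1 h2.
Qed.

Hypothesis hT : forall i, tideal (Ti i).

(** By loc_bip a local retract of a sum is a retract of one of the objects of
    which it is made up. *)
Lemma loc_sums J X Y : loc X -> sums J Y -> sret X Y -> sid X = 0 \/ exists i, J i /\ Ti i X.
Proof.
move=> lX; elim=> [{}Y Y0|i {}Y Ji TY|Y1 Y2 {}Y b _ h1 _ h2].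
- by move=> [a [r <-]]; left; rewrite (shom0l r Y0) scomp0l.
- by move=> XY; right; exists i; split=> //; apply: ti_ret (hT i) _ _ XY TY.
by move/(loc_bip lX b) => [/h1|/h2].
Qed.

(** A retract is a sum of local objects by KS_ind, and each of them belongs to
    some T_i by loc_sums. *)
Lemma sums_ret J X Y : sret X Y -> sums J Y -> sums J X.
Proof.
move: X Y; apply: (@KS_ind _ _ H (fun X => forall Y, sret X Y -> sums J Y -> sums J X)).
  move=> X lX Y XY DY; have [X0|[i [Ji TX]]] := loc_sums lX DY XY; first exact: sums0.
  exact: sums1 Ji TX.
move=> X1 X2 X b h1 h2 Y XY DY; apply: (sums2 b).
  exact: h1 (sret_trans (bip_ret1 b) XY) DY.
exact: h2 (sret_trans (bip_ret2 b) XY) DY.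
Qed.

Lemma sums_ten J X Y Z : tenp X Y Z -> sums J X -> sums J Z.
Proof.
move=> tZ DX; elim: DX Z tZ => [{}X X0|i {}X Ji TX|X1 X2 {}X b _ h1 _ h2] Z tZ.
- move: X0 tZ => /sid0_proj pX [t tT]; apply/sums0/sid0_proj.
  exact: proj_tens tT pX.
- by apply: sums1 Ji _; apply: ti_ten (hT _) _ _ _ tZ TX.
apply: (sums2 (ten_bip b (ten_ftens _ _) (ten_ftens _ _) tZ)).
  exact: h1 (ten_ftens _ _).
exact: h2 (ten_ftens _ _).
Qed.

Lemma sums_empty J X : (forall i, ~ J i) -> sums J X -> sid X = 0.
Proof.
move=> J0; elim=> [{}X //|i {}X /J0 //|X1 X2 {}X [i [j [p [q [_ _ _ _ <-]]]]] _ h1 _ h2].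
by rewrite (shom0l i h1) (shom0l j h2) !scomp0l addr0.
Qed.

Lemma sums_coprod X : sums (fun=> True) X <->
  exists (n : nat) (c : 'I_n -> I) (F : 'I_n -> fg) (inj : forall j, shom (F j) X),
    (forall j, Ti (c j) (F j)) /\ scoprod inj.
Proof.
split.
  elim=> [{}X X0|i {}X _ TX|Y Z {}X b _ [n [c [F [inj [TF cF]]]]] _ [m [c' [F' [inj' [TF' cF']]]]]].
  - have f0 (j : 'I_0) : False by case: j.
    exists 0%N, (fun j => match f0 j with end), (fun j => match f0 j with end),
      (fun j => match f0 j with end); split=> [j|]; first by case: (f0 j).
    exact: scoprod0.
  - exists 1%N, (fun=> i), (fun=> X), (fun=> sid X); split=> // W f.
    exists (f ord0); split=> [j|v <-]; last by rewrite scomp1r.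
    by rewrite scomp1r (ord1 j).
  pose c2 (s : 'I_n + 'I_m) := match s with inl a => c a | inr b => c' b end.
  pose F2 (s : 'I_n + 'I_m) := match s with inl a => F a | inr b => F' b end.
  have [i ci] := @scoprod_sum _ _ F2 _ _ _ inj inj' cF cF' b.
  exists (n + m)%N, (fun j => c2 (split j)), (fun j => F2 (split j)), (fun j => i (split j)).
  split; first by move=> j; case: (split j).
  exact: (@scoprod_reindex _ _ (@unsplit n m) (@split n m) (@splitK n m) (@unsplitK n m) F2 _ i ci).
move=> [n [c [F [inj [TF cF]]]]].
have [S [i [ci DS]]] : exists (S : fg) (i : forall j, shom (F j) S), scoprod i /\ sums (fun=> True) S.
  elim: n c F {inj cF} TF => [|n IH] c F TF.
    have f0 (j : 'I_0) : False by case: j.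
    exists fzero, (fun j => match f0 j with end); split; last exact/sums0/fzero0.
    exact: scoprod0 fzero0.
  have [S [i [ci DS]]] := IH (fun j => c (lift ord0 j)) (fun j => F (lift ord0 j)) (fun j => TF _).
  pose g (s : unit + 'I_n) : 'I_n.+1 := match s with inl _ => ord0 | inr j => lift ord0 j end.
  pose h (j : 'I_n.+1) : unit + 'I_n :=
    match unlift ord0 j with None => inl tt | Some l => inr l end.
  have gh j : g (h j) = j by rewrite /h; case: unliftP.
  have hg s : h (g s) = s.
    by rewrite /h; case: s => [[]|l] /=; rewrite ?unlift_none ?liftK.
  have c1 : @scoprod unit (fun u => F (g (inl u))) (F ord0) (fun=> sid (F ord0)).
    move=> W f; exists (f tt); split=> [[]|v /(_ tt) <-]; first exact: scomp1r.
    by rewrite scomp1r.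
  have [i2 ci2] := @scoprod_sum _ _ (fun s => F (g s)) _ _ _ _ i c1 ci (bip_dsum (F ord0) S).
  have [i3 ci3] := scoprod_reindex' gh hg ci2.
  exists (fdsum (F ord0) S), i3; split=> //.
  by apply: sums2 (bip_dsum (F ord0) S) _ DS; apply: sums1 (TF ord0).
apply: sums_ret DS; apply: siso_ret; exact: scoprod_uniq cF ci.
Qed.

Hypothesis hd : forall i j, i <> j -> disj (Ti i) (Ti j).

(** By induction on both sums, from the orthogonality of the single ideals. *)
Lemma sums_orth J J' X Y : (forall i, J i -> ~ J' i) -> sums J X -> sums J' Y ->
  forall s : shom X Y, s = 0.
Proof.
move=> JJ DX DY.
elim: DX => [{}X X0 s|i {}X Ji TX|X1 X2 {}X [i [j [p [q [_ _ _ _ e]]]]] _ h1 _ h2 s].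
- exact: shom0l.
- elim: DY => [{}Y Y0 s|j {}Y Jj TY|Y1 Y2 {}Y [i1 [j1 [p [q [_ _ _ _ e]]]]] _ h1 _ h2 s].
  + exact: shom0r.
  + apply: (hom_orth coH (hT i) (hT j) _ TX TY); apply: hd => e.
    by apply: (JJ i Ji); rewrite e.
  by rewrite -(scomp1l s) -e scompDl -!scompA (h1 (p ** s)) (h2 (q ** s)) !scomp0r addr0.
by rewrite -(scomp1r s) -e scompDr !scompA (h1 (s ** i)) (h2 (s ** j)) !scomp0l addr0.
Qed.

Lemma sums_disj J J' X : (forall i, J i -> ~ J' i) -> sums J X -> sums J' X -> sid X = 0.
Proof. by move=> JJ DX DX'; apply: sums_orth JJ DX DX' _. Qed.

Lemma bip_interchange (X Y Z X1 X2 Y1 Y2 : fg) : bip X Y Z -> bip X1 X2 X -> bip Y1 Y2 Y ->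
  exists U V, [/\ bip Y1 X1 U, bip Y2 X2 V & bip U V Z].
Proof.
move=> bZ bX bY; have [U [b1 b2]] := bip_assoc bX bZ.
have [V [b3 b4]] := bip_assoc bY (bip_sym b1).
have [W [b5 b6]] := bip_assoc (bip_sym b4) (bip_sym b2).
by exists W, V; split=> //; apply: bip_sym.
Qed.

Definition except (J : I -> Prop) (i : I) : I -> Prop := fun j => J j /\ j <> i.

(** The summands in T_i are collected by rearranging sums of sums. *)
Lemma sums_split J i X : sums J X ->
  exists Xi X', [/\ bip Xi X' X, Ti i Xi & sums (except J i) X'].
Proof.
elim=> [{}X X0|j {}X Jj TX|Y Z {}X b _ [X1 [X2 [b1 T1 D1]]] _ [Y1 [Y2 [b2 T2 D2]]]].
- exists X, X; split; first exact: bip_0r.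
    exact: (ti_zero (hT i)).
  exact: sums0.
- have [e|ne] := EM (j = i).
    exists X, fzero; split; first exact: bip_0r fzero0.
      by rewrite -e.
    exact/sums0/fzero0.
  exists fzero, X; split; first exact/bip_sym/bip_0r/fzero0.
    exact/(ti_zero (hT i))/fzero0.
  by apply: sums1 TX.
have [U [V [c1 c2 c3]]] := bip_interchange b b1 b2; exists U, V; split=> //.
  exact: ti_bip (hT i) _ _ _ c1 T2 T1.
exact: sums2 c2 D2 D1.
Qed.

(** There are no maps between T_i and the sums of the other ideals, so an
    isomorphism is diagonal and restricts to the components. *)
Lemma comp_uniq (i : I) (X Y X1 X2 Y1 Y2 : fg) : siso X Y -> bip X1 X2 X -> bip Y1 Y2 Y ->
  Ti i X1 -> Ti i Y1 -> sums (fun j => j <> i) X2 -> sums (fun j => j <> i) Y2 -> siso X1 Y1.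
Proof.
move=> [f [g [gf fg_]]] [iX [jX [pX [qX [a1 a2 a3 a4 a5]]]]] [iY [jY [pY [qY [b1 b2 b3 b4 b5]]]]].
move=> TX TY DX DY.
have orth (U V : fg) : Ti i U -> sums (fun j => j <> i) V -> forall s : shom U V, s = 0.
  move=> TU DV; apply: (@sums_orth (fun j => j = i)) DV => [j -> //|].
  exact: sums1 TU.
exists (pY ** f ** iX), (pX ** g ** iY); split.
  have z : qY ** (f ** iX) = 0 by apply: orth.
  transitivity (pX ** g ** (iY ** pY + jY ** qY) ** (f ** iX)).
    rewrite scompDr scompDl -(scompA (pX ** g) (jY ** qY)) -(scompA jY qY) z.
    by rewrite !scomp0r addr0 !scompA.
  by rewrite b5 scomp1r !scompA -(scompA pX) gf scomp1r.
have z : qX ** (g ** iY) = 0 by apply: orth.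
transitivity (pY ** f ** (iX ** pX + jX ** qX) ** (g ** iY)).
  rewrite scompDr scompDl -(scompA (pY ** f) (jX ** qX)) -(scompA jX qX) z.
  by rewrite !scomp0r addr0 !scompA.
by rewrite a5 scomp1r !scompA -(scompA pY) fg_ scomp1r.
Qed.

(** The zero objects are the left orthogonal of the ideal of all objects, so
    they are closed under fibres. *)
Lemma zero_fib (X Y Z : fg) (i : ghom X Y) (p : ghom Y Z) : short_exact i p ->
  sid Y = 0 -> sid Z = 0 -> sid X = 0.
Proof.
have tT : tideal (fun _ : fg => True) by split.
move=> ex Y0 Z0; have : perp (fun _ : fg => True) X.
  apply: (ti_fib (perp_tideal coH tT) ex) => W _ s; exact: shom0l.
by move=> pX; apply: pX.
Qed.
End Family.

Section FiniteFamily.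
Variables (I : eqType) (Ti : I -> fg -> Prop).
Hypothesis hT : forall i, tideal (Ti i).
Hypothesis hd : forall i j, i <> j -> disj (Ti i) (Ti j).
Local Notation sums := (sums Ti).

Definition within (J : I -> Prop) (s : seq I) : I -> Prop := fun j => j \in s /\ J j.

Lemma sums_fin J X : sums J X -> exists s : seq I, sums (within J s) X.
Proof.
elim=> [{}X X0|i {}X Ji TX|X1 X2 {}X b _ [s1 h1] _ [s2 h2]].
- by exists [::]; apply: sums0.
- by exists [:: i]; apply: sums1 TX; rewrite /within inE eqxx.
exists (s1 ++ s2); apply: (sums2 b).
  by apply: sums_mono h1 => j [js Jj]; split=> //; rewrite mem_cat js.
by apply: sums_mono h2 => j [js Jj]; split=> //; rewrite mem_cat js orbT.
Qed.

(** By fib_bip the fibre splits off the fibre of the T_a-components, and the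
    remaining part involves fewer ideals. The induction needs the finite list
    s of ideals to be fixed. *)
Lemma sums_fib_fin J s (X Y Z : fg) (i : ghom X Y) (p : ghom Y Z) : short_exact i p ->
  sums (within J s) Y -> sums (within J s) Z -> sums (within J s) X.
Proof.
elim: s X Y Z i p => [|a s IH] X Y Z i p ex DY DZ.
  have e0 U : sums (within J [::]) U -> sid U = 0 by apply: sums_empty => j [].
  by apply: sums0; apply: zero_fib ex (e0 _ DY) (e0 _ DZ).
have [Ja|nJa] := EM (J a); last first.
  have sub U : sums (within J (a :: s)) U -> sums (within J s) U.
    apply: sums_mono => j [js Jj]; split=> //; move: js; rewrite inE => /orP[/eqP e|//].
    by case: nJa; rewrite -e.
  apply: (@sums_mono _ _ (within J s)) => [j [js Jj]|]; first by split=> //; rewrite inE js orbT.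
  exact: IH ex (sub _ DY) (sub _ DZ).
have [Y1 [Y2 [bY TY DY2]]] := sums_split hT a DY.
have [Z1 [Z2 [bZ TZ DZ2]]] := sums_split hT a DZ.
have sub U : sums (except (within J (a :: s)) a) U -> sums (within J s) U.
  apply: sums_mono => j [[js Jj] ja]; split=> //; move: js; rewrite inE => /orP[/eqP //|//].
have D1 U : Ti a U -> sums (fun j => j = a) U by move=> TU; apply: sums1 TU.
have o12 (s0 : shom Y1 Z2) : s0 = 0.
  by apply: (sums_orth hT hd _ (D1 _ TY) DZ2) => j -> [].
have o21 (s0 : shom Y2 Z1) : s0 = 0.
  by apply: (sums_orth hT hd _ DY2 (D1 _ TZ)) => j [].
have [K1 [K2 [bK t1 t2]]] := fib_bip ex bY bZ o12 o21.
apply: (sums2 bK).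
  apply: (@sums1 _ _ _ a); first by split=> //; rewrite inE eqxx.
  by have [_ h _] := ti_tri (hT a) t1; apply: h.
apply: (@sums_mono _ _ (within J s)) => [j [js Jj]|]; first by split=> //; rewrite inE js orbT.
have [X' [Y' [Z' [i' [p' [ex' iX iY iZ]]]]]] := t2.
apply: (sums_ret hT (siso_ret iX)); apply: IH ex' _ _.
  exact: (sums_ret hT (siso_ret (siso_sym iY)) (sub _ DY2)).
exact: (sums_ret hT (siso_ret (siso_sym iZ)) (sub _ DZ2)).
Qed.

Lemma sums_tideal J : tideal (sums J).
Proof.
apply: (tideal_crit coH).
- exact: sums_ret.
- exact: sums0.
- move=> X Y Z i p ex /sums_fin[s1 D1] /sums_fin[s2 D2].
  apply: (@sums_mono _ _ (within J (s1 ++ s2))) => [j []//|].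
  apply: (sums_fib_fin ex).
    by apply: sums_mono D1 => j [js Jj]; split=> //; rewrite mem_cat js.
  by apply: sums_mono D2 => j [js Jj]; split=> //; rewrite mem_cat js orbT.
exact: sums_ten.
Qed.

End FiniteFamily.

End Sums.

(** * Components and Krull-Schmidt decompositions *)

Section KrullSchmidt.
Variables (k : fieldType) (B : falgType k) (H : hopf_algebra B).
Variable coH : graded_cocommutative H.
Local Notation fg := (fgmod H).
Local Notation "g ** f" := (scomp g f) (at level 40, left associativity).
Local Notation all_sums Ti := (sums Ti (fun=> True)).

Lemma disjP (A A' : fg -> Prop) : @trivial_intersection (stmod H) A A' <-> disj A A'.
Proof. by split=> d X AX A'X; apply/is_zeroP/d. Qed.
Lemma zero_subcatP (A : fg -> Prop) : @zero_subcat (stmod H) A <-> forall X, A X -> sid X = 0.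
Proof. by split=> d X AX; apply/is_zeroP/d. Qed.

Lemma decompositionP (I : Type) (Ti : I -> fg -> Prop) (A : fg -> Prop) :
  @decomposition (stmod H) I Ti A <->
  [/\ forall i, tideal (Ti i), forall X, A X <-> all_sums Ti X
    & forall i j, i <> j -> disj (Ti i) (Ti j)].
Proof.
have cop X : (forall i, tideal (Ti i)) -> (all_sums Ti X <->
    exists (n : nat) (c : 'I_n -> I) (F : 'I_n -> fg) (inj : forall j, ghom (F j) X),
          (forall j, Ti (c j) (F j)) /\ @is_coproduct (stmod H) _ F X inj).
  move=> hT; split=> [/(sums_coprod hT)|].
    move=> [n [c [F [inj [TF cF]]]]]; exists n, c, F, (fun j => rep (inj j)); split=> //.
    apply/coproductP; congr (scoprod _): cF.
    by apply: functional_extensionality_dep => j; rewrite repK.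
  move=> [n [c [F [inj [TF /coproductP cF]]]]]; apply/(sums_coprod hT).
  by exists n, c, F, (fun j => cls (inj j)).
split=> -[h1 h2 h3].
  have hT i : tideal (Ti i) by apply/thick_tideal.
  split=> // [X|i j ij]; last by apply/disjP/h3.
  by rewrite h2; apply: iff_sym; apply: cop.
split=> [i|X|i j ij]; first exact/thick_tideal.
  by rewrite h2; apply: cop.
exact/disjP/h3.
Qed.

Section Components.
Variables (T : fg -> Prop) (tT : tideal T).

Definition ind_ob (X : fg) : Prop := [/\ loc X, sid X <> 0 & T X].
Definition link (X Y : fg) : Prop := ~ disj (gen1 X) (gen1 Y).
Inductive conn : fg -> fg -> Prop :=
| conn0 X : conn X X
| conn1 X Y Z : conn X Y -> ind_ob Y -> ind_ob Z -> link Y Z -> conn X Z.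

Lemma link_sym X Y : link X Y -> link Y X.
Proof. by move=> l d; apply/l/disj_sym. Qed.
Lemma conn_trans X Y Z : conn X Y -> conn Y Z -> conn X Z.
Proof.
move=> c d; elim: d X c => [//|Y1 Y2 Y3 _ IH i2 i3 l X /IH c].
exact: conn1 c i2 i3 l.
Qed.
Lemma conn_sym X Y : conn X Y -> conn Y X.
Proof.
elim=> [X0|X0 Y0 Z0 _ IH i2 i3 l]; first exact: conn0.
exact: conn_trans (conn1 (conn0 Z0) i3 i2 (link_sym l)) IH.
Qed.

Definition component (X : fg) : fg -> Prop := gen (fun Y => ind_ob Y /\ conn X Y).
Lemma component_tideal X : tideal (component X). Proof. exact: gen_tideal. Qed.
Lemma component_self X : ind_ob X -> component X X.
Proof. by move=> iX; apply: gen_mem; split=> //; apply: conn0. Qed.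
Lemma component_sub X Y : component X Y -> T Y.
Proof. by apply: gen_min => // Z [[]]. Qed.
Lemma component_eq X Y : conn X Y -> component X = component Y.
Proof.
move=> c; apply: funext => Z; apply: propext.
split; apply: gen_sub => W [iW cW]; split=> //.
  exact: conn_trans (conn_sym c) cW.
exact: conn_trans c cW.
Qed.
(** By gen_disj it is enough to compare two local objects of the two classes,
    and these are not linked. *)
Lemma component_disj X Y : ~ conn X Y -> disj (component X) (component Y).
Proof.
move=> nc; apply: (gen_disj coH) => X' Y' [iX cX] [iY cY].
apply: contrapT => l; apply: nc.
exact: conn_trans (conn1 cX iX iY l) (conn_sym cY).
Qed.

(** The components index themselves, so that each of them occurs only once. *)
Definition comp_index : Type := {A : fg -> Prop | exists X, ind_ob X /\ A = component X}.

Lemma ind_ob_ex (A : fg -> Prop) : tideal A -> (forall X, A X -> T X) ->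
  ~ (forall X, A X -> sid X = 0) -> exists X, ind_ob X /\ A X.
Proof.
move=> tA AT; move=> nA; apply: contrapT => no; apply: nA.
apply: KS_ind => [X lX AX|X Y Z b h1 h2 AZ].
  by apply: contrapT => X0; apply: no; exists X; split=> //; split=> //; apply: AT.
have [i [j [p [q [_ _ _ _ <-]]]]] := b.
rewrite (shom0l i (h1 _)) ?(shom0l j (h2 _)) ?scomp0l ?addr0 //.
  exact: ti_ret tA _ _ (bip_ret2 b) AZ.
exact: ti_ret tA _ _ (bip_ret1 b) AZ.
Qed.

(** An ideal is generated by its nonzero local objects, by KS_ind. *)
Lemma local_gen (A A' : fg -> Prop) : tideal A -> (forall X, A X -> T X) -> tideal A' ->
  (forall X, ind_ob X -> A X -> A' X) -> forall X, A X -> A' X.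
Proof.
move=> tA AT tA' h; apply: KS_ind => [X lX AX|X Y Z b h1 h2 AZ].
  have [X0|X0] := EM (sid X = 0); first exact: ti_zero.
  by apply: h => //; split=> //; apply: AT.
apply: (ti_bip tA' b); [apply: h1|apply: h2].
  exact: ti_ret tA _ _ (bip_ret1 b) AZ.
exact: ti_ret tA _ _ (bip_ret2 b) AZ.
Qed.

Lemma component_decomposition :
  @decomposition (stmod H) comp_index (fun A => sval A) T.
Proof.
have hT (a : comp_index) : tideal (sval a).
  by case: a => A [X [iX e]] /=; rewrite e; apply: component_tideal.
apply/decompositionP; split=> // [X|[A [Y [iY EA]]] [A' [Z [iZ EA']]] ne /=].
  split=> [|DX].
    move: X; apply: KS_ind => [X lX TX|X Y Z b h1 h2 TZ].
      have [X0|X0] := EM (sid X = 0); first exact: sums0.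
      have iX : ind_ob X by split.
      have ex : exists Y, ind_ob Y /\ component X = component Y by exists X.
      apply: (@sums1 _ _ _ comp_index (fun A => sval A) _ (exist (fun A => exists Y, ind_ob Y /\ A = component Y) _ ex)) => //=.
      exact: component_self.
    apply: (sums2 b); [apply: h1|apply: h2].
      exact: ti_ret tT _ _ (bip_ret1 b) TZ.
    exact: ti_ret tT _ _ (bip_ret2 b) TZ.
  apply: (sums_min tT _ DX) => -[A [Y [iY e]]] Z _ /=; rewrite e.
  exact: component_sub.
rewrite EA EA'; apply: component_disj => c; apply: ne.
by apply: eq_exist; rewrite EA EA'; apply: component_eq.
Qed.

(** An object of A is a sum of objects of the A_j, and a local object is a
    retract of one of them. *)
Lemma ind_ob_summand (J : Type) (Aj : J -> fg -> Prop) (A : fg -> Prop) X :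
  @decomposition (stmod H) J Aj A -> ind_ob X -> A X -> exists j, Aj j X.
Proof.
move=> /decompositionP[hT AE hd] [lX X0 _] /AE DX.
have sXX : sret X X by apply/siso_ret/siso_refl.
by have [//|[j [_ h]]] := loc_sums hT lX DX sXX; exists j.
Qed.

(** If j and l differ, the ideals generated by X and Y are contained in ideals
    with trivial intersection. *)
Lemma link_summand (J : Type) (Aj : J -> fg -> Prop) (A : fg -> Prop) X Y j l :
  @decomposition (stmod H) J Aj A -> Aj j X -> Aj l Y -> link X Y -> j = l.
Proof.
move=> /decompositionP[hT AE hd] AX AY lk; apply: contrapT => jl; apply: lk => Z gX gY.
apply: (hd _ _ jl).
  exact: gen1_min (hT j) AX _ gX.
exact: gen1_min (hT l) AY _ gY.
Qed.

Lemma conn_summand (J : Type) (Aj : J -> fg -> Prop) (A : fg -> Prop) X Y j :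
  @decomposition (stmod H) J Aj A -> (forall Z, ind_ob Z -> conn X Z -> A Z) ->
  Aj j X -> conn X Y -> Aj j Y.
Proof.
move=> dec sub AX c; elim: c sub AX => [//|X0 Y0 Z0 c IH iY iZ l] sub AX.
have AY := IH sub AX.
have cZ : conn X0 Z0 := conn1 c iY iZ l.
have [m AZ] := ind_ob_summand dec iZ (sub _ iZ cZ).
by rewrite (link_summand dec AY AZ l).
Qed.

(** All local objects of a class lie in the summand that contains one of them,
    so the other summand is zero. *)
Lemma component_indecomposable X : ind_ob X -> @indecomposable (stmod H) (component X).
Proof.
move=> iX; split.
  move/zero_subcatP => z; have [lX X0 TX] := iX; apply: X0.
  exact: z _ (component_self iX).
move=> C1 C2 dec.
have sub Z : ind_ob Z -> conn X Z -> component X Z by move=> iZ cZ; apply: gen_mem.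
have [b bX] := ind_ob_summand dec iX (component_self iX).
have /decompositionP[hT AE hd] := dec.
have all_b Z : component X Z -> (if b then C1 else C2) Z.
  move=> cZ; apply: (gen_min (hT b) _ cZ) => W [iW cW].
  exact: (conn_summand dec sub bX cW).
have other (C : bool) : C <> b -> forall Z, (if C then C1 else C2) Z -> sid Z = 0.
  move=> Cb Z CZ; apply: (hd C b Cb) => //; apply: all_b.
  by apply/AE; apply: (@sums1 _ _ _ bool _ _ C).
case: b {bX all_b} other => other; [right|left]; apply/zero_subcatP.
  exact: (other false).
exact: (other true).
Qed.

Lemma decomposition_sub (J : Type) (Aj : J -> fg -> Prop) (A : fg -> Prop) j X :
  @decomposition (stmod H) J Aj A -> Aj j X -> A X.
Proof. by move=> /decompositionP[hT AE hd] AX; apply/AE; apply: (@sums1 _ _ _ J Aj _ j). Qed.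

(** A summand is closed under linkage, so it contains the component of any of
    its local objects X; the local objects which are not connected to X
    generate a complement, which is zero if the summand is indecomposable. *)
Lemma indecomposable_component (J : Type) (Aj : J -> fg -> Prop) X j :
  @decomposition (stmod H) J Aj T -> @indecomposable (stmod H) (Aj j) ->
  ind_ob X -> Aj j X -> Aj j = component X.
Proof.
move=> dec [_ indec] iX AX; have /decompositionP[hT AE hd] := dec.
have AT Z : Aj j Z -> T Z := decomposition_sub dec.
have subT Z : ind_ob Z -> conn X Z -> T Z by move=> [].
have CA Z : component X Z -> Aj j Z.
  move=> cZ; apply: (gen_min (hT j) _ cZ) => W [iW cW].
  exact: conn_summand dec subT AX cW.
pose R := gen (fun Y => [/\ ind_ob Y, Aj j Y & ~ conn X Y]).
have RA Z : R Z -> Aj j Z by move=> rZ; apply: (gen_min (hT j) _ rZ) => W [].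
have dj : disj (component X) R.
  apply: (gen_disj coH) => X' Y' [iX' cX'] [iY' _ nc].
  by apply: contrapT => l; apply: nc; apply: conn1 cX' iX' iY' l.
have dec2 : @decomposition (stmod H) bool (fun b : bool => if b then component X else R) (Aj j).
  have hT2 (b : bool) : tideal (if b then component X else R).
    by case: b; apply: gen_tideal.
  apply/decompositionP; split=> // [Z|[] [] //= _]; last exact: disj_sym.
  split=> [|DZ].
    have tS : tideal (all_sums (fun b : bool => if b then component X else R)).
      apply: (sums_tideal coH) => // -[] [] //= _; exact: disj_sym.
    apply: local_gen (hT j) AT tS _ _ => Y iY AY; have [c|nc] := EM (conn X Y).
      by apply: (@sums1 _ _ _ bool _ _ true) => //; apply: gen_mem.
    by apply: (@sums1 _ _ _ bool _ _ false) => //; apply: gen_mem.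
  by apply: (sums_min (hT j)) DZ => -[] Y _ /=; [apply: CA|apply: RA].
have [/zero_subcatP z|/zero_subcatP z] := indec _ _ dec2.
  by have [_ X0 _] := iX; case: X0; apply: z (component_self iX).
apply: funext => Z; apply: propext; split; last exact: CA.
apply: local_gen (hT j) AT (component_tideal X) _ _ => Y iY AY.
have [c|nc] := EM (conn X Y); first exact: gen_mem.
by have [_ Y0 _] := iY; case: Y0; apply: z; apply: gen_mem.
Qed.

Lemma krull_schmidt : @has_unique_Krull_Schmidt (stmod H) T.
Proof.
exists comp_index, (fun A => sval A); split.
  split; first exact: component_decomposition.
  by case=> A [X [iX e]] /=; rewrite e; apply: component_indecomposable.
move=> J Aj [dec indec]; have /decompositionP[hT AE hd] := dec.
have ex (a : comp_index) : exists j, Aj j = sval a.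
  case: a => A [X [iX e]] /=; rewrite e.
  have TX : T X by case: iX.
  have [j AX] := ind_ob_summand dec iX TX; exists j.
  exact: indecomposable_component dec (indec j) iX AX.
have ex' j : exists a : comp_index, Aj j = sval a.
  have [/zero_subcatP nz _] := indec j.
  have [X [iX AX]] := ind_ob_ex (hT j) (fun X => decomposition_sub (j := j) (X := X) dec) nz.
  have e := indecomposable_component dec (indec j) iX AX.
  have eX : exists Y, ind_ob Y /\ Aj j = component Y by exists X.
  by exists (exist (fun A => exists Y, ind_ob Y /\ A = component Y) (Aj j) eX).
pose s a := projT1 (cid (ex a)); pose t j := projT1 (cid (ex' j)).
have sE a : Aj (s a) = sval a by rewrite /s; case: cid.
have tE j : Aj j = sval (t j) by rewrite /t; case: cid.
exists s; split; last by move=> a X; rewrite sE.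
have sv (a b : comp_index) : sval a = sval b -> a = b.
  by case: a => A eA; case: b => A' eA' /= e; apply: eq_exist.
exists t => [a|j]; first by apply: sv; rewrite -tE sE.
apply: contrapT => ne; have [/zero_subcatP nz _] := indec j; apply: nz => X AX.
by apply: (hd _ _ ne) => //; rewrite sE -tE.
Qed.
End Components.
End KrullSchmidt.

(** * Grothendieck groups *)

Section Grothendieck.
Variables (k : fieldType) (B : falgType k) (H : hopf_algebra B).
Variable coH : graded_cocommutative H.
Local Notation fg := (fgmod H).
Local Notation "g ** f" := (scomp g f) (at level 40, left associativity).
Local Notation word A := (@K0word (stmod H) A).
Local Notation obj A := {X : ob (stmod H) | A X}.

Section Words.
Variable A : fg -> Prop.
Implicit Types u v w : word A.

Lemma K0_catl w u v : K0eq u v -> K0eq (w ++ u) (w ++ v).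
Proof. by move=> e; apply: K0cat e; apply: K0refl. Qed.
Lemma K0_catr w u v : K0eq u v -> K0eq (u ++ w) (v ++ w).
Proof. by move=> e; apply: K0cat e _; apply: K0refl. Qed.
Lemma K0_swap (a b c d : word A) : K0eq ((a ++ b) ++ (c ++ d)) ((a ++ c) ++ (b ++ d)).
Proof.
rewrite -!catA; apply: K0_catl; rewrite !catA; apply: K0_catr; exact: K0comm.
Qed.

Definition wneg (u : word A) : word A := [seq (~~ x.1, x.2) | x <- u].
Lemma K0_negr u : K0eq (u ++ wneg u) [::].
Proof.
elim: u => [|[b X] u IH]; first exact: K0refl.
apply: K0trans (K0_swap [:: (b, X)] u [:: (~~ b, X)] (wneg u)) _.
apply: K0trans (K0cat (K0opp b X) IH) _; exact: K0refl.
Qed.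
Lemma K0_neg u v : K0eq u v -> K0eq (wneg u) (wneg v).
Proof.
move=> e; apply: K0trans (_ : K0eq _ (wneg u ++ (v ++ wneg v))) _.
  rewrite -{1}[wneg u]cats0; apply: K0_catl; apply: K0sym; exact: K0_negr.
rewrite catA; apply: K0trans (_ : K0eq _ ((wneg u ++ u) ++ wneg v)) _.
  by apply/K0_catr/K0_catl/K0sym.
rewrite -{2}[wneg v]cat0s; apply: K0_catr; apply: K0trans (K0comm _ _) _.
exact: K0_negr.
Qed.
(** Relations are only given for positive letters; negating a word carries
    them over to negative ones. *)
Lemma K0_letter (b : bool) (X : obj A) v : K0eq [:: (true, X)] v ->
  K0eq [:: (b, X)] (if b then v else wneg v).
Proof. by case: b => // /K0_neg. Qed.

Lemma K0_siso (b : bool) (X Y : obj A) : siso (sval X) (sval Y) -> K0eq [:: (b, X)] [:: (b, Y)].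
Proof.
move=> /isomorphicP e; have := K0_letter b (K0iso e).
by case: b.
Qed.
Lemma K0_zero (b : bool) (X : obj A) : sid (sval X) = 0 -> K0eq [:: (b, X)] [::].
Proof.
move=> X0; suff h : K0eq [:: (true, X)] [::] by have := K0_letter b h; case: b.
have t : @has_triangle (stmod H) (sval X) (sval X) (sval X).
  by apply/has_triangleP/tri_bip/bip_0r.
apply: K0sym; apply: K0trans (K0sym (K0opp true X)) _.
apply: K0trans (K0_catr [:: (false, X)] (K0triangle t)) _ => /=.
by rewrite -[X in K0eq _ X]cats0; apply: (K0_catl [:: (true, X)] (K0opp true X)).
Qed.
Lemma K0_bip (X Y Z : obj A) : bip (sval X) (sval Y) (sval Z) ->
  K0eq [:: (true, Z)] [:: (true, X); (true, Y)].
Proof. by move=> b; apply: K0triangle; apply/has_triangleP/tri_bip. Qed.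
End Words.

Section WordMaps.
Variables (A A' : fg -> Prop).
Definition wmap (m : obj A -> obj A') (u : word A) : word A' := [seq (x.1, m x.2) | x <- u].
Lemma wmap_cat m u v : wmap m (u ++ v) = wmap m u ++ wmap m v.
Proof. exact: map_cat. Qed.
Lemma K0_wmap (m : obj A -> obj A') :
  (forall X Y, siso (sval X) (sval Y) -> siso (sval (m X)) (sval (m Y))) ->
  (forall X Y Z, tri (sval X) (sval Y) (sval Z) -> tri (sval (m X)) (sval (m Y)) (sval (m Z))) ->
  forall u v, K0eq u v -> K0eq (wmap m u) (wmap m v).
Proof.
move=> mi mt u v; elim=> {u v}.
- by move=> u; apply: K0refl.
- by move=> u v _; apply: K0sym.
- by move=> u v w _ h1 _; apply: K0trans.
- by move=> u u' v v' _ h1 _ h2; rewrite !wmap_cat; apply: K0cat.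
- by move=> u v; rewrite !wmap_cat; apply: K0comm.
- by move=> b X; apply: K0opp.
- by move=> X Y /isomorphicP e; apply/K0iso/isomorphicP/mi.
by move=> X Y Z /has_triangleP e; apply/K0triangle/has_triangleP/mt.
Qed.
Fixpoint letters (P : obj A -> Prop) (u : word A) : Prop :=
  if u is x :: u' then P x.2 /\ letters P u' else True.
Lemma lettersT (P : obj A -> Prop) u : (forall X, P X) -> letters P u.
Proof. by move=> h; elim: u => //= x u IH; split. Qed.
Lemma letters_cat P u v : letters P (u ++ v) <-> letters P u /\ letters P v.
Proof.
elim: u => [|x u IH] /=; first by split=> [|[]].
by rewrite IH; split=> [[? [? ?]]|[[? ?] ?]].
Qed.
Lemma letters_mono (P Q : obj A -> Prop) u : (forall X, P X -> Q X) -> letters P u -> letters Q u.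
Proof. by move=> h; elim: u => //= x u IH [/h ? /IH ?]. Qed.
Lemma K0_wmap_eq (m m' : obj A -> obj A') u :
  letters (fun X => siso (sval (m X)) (sval (m' X))) u -> K0eq (wmap m u) (wmap m' u).
Proof.
elim: u => [|[b X] u IH] /=; first by move=> _; apply: K0refl.
move=> [e /IH h]; apply: (K0cat (u := [:: (b, m X)]) (u' := [:: (b, m' X)])) h.
exact: K0_siso.
Qed.
Lemma K0_wmap_zero (m : obj A -> obj A') u :
  letters (fun X => sid (sval (m X)) = 0) u -> K0eq (wmap m u) [::].
Proof.
elim: u => [|[b X] u IH] /=; first by move=> _; apply: K0refl.
move=> [e /IH h]; apply: (K0cat (u := [:: (b, m X)]) (u' := [::])) h.
exact: K0_zero.
Qed.
End WordMaps.

Section Family.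
Variables (I : eqType) (Ti : I -> fg -> Prop).
Hypothesis hT : forall i, tideal (Ti i).
Hypothesis hd : forall i j, i <> j -> disj (Ti i) (Ti j).
Local Notation T := (sums Ti (fun=> True)).

Lemma pr_ex (X : obj T) i : exists Xi : obj (Ti i), exists X',
  bip (sval Xi) X' (sval X) /\ sums Ti (fun j => j <> i) X'.
Proof.
have [Xi [X' [b TX DX]]] := sums_split hT i (svalP X).
exists (exist _ Xi TX), X'; split=> //.
by apply: sums_mono DX => j [].
Qed.
Definition pr i (X : obj T) : obj (Ti i) := projT1 (cid (pr_ex X i)).
Lemma prP i (X : obj T) : exists X',
  bip (sval (pr i X)) X' (sval X) /\ sums Ti (fun j => j <> i) X'.
Proof. by rewrite /pr; case: cid. Qed.
Lemma pr_uniq i (X : obj T) X1 X2 : bip X1 X2 (sval X) -> Ti i X1 ->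
  sums Ti (fun j => j <> i) X2 -> siso X1 (sval (pr i X)).
Proof.
move=> b TX DX; have [X' [b' DX']] := prP i X.
exact: (comp_uniq coH hT hd (siso_refl _) b b' TX (svalP _) DX DX').
Qed.
Lemma pr_siso i (X Y : obj T) : siso (sval X) (sval Y) -> siso (sval (pr i X)) (sval (pr i Y)).
Proof.
move=> e; have [X' [b DX]] := prP i X; have [Y' [b' DY]] := prP i Y.
exact: (comp_uniq coH hT hd e b b' (svalP _) (svalP _) DX DY).
Qed.
Lemma orth1 i (X Y : fg) : Ti i X -> sums Ti (fun j => j <> i) Y -> forall s : shom X Y, s = 0.
Proof.
move=> TX DY; apply: (sums_orth coH hT hd (J := fun j => j = i)) DY => [j -> //|].
exact: sums1 TX.
Qed.
Lemma orth2 i (X Y : fg) : Ti i X -> sums Ti (fun j => j <> i) Y -> forall s : shom Y X, s = 0.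
Proof.
move=> TX DY; apply: (sums_orth coH hT hd (J' := fun j => j = i)) DY _ => [j //|].
exact: sums1 TX.
Qed.
(** The fibre of Y -> Z is the sum of the fibres of the diagonal entries, one
    of which is in T_i and the other a sum of objects of the other ideals; by
    pr_uniq the first is the component of X. *)
Lemma pr_tri i (X Y Z : obj T) : tri (sval X) (sval Y) (sval Z) ->
  tri (sval (pr i X)) (sval (pr i Y)) (sval (pr i Z)).
Proof.
move=> [X1 [Y1 [Z1 [f [g [ex iX iY iZ]]]]]].
have [Y' [bY DY]] := prP i Y; have [Z' [bZ DZ]] := prP i Z.
have bY1 := bip_siso bY iY; have bZ1 := bip_siso bZ iZ.
have [K1 [K2 [bK t1 t2]]] := fib_bip ex bY1 bZ1 (orth1 (svalP _) DZ) (orth2 (svalP _) DY).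
apply: (tri_iso _ _ _ t1); try exact: siso_refl.
apply: pr_uniq (bip_siso bK (siso_sym iX)) _ _.
  by have [_ h _] := ti_tri (hT i) t1; apply: h; apply: svalP.
by have [_ h _] := ti_tri (sums_tideal coH hT hd (fun j => j <> i)) t2; apply: h.
Qed.
Definition inc i (X : obj (Ti i)) : obj T := exist (fun X : fg => T X) (sval X) (sums1 (J := fun=> True) Logic.I (svalP X)).
Lemma pr_inc i (X : obj (Ti i)) : siso (sval X) (sval (pr i (inc X))).
Proof.
apply: (pr_uniq (X2 := fzero H)) (svalP X) _; first exact/bip_0r/fzero0.
exact/sums0/fzero0.
Qed.
Lemma pr_zero i J (X : obj T) : ~ J i -> sums Ti J (sval X) -> sid (sval (pr i X)) = 0.
Proof.
move=> nJ DX; have [X' [b _]] := prP i X.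
apply: (sums_disj coH hT hd (J := J) (J' := fun j => j = i)) => [j Jj e||].
- by apply: nJ; rewrite -e.
- exact: (sums_ret hT (bip_ret1 b) DX).
by apply: (sums1 (i := i)) (svalP _).
Qed.
Lemma pr_inc_zero i j (X : obj (Ti i)) : i <> j -> sid (sval (pr j (inc X))) = 0.
Proof.
move=> ij; apply: (pr_zero (J := fun l => l = i)) => [e|]; first by rewrite e in ij.
by apply: sums1 (svalP X).
Qed.

(** The homomorphism from K_0 of the sum to the product of the K_0(T_i), on
    words. *)
Definition phi (u : word T) (i : I) : word (Ti i) := wmap (pr i) u.
(** The inverse homomorphism, for families supported on s. *)
Definition flat (s : seq I) (w : forall i, word (Ti i)) : word T :=
  flatten [seq wmap (@inc i) (w i) | i <- s].

Lemma K0_phi u v i : K0eq u v -> K0eq (phi u i) (phi v i).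
Proof. by apply: K0_wmap => *; [apply: pr_siso|apply: pr_tri]. Qed.
Lemma K0_inc i (u v : word (Ti i)) : K0eq u v -> K0eq (wmap (@inc i) u) (wmap (@inc i) v).
Proof. exact: K0_wmap. Qed.
Lemma flat_eq s w w' : (forall i, i \in s -> K0eq (w i) (w' i)) -> K0eq (flat s w) (flat s w').
Proof.
elim: s => [|i s IH] h; first exact: K0refl.
apply: K0cat; first by apply/K0_inc/h; rewrite inE eqxx.
by apply: IH => j js; apply: h; rewrite inE js orbT.
Qed.
Lemma flat_cat s w w' : K0eq (flat s (fun i => w i ++ w' i)) (flat s w ++ flat s w').
Proof.
elim: s => [|i s IH]; first exact: K0refl.
rewrite /flat /= wmap_cat.
exact: K0trans (K0cat (K0refl _) IH) (K0_swap _ _ _ _).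
Qed.
Lemma flat_neg s w : wneg (flat s w) = flat s (fun i => wneg (w i)).
Proof.
elim: s => [//|i s IH]; rewrite /flat /= -/(flat s _) /wneg map_cat -/(wneg (flat s w)) IH.
by congr (_ ++ _); rewrite /wmap -!map_comp.
Qed.

(** An object is the direct sum of its components, so its class is the sum of
    their classes. The components are split off one at a time. *)
Lemma K0_object s : uniq s -> forall X : obj T, sums Ti (fun j => j \in s) (sval X) ->
  K0eq [:: (true, X)] (flat s (fun i => [:: (true, pr i X)])).
Proof.
elim: s => [|i s IH] /=.
  by move=> _ X DX; apply: K0_zero; apply: sums_empty DX.
move=> /andP[is_ us] X DX.
have [X1 [X2 [b TX DX2]]] := sums_split hT i DX.
have DX2' : sums Ti (fun j => j \in s) X2.
  by apply: sums_mono DX2 => j []; rewrite inE => /orP[/eqP //|].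
pose Xi : obj (Ti i) := exist _ X1 TX.
have TX2 : T X2 by apply: sums_mono DX2.
pose Xr : obj T := exist _ X2 TX2.
apply: K0trans (K0_bip (X := inc Xi) (Y := Xr) (Z := X) b) _.
apply: (K0cat (u := [:: (true, inc Xi)]) (v := [:: (true, Xr)])).
  apply: K0_siso => /=; apply: (pr_uniq b TX).
  by apply: sums_mono DX2 => j [].
apply: K0trans (IH us Xr DX2') _; apply: flat_eq => j js; apply: K0_siso.
have [R [bR DR]] := prP j Xr.
have [U [bU bX]] := bip_assoc bR (bip_sym b).
apply: pr_uniq bX (svalP _) _; apply: sums2 bU DR _.
apply: (sums1 (i := i) _ TX) => e; by rewrite e js in is_.
Qed.

Lemma K0_word s u : uniq s -> letters (fun X => sums Ti (fun j => j \in s) (sval X)) u ->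
  K0eq u (flat s (phi u)).
Proof.
move=> us; elim: u => [|[b X] u IH] /=.
  move=> _; have -> : flat s (phi [::]) = [::] by elim: s {us} => //= i s IHs; rewrite /flat /= -/(flat s _) IHs.
  exact: K0refl.
move=> [DX /IH h].
apply: K0trans (_ : K0eq _ (flat s (fun i => [:: (b, pr i X)]) ++ flat s (phi u))) _.
  apply: (K0cat (u := [:: (b, X)])) h.
  have := K0_letter b (K0_object us DX); case: b => //.
  by rewrite flat_neg.
apply: K0sym; exact: (flat_cat s (fun i => [:: (b, pr i X)]) (phi u)).
Qed.

Lemma word_support (u : word T) : exists s, uniq s /\ letters (fun X => sums Ti (fun j => j \in s) (sval X)) u.
Proof.
elim: u => [|[b X] u [s [us h]]]; first by exists [::].
have [r DX] := sums_fin (svalP X).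
exists (undup (r ++ s)); split; first exact: undup_uniq.
split.
  by apply: sums_mono DX => j [jr _]; rewrite mem_undup mem_cat jr.
by apply: letters_mono h => Y; apply: sums_mono => j js; rewrite mem_undup mem_cat js orbT.
Qed.

Lemma flatten_notin s w i : i \notin s -> K0eq (phi (flat s w) i) [::].
Proof.
elim: s => [|j s IH]; first by move=> _; apply: K0refl.
rewrite inE negb_or => /andP[ij /IH h]; rewrite /flat /= /phi wmap_cat.
apply: (K0cat (u' := [::])) h; rewrite {1}/wmap -map_comp.
apply: (@K0_wmap_zero _ _ (fun X => pr i (inc X))); apply: lettersT => X.
by apply: pr_inc_zero => e; rewrite e eqxx in ij.
Qed.
Lemma flatten_in s w i : uniq s -> i \in s -> K0eq (phi (flat s w) i) (w i).
Proof.
elim: s => [//|j s IH] /= /andP[js us]; rewrite inE /flat /= /phi wmap_cat.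
case: eqVneq => [e _|ij /= is_].
  rewrite -e in js *; rewrite -[X in K0eq _ X]cats0.
  apply: K0cat; last exact: flatten_notin.
  rewrite /wmap -map_comp.
  rewrite -[X in K0eq _ X]map_id.
  apply: K0trans (_ : K0eq _ (wmap id (w i))) _; last first.
    by rewrite /wmap; elim: (w i) => [|[b X] u IHu] /=; [apply: K0refl|apply: (K0_catl [:: (b, X)])].
  apply: (@K0_wmap_eq _ _ (fun X => pr i (inc X)) id); apply: lettersT => X.
  exact/siso_sym/pr_inc.
rewrite -[X in K0eq _ X]cat0s; apply: K0cat; last exact: IH.
rewrite /wmap -map_comp.
apply: (@K0_wmap_zero _ _ (fun X => pr i (inc X))); apply: lettersT => X.
by apply: pr_inc_zero => e; rewrite e eqxx in ij.
Qed.

(** Every word involves finitely many ideals, so on it phi is inverted by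
    flat. *)
Lemma K0_sum : @K0_direct_sum (stmod H) I Ti T.
Proof.
exists phi; split.
- move=> u v; split=> [e i|h]; first exact: K0_phi.
  have [s [us /letters_cat[hu hv]]] := word_support (u ++ v).
  apply: K0trans (K0_word us hu) _; apply: K0trans _ (K0sym (K0_word us hv)).
  by apply: flat_eq => i _; apply: h.
- by move=> u v i; rewrite /phi wmap_cat; apply: K0refl.
- move=> u; have [s [us hu]] := word_support u.
  exists (size s), (tnth (in_tuple s)) => i; have [is_|is_] := boolP (i \in s).
    left; have lt : (index i s < size s)%N by rewrite index_mem.
    by exists (Ordinal lt); rewrite (tnth_nth i) /= nth_index.
  right; apply: K0_wmap_zero; apply: letters_mono hu => X DX.
  by apply: pr_zero DX; apply/negP.
move=> w [n [s hs]].
pose r := undup (codom s); exists (flat r w) => i.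
have [ir|ir] := boolP (i \in r); first by apply: flatten_in => //; apply: undup_uniq.
have [[j e]|h] := hs i; last exact: K0trans (flatten_notin w ir) (K0sym h).
by case/negP: ir; rewrite mem_undup -e codom_f.
Qed.
End Family.
End Grothendieck.

Theorem theorem6p1 (k : fieldType) (p : nat) (char_k : p \in [pchar k]%R)
    (B : falgType k) (H : hopf_algebra B) (coH : graded_cocommutative H)
    (tpp : tensor_product_property H) :
  (forall T : subcat (stmod H), thick_ideal T -> has_unique_Krull_Schmidt T)
  /\
  (forall (I : Type) (Ti : I -> subcat (stmod H)),
     (forall i, thick_ideal (Ti i)) ->
     (forall i j, i <> j -> trivial_intersection (Ti i) (Ti j)) ->
     exists T : subcat (stmod H),
       [/\ thick_ideal T, decomposition Ti T & K0_direct_sum Ti T]).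
Proof.
split=> [T /thick_tideal tT|I Ti tT dT]; first exact: krull_schmidt.
(* The supports in the direct sum are lists of indices, whose membership is
   decided by a classical equality test on I. *)
have hT (i : {classic I}) : tideal (Ti i) by apply/thick_tideal/tT.
have hd (i j : {classic I}) : i <> j -> disj (Ti i) (Ti j).
  by move=> ij; apply/disjP/dT.
exists (sums (I := {classic I}) Ti (fun=> True)); split.
- by apply/thick_tideal/(sums_tideal coH hT hd).
- by apply/decompositionP; split.
exact: (@K0_sum _ _ _ coH {classic I} Ti hT hd).
Qed.
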